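(* Let $f,g\in\mathbb{F}\setminus\mathbb{K}$ be given by minimal admissible linear systems $\mathcal{A}_f=(u_f,A_f,v_f)$ and $\mathcal{A}_g=(u_g,A_g,v_g)$ of dimension $n_f$ and $n_g$ respectively, and let $n=n_f+n_g$. Suppose that $f$ is a left factor of $fg$. Then a minimal admissible linear system $\mathcal{A}$ for $fg$ is given as follows: (a) if $1\in L(f)$, then $\mathcal{A}$ is the system of the type $(1,* )$ multiplication construction, with $\dim\mathcal{A}=n-1$; (b) if $1\in R(g)$, then $\mathcal{A}$ is the system of the type $( *,1)$ multiplication construction, with $\dim\mathcal{A}=n-1$; (c) if $1\notin R(g)$ and $1\notin L(f)$, then $$\mathcal{A}=\left(\begin{bmatrix} u_f & 0 \end{bmatrix},\begin{bmatrix} A_f & -v_f u_g \\ 0 & A_g \end{bmatrix},\begin{bmatrix} 0 \\ v_g \end{bmatrix}\right),$$ with $\dim\mathcal{A}=n$.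
   Context: Let $\mathbb{K}$ be a commutative field, $X=\{x_1,\dots,x_d\}$ a finite non-empty alphabet, $\mathbb{K}\langle X\rangle$ the free associative algebra and $\mathbb{F}$ its universal field of fractions (the free field). A linear representation of $f\in\mathbb{F}$ of dimension $n$ is a triple $\pi=(u,A,v)$ with $u\in\mathbb{K}^{1\times n}$, $v\in\mathbb{K}^{n\times 1}$, $A=A_0+A_1x_1+\dots+A_dx_d$ with $A_\ell\in\mathbb{K}^{n\times n}$, $A$ invertible over $\mathbb{F}$, and $f=uA^{-1}v$. It is minimal if $n$ is smallest possible among all linear representations of $f$; this $n$ is $\operatorname{rank}(f)$. It is an admissible linear system (ALS) if $u=e_1=[1,0,\dots,0]$; $(1,A,\lambda)$ denotes an ALS with $v=[0,\dots,0,\lambda]^\top$, $\lambda\in\mathbb{K}$. An admissible transformation of an ALS $(u,A,v)$ is a pair of invertible $P,Q\in\mathbb{K}^{n\times n}$ with first row of $Q$ equal to $e_1$; it gives the ALS $(uQ,PAQ,Pv)$ for the same element. $L(\pi)$ and $R(\pi)$ are the $\mathbb{K}$-linear spans of the entries of $A^{-1}v$ and $uA^{-1}$ respectively; for minimal $\pi$ they depend only on $f$ and are denoted $L(f)$ and $R(f)$. For non-zero $h\in\mathbb{F}$, a non-zero $f\in\mathbb{F}$ is a left factor of $h$ if $\operatorname{rank}(f)+\operatorname{rank}(f^{-1}h)\le\operatorname{rank}(h)+1$ and $\operatorname{rank}(h^{-1}f)+\operatorname{rank}(f^{-1})\le\operatorname{rank}(h^{-1})+1$. Type $(1,* )$ multiplication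 construction. If $1\in L(f)$, the minimal system $\mathcal{A}_f$ can be brought by an admissible transformation into the form $$\mathcal{A}_f=\left(\begin{bmatrix} 1 & 0 & 0 \end{bmatrix},\begin{bmatrix} a & b' & b \\ a' & B & b'' \\ 0 & 0 & 1 \end{bmatrix},\begin{bmatrix} 0 \\ 0 \\ \lambda_f \end{bmatrix}\right)$$ (diagonal blocks of sizes $1$, $n_f-2$, $1$), and $\mathcal{A}_g$ into the form $(1,A_g,\lambda_g)$. The constructed system is then $$\left(\begin{bmatrix} 1 & 0 & 0 \end{bmatrix},\begin{bmatrix} a & b' & \lambda_f b u_g \\ a' & B & \lambda_f b'' u_g \\ 0 & 0 & A_g \end{bmatrix},\begin{bmatrix} 0 \\ 0 \\ v_g \end{bmatrix}\right).$$ Type $( *,1)$ multiplication construction. If $1\in R(g)$, the minimal system $\mathcal{A}_g$ can be brought by an admissible transformation into the form $$\mathcal{A}_g=\left(\begin{bmatrix} 1 & 0 & 0 \end{bmatrix},\begin{bmatrix} 1 & b' & b \\ 0 & B & b'' \\ 0 & c' & c \end{bmatrix},\begin{bmatrix} 0 \\ 0 \\ \lambda_g \end{bmatrix}\right)$$ (diagonal blocks of sizes $1$, $n_g-2$, $1$), and $\mathcal{A}_f$ into the form $(1,A_f,\lambda_f)$. The constructed system is then $$\left(\begin{bmatrix} u_f & 0 & 0 \end{bmatrix},\begin{bmatrix} A_f & e_{n_f}\lambda_f b' & e_{n_f}\lambda_f b \\ 0 & B & b'' \\ 0 & c' & c \end{bmatrix},\begin{bmatrix} 0 \\ 0 \\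 \lambda_g \end{bmatrix}\right),$$ where $e_{n_f}$ is the last unit column vector of size $n_f$. *)

(* Defs.v *)
From HB Require Import structures.
From mathcomp Require Import all_boot all_order all_algebra.
From mathcomp Require Export monalg.

Set Implicit Arguments.
Unset Strict Implicit.
Unset Printing Implicit Defensive.

Import GRing.Theory.
Local Open Scope ring_scope.

(* The free associative algebra on the alphabet x_0, ..., x_(d-1): the algebra
   of the free monoid (words) over 'I_d. *)
Notation "{ 'freealg' K , d }" := {malg K[{fmonom 'I_d}]}
  (at level 0, K at level 99, d at level 99, format "{ 'freealg'  K ,  d }")
  : type_scope.

Section FreeField.

(* MathComp has no structure for skew fields; [unitRingType] includes 1 != 0. *)
Definition is_skew_field (D : unitRingType) : Prop :=
  forall x : D, x != 0 -> x \is a GRing.unit.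

Variable R : nzRingType.

Definition is_Rsubring (D : unitRingType) (phi : R -> D) (S : D -> Prop) :
    Prop :=
  [/\ forall r, S (phi r),
      forall x y, S x -> S y -> S (x - y)
    & forall x y, S x -> S y -> S (x * y)].

(* An epic R-field: a skew field D with a ring morphism R -> D whose image
   generates D as a skew field. *)
Definition is_epic_field (D : unitRingType) (phi : {rmorphism R -> D}) : Prop :=
  is_skew_field D /\
  forall S : D -> Prop, is_Rsubring phi S ->
    (forall x, S x -> x != 0 -> S x^-1) -> forall x, S x.

(* P. M. Cohn's specializations: morphisms of R-rings h from an R-subring S of
   U to D such that the elements of S outside ker h are invertible in S.
   Only the restriction of h to S matters. *)
Definition specialization (U D : unitRingType) (iota : R -> U) (phi : R -> D) :
    Prop :=
  exists (S : U -> Prop) (h : U -> D),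
  [/\ is_Rsubring iota S,
      forall r, h (iota r) = phi r,
      forall x y, S x -> S y -> h (x - y) = h x - h y,
      forall x y, S x -> S y -> h (x * y) = h x * h y
    & forall x, S x -> h x != 0 -> S x^-1].

(* The universal epic R-field is the initial object of the category of epic
   R-fields and specializations, where two specializations are identified when
   they agree on a common domain which still defines a specialization.  Any two
   specializations from an epic R-field are identified (their equalizer
   defines one), so only existence is required.  It is a field of fractions
   when R embeds in it. *)
Definition is_universal_field_of_fractions (U : unitRingType)
    (iota : {rmorphism R -> U}) : Prop :=
  [/\ is_epic_field iota,
      injective iota
    & forall (D : unitRingType) (phi : {rmorphism R -> D}),
        is_epic_field phi -> specialization iota phi].

End FreeField.

(* A triple (u, A, v) packaged with its dimension. *)
Record linsys (K : fieldType) (d : nat) := LinSys {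
  sdim : nat;
  lhs : 'rV[K]_sdim;
  mat : 'M[{freealg K, d}]_sdim;
  rhs : 'cV[K]_sdim
}.

Section Systems.

Variables (K : fieldType) (d : nat).
Local Notation KX := {freealg K, d}.

Definition var (l : 'I_d) : KX := << fmu l >>.

(* scalar matrices seen over K<X> *)
Definition cst (m n : nat) (M : 'M[K]_(m, n)) : 'M[KX]_(m, n) :=
  map_mx (in_alg KX) M.

Definition is_linear_mx (n : nat) (A : 'M[KX]_n) : Prop :=
  exists (A0 : 'M[K]_n) (Al : 'I_d -> 'M[K]_n),
    A = cst A0 + \sum_(l < d) map_mx (fun c => c *: var l) (Al l).

Definition e_first (n : nat) : 'rV[K]_n := \row_j (j == 0%N :> nat)%:R.
Definition e_last (n : nat) : 'cV[K]_n := \col_i (i.+1 == n :> nat)%:R.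

Definition transform (S : linsys K d) (P Q : 'M[K]_(sdim S)) : linsys K d :=
  LinSys (lhs S *m Q) (cst P *m mat S *m cst Q) (P *m rhs S).

Definition adm_transf (S S' : linsys K d) : Prop :=
  exists P Q : 'M[K]_(sdim S),
    [/\ P \in unitmx, Q \in unitmx,
        forall i : 'I_(sdim S), i = 0%N :> nat -> row i Q = e_first (sdim S)
      & S' = transform P Q].

(* The system denoted (1, A, lambda). *)
Definition als1 (n : nat) (A : 'M[KX]_n) (lambda : K) : linsys K d :=
  LinSys (e_first n) A (lambda *: e_last n).

Section Type1Star.

Variables (m : nat) (a : 'M[KX]_1) (b' : 'rV[KX]_m) (b : 'M[KX]_1).
Variables (a' : 'cV[KX]_m) (B : 'M[KX]_m) (b'' : 'cV[KX]_m) (lambda_f : K).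

Definition form_f1 : linsys K d :=
  @LinSys K d (1 + m + 1)
    (row_mx (row_mx 1%:M 0) 0)
    (block_mx (block_mx a b' a' B) (col_mx b b'')
              0                    1%:M)
    (col_mx 0 lambda_f%:M).

Definition mul_1star (Sg : linsys K d) : linsys K d :=
  @LinSys K d (1 + m + sdim Sg)
    (row_mx (row_mx 1%:M 0) 0)
    (block_mx (block_mx a b' a' B)
              (col_mx ((lambda_f%:A *: b) *m cst (lhs Sg))
                      ((lambda_f%:A *: b'') *m cst (lhs Sg)))
              0 (mat Sg))
    (col_mx 0 (rhs Sg)).

End Type1Star.

Section TypeStar1.

Variables (m : nat) (b' : 'rV[KX]_m) (b : 'M[KX]_1) (B : 'M[KX]_m).
Variables (b'' : 'cV[KX]_m) (c' : 'rV[KX]_m) (c : 'M[KX]_1) (lambda_g : K).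

Definition form_1g : linsys K d :=
  @LinSys K d (1 + (m + 1))
    (row_mx 1%:M 0)
    (block_mx 1%:M (row_mx b' b)
              0    (block_mx B b'' c' c))
    (col_mx 0 (col_mx 0 lambda_g%:M)).

Definition mul_star1 (n : nat) (Af : 'M[KX]_n) (lambda_f : K) : linsys K d :=
  @LinSys K d (n + (m + 1))
    (row_mx (e_first n) 0)
    (block_mx Af (row_mx (cst (lambda_f *: e_last n) *m b')
                         (cst (lambda_f *: e_last n) *m b))
              0  (block_mx B b'' c' c))
    (col_mx 0 (col_mx 0 lambda_g%:M)).

End TypeStar1.

Definition mul_star_star (Sf Sg : linsys K d) : linsys K d :=
  @LinSys K d (sdim Sf + sdim Sg)
    (row_mx (lhs Sf) 0)
    (block_mx (mat Sf) (- (cst (rhs Sf) *m cst (lhs Sg)))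
              0        (mat Sg))
    (col_mx 0 (rhs Sg)).

Variables (F : unitAlgType K) (iota : KX -> F).

(* [map_mx iota (mat S)] is the matrix of the system over F; [unitmx] only
   applies over commutative rings. *)
Definition inverse_mat (S : linsys K d) (Ai : 'M[F]_(sdim S)) : Prop :=
  map_mx iota (mat S) *m Ai = 1%:M /\ Ai *m map_mx iota (mat S) = 1%:M.

Definition over_F (m n : nat) (M : 'M[K]_(m, n)) : 'M[F]_(m, n) :=
  map_mx (in_alg F) M.

Definition is_linrep (S : linsys K d) (f : F) : Prop :=
  is_linear_mx (mat S) /\
  exists2 Ai : 'M[F]_(sdim S), inverse_mat Ai &
    f = (over_F (lhs S) *m Ai *m over_F (rhs S)) 0 0.

Definition is_minimal (S : linsys K d) (f : F) : Prop :=
  is_linrep S f /\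
  forall S' : linsys K d, is_linrep S' f -> (sdim S <= sdim S')%N.

Definition is_minimal_als (S : linsys K d) (f : F) : Prop :=
  is_minimal S f /\ lhs S = e_first (sdim S).

Definition is_rank (f : F) (r : nat) : Prop :=
  exists2 S : linsys K d, is_minimal S f & sdim S = r.

(* x \in L(pi), resp. x \in R(pi) *)
Definition in_L_sys (S : linsys K d) (x : F) : Prop :=
  exists (Ai : 'M[F]_(sdim S)) (k : 'I_(sdim S) -> K), inverse_mat Ai /\
    x = \sum_i k i *: (Ai *m over_F (rhs S)) i 0.

Definition in_R_sys (S : linsys K d) (x : F) : Prop :=
  exists (Ai : 'M[F]_(sdim S)) (k : 'I_(sdim S) -> K), inverse_mat Ai /\
    x = \sum_j k j *: (over_F (lhs S) *m Ai) 0 j.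

(* x \in L(f), resp. x \in R(f): L(pi) and R(pi) are the same for all minimal
   linear representations pi of f. *)
Definition in_L (f x : F) : Prop :=
  exists2 S : linsys K d, is_minimal S f & in_L_sys S x.

Definition in_R (f x : F) : Prop :=
  exists2 S : linsys K d, is_minimal S f & in_R_sys S x.

(* rank(f) + rank(g) <= rank(h) + 1 *)
Definition rank_le (f g h : F) : Prop :=
  exists p q r : nat,
    [/\ is_rank f p, is_rank g q, is_rank h r & (p + q <= r + 1)%N].

Definition left_factor (f h : F) : Prop :=
  [/\ f != 0, h != 0, rank_le f (f^-1 * h) h & rank_le (h^-1 * f) f^-1 h^-1].

End Systems.

(* Main.v *)
(** A linear representation [f = u A^-1 v] is minimal if and only if the entries of
    [s = A^-1 v] and those of [t = u A^-1] are linearly independent over [K], and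
    then its spans [L(f)] and [R(f)] do not depend on it (Cohn and Reutenauer).
    All this rests on one property of the free field: a square pencil that is not
    invertible is hollow, i.e. equivalent over [K] to one with an [r x s] block
    of zeros, [r + s > n].  By universality, a non-invertible pencil is singular
    over the Malcev-Neumann field of the free group, ordered through the Magnus
    embedding.  There one may assume that the entries of a null vector that are
    linearly independent over [K] have distinct leading terms [a_j]; counting
    the vertices of the Cayley forest spanned by the edges from [a_j] to
    [x_i a_j] shows that the products [x_i e_j] satisfy few linear relations.

    In (a) and (b), the construction has dimension [n_f + n_g - 1], which is the
    lower bound given by the first rank inequality. In (c), suppose that the
    entries of [s_f g] and [s_g] are dependent. The same bound allows only one
    dependency, and as [1] is not in [L(f)], it yields a non-scalar linear
    polynomial [Q] with [l = Q^-1 in L(f)]. Since [1] is not in [R(g)], the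
    elements [1] and [l] lie in [L(g^-1)], while [l f^-1] lies in [L(f^-1)].
    This gives two dependencies in the product system of [g^-1] and [f^-1],
    against the second rank inequality. Hence the system of (c) has independent
    left and, by symmetry, right entries, and it is minimal. *)

Require Import Defs.
From HB Require Import structures.
From mathcomp Require Import all_boot all_order all_algebra all_fingroup.
From mathcomp Require Import boolp classical_sets functions cardinality fsbigop.
From mathcomp Require Import zify.

Set Implicit Arguments.
Unset Strict Implicit.
Unset Printing Implicit Defensive.

(* [Defs] again, since [functions] has a [cst] of its own *)
Import Defs Order.TTheory GRing.Theory Num.Theory.
Local Open Scope ring_scope.

(** * Matrices over skew fields *)

(** The theory of representations is developed for any skew field [F] with central scalars [kap] and
    generators [y] that satisfies [hollowP]. It then applies verbatim to the converse ring [F^c],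
    and statements on right families follow from those on left families by transposition.

    [hollowP] acts through one count: [m] elements independent over [K] satisfy at most [m]
    independent relations with coefficients affine in the generators and constant right-hand sides
    ([key1]). A system with independent left family attains this bound, so every further relation of
    this kind is a combination of its rows. The count gives the uniqueness of the spans and the
    normal forms of (a) and (b).

    The delicate point of (c) is that [l f^-1] lies in [L(f^-1)]: the inverse system only places it
    in [K + L(f^-1)]. The same count removes the constant, because [Q] is not a scalar.

    Universality serves in one direction only: a matrix over the free algebra that is injective over
    some skew field is invertible over the free field. Elimination over the domain of a
    specialization proves this, each pivot having nonzero image. *)

Definition invertible_mx (R : nzRingType) n (M : 'M[R]_n) :=
  exists N : 'M[R]_n, M *m N = 1%:M /\ N *m M = 1%:M.

Section InvertibleMx.

Variable R : nzRingType.

Lemma invertible_mxM n (M N : 'M[R]_n) :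
  invertible_mx M -> invertible_mx N -> invertible_mx (M *m N).
Proof.
move=> [M' [MM' M'M]] [N' [NN' N'N]]; exists (N' *m M'); split.
  by rewrite mulmxA -[_ *m N *m _]mulmxA NN' mulmx1.
by rewrite mulmxA -[_ *m M' *m _]mulmxA M'M mulmx1.
Qed.

Lemma invertible_lower n1 n2 (M : 'M[R]_(n2, n1)) :
  invertible_mx (block_mx (1%:M : 'M_n1) 0 M (1%:M : 'M_n2)).
Proof.
by exists (block_mx 1%:M 0 (- M) 1%:M); rewrite !mulmx_block !mulmx1 !mul1mx
  !mul0mx !mulmx0 !addr0 !add0r ?subrr ?addNr -scalar_mx_block.
Qed.

Lemma invertible_upper n1 n2 (M : 'M[R]_(n1, n2)) :
  invertible_mx (block_mx (1%:M : 'M_n1) M 0 (1%:M : 'M_n2)).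
Proof.
by exists (block_mx 1%:M (- M) 0 1%:M); rewrite !mulmx_block !mulmx1 !mul1mx
  !mul0mx !mulmx0 !addr0 !add0r ?subrr ?addNr -scalar_mx_block.
Qed.

Lemma invertible_diag n1 n2 (A : 'M[R]_n1) (B : 'M[R]_n2) :
  invertible_mx A -> invertible_mx B -> invertible_mx (block_mx A 0 0 B).
Proof.
move=> [A' [AA' A'A]] [B' [BB' B'B]]; exists (block_mx A' 0 0 B').
by rewrite !mulmx_block !mulmx0 !mul0mx !addr0 !add0r AA' A'A BB' B'B
  -scalar_mx_block.
Qed.

Lemma invertible_ublock n1 n2 (A : 'M[R]_n1) (B : 'M[R]_n2) C :
  invertible_mx A -> invertible_mx B -> invertible_mx (block_mx A C 0 B).
Proof.
move=> iA iB; have [A' [AA' A'A]] := iA.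
have -> : block_mx A C 0 B = block_mx A 0 0 B *m block_mx 1%:M (A' *m C) 0 1%:M.
  by rewrite mulmx_block !mulmx1 !mulmx0 !mul0mx !addr0 !add0r mulmxA AA' mul1mx.
by apply: invertible_mxM; [exact: invertible_diag|exact: invertible_upper].
Qed.

Lemma invertible_perm n (s : 'S_n) : invertible_mx (perm_mx s : 'M[R]_n).
Proof.
by exists (perm_mx s^-1%g); rewrite -!perm_mxM mulgV mulVg perm_mx1.
Qed.

End InvertibleMx.

Section LocalElimination.

(* [h] is only meaningful on [S], the domain of a specialization *)
Variables (U D : unitRingType) (S : U -> Prop) (h : U -> D).
Hypothesis D_skew : is_skew_field D.
Hypothesis S1 : S 1.
Hypothesis SB : forall x y, S x -> S y -> S (x - y).
Hypothesis SM : forall x y, S x -> S y -> S (x * y).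
Hypothesis SV : forall x, S x -> h x != 0 -> S x^-1.
Hypothesis h1 : h 1 = 1.
Hypothesis hB : forall x y, S x -> S y -> h (x - y) = h x - h y.
Hypothesis hM : forall x y, S x -> S y -> h (x * y) = h x * h y.
Hypothesis U_skew : is_skew_field U.

Let h0 : h 0 = 0. Proof. by rewrite -(subrr 1) hB// subrr. Qed.

(** Gaussian elimination inside the local ring [S]. Injectivity of the image provides an entry of
    the first column with nonzero image; by [SV] the inverse of this pivot stays in [S], so the
    Schur complement has entries in [S] and, again, injective image. *)
Lemma local_elimination n (M : 'M[U]_n) : (forall i j, S (M i j)) ->
  (forall w : 'cV[D]_n, map_mx h M *m w = 0 -> w = 0) -> invertible_mx M.
Proof.
elim: n M => [|n IH] M SM' inj.
  by exists M; split; rewrite [LHS]thinmx0 [RHS]thinmx0.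
have [i hi] : exists i, h (M i ord0) != 0.
  apply/existsP; apply: contraT; rewrite negb_exists => /forallP z.
  have : map_mx h M *m (delta_mx ord0 ord0 : 'cV[D]_n.+1) = 0.
    apply/matrixP => i j; rewrite !mxE (bigD1 ord0)//= !mxE !eqxx ord1 eqxx mulr1.
    have /negbNE/eqP -> := z i; rewrite big1 ?addr0// => k k0.
    by rewrite !mxE (negPf k0) mulr0.
  move=> /inj/matrixP/(_ ord0 ord0).
  by rewrite !mxE !eqxx => /eqP; rewrite oner_eq0.
pose M1 : 'M[U]_(1 + n) := xrow i ord0 M.
suff iM1 : invertible_mx M1.
  have -> : M = tperm_mx i ord0 *m M1.
    by rewrite /M1 xrowE mulmxA -perm_mxM tperm2 perm_mx1 mul1mx.
  by apply: invertible_mxM => //; exact: invertible_perm.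
have S1' k j : S (M1 k j) by rewrite /M1 !mxE; exact: SM'.
have inj1 (w : 'cV[D]_(1 + n)) : map_mx h M1 *m w = 0 -> w = 0.
  move=> w0; apply: inj.
  have -> : map_mx h M = tperm_mx i ord0 *m map_mx h M1.
    by rewrite map_xrow xrowE mulmxA -perm_mxM tperm2 perm_mx1 mul1mx.
  by rewrite -mulmxA w0 mulmx0.
set p := M1 (lshift n ord0) (lshift n ord0).
have hp : h p != 0.
  have -> : p = M i ord0; last exact: hi.
  rewrite /p /M1 mxE; congr (M _ _); last exact: val_inj.
  by rewrite (_ : lshift n ord0 = ord0 :> 'I_(1 + n)) ?tpermR//; apply: val_inj.
have Sp : S p by exact: S1'.
have up : p \is a GRing.unit.
  by apply: U_skew; apply: contraNneq hp => ->; rewrite h0.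
have hpV : h p^-1 = (h p)^-1.
  have u : h p \is a GRing.unit by exact: D_skew.
  apply: (mulrI u); rewrite -hM//; last exact: SV.
  by rewrite !divrr.
move: M1 S1' inj1 @p hp Sp up hpV => M1 S1' inj1 p hp Sp up hpV.
have pE : ulsubmx M1 = p%:M.
  by apply/matrixP => k j; rewrite !mxE !ord1 eqxx mulr1n.
pose c := dlsubmx M1; pose r := ursubmx M1.
pose E := drsubmx M1 - c *m p^-1%:M *m r.
have M1E : M1 = block_mx 1%:M 0 (c *m p^-1%:M) 1%:M *m block_mx p%:M 0 0 E
     *m block_mx 1%:M (p^-1%:M *m r) 0 1%:M.
  rewrite !mulmx_block !mulmx1 !mul1mx !mulmx0 !mul0mx !addr0 !add0r.
  rewrite -[LHS](submxK (m1 := 1) (n1 := 1)) pE -[X in block_mx _ _ X _ = _]/c.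
  congr block_mx; first by rewrite mulmxA -scalar_mxM mulrV// mul1mx.
    by rewrite -mulmxA -scalar_mxM mulVr// mulmx1.
  rewrite -!mulmxA [p%:M *m _]mulmxA -scalar_mxM mulrV// mul1mx /E mulmxA.
  by rewrite addrC subrK.
rewrite M1E; apply: invertible_mxM; last exact: invertible_upper.
apply: invertible_mxM; first exact: invertible_lower.
apply: invertible_diag.
  by exists p^-1%:M; rewrite -!scalar_mxM mulrV// mulVr.
have Eij k j : E k j = M1 (rshift 1 k) (rshift 1 j) -
    M1 (rshift 1 k) (lshift n ord0) * p^-1 * M1 (lshift n ord0) (rshift 1 j).
  by rewrite !mxE big_ord1 !mxE big_ord1 !mxE eqxx mulr1n.
have Sc k j : S (M1 (rshift 1 k) (lshift n ord0) * p^-1 * M1 (lshift n ord0) (rshift 1 j)).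
  by apply: (SM (SM _ (SV _ _))).
apply: IH => [k j|w' w0]; first by rewrite Eij; apply: SB.
pose c' : 'cV_n := map_mx h c; pose r' : 'rV_n := map_mx h r.
have hE : map_mx h E = map_mx h (drsubmx M1) - c' *m (h p)^-1%:M *m r'.
  apply/matrixP => k j; rewrite mxE Eij (hB (S1' _ _) (Sc _ _)).
  rewrite (hM (SM (S1' _ _) (SV Sp hp)) (S1' _ _)).
  rewrite (hM (S1' _ _) (SV Sp hp)) hpV.
  by rewrite !mxE big_ord1 !mxE big_ord1 !mxE eqxx mulr1n.
(* A null vector [w'] of the image of the Schur complement extends to one of the image of [M1], the
   pivot row forcing the first entry. *)
have := inj1 (col_mx (- ((h p)^-1%:M *m r' *m w')) w').
rewrite -[M1](submxK (m1 := 1) (n1 := 1)) pE map_block_mx mul_block_col.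
have -> : map_mx h p%:M = (h p)%:M :> 'M_1.
  by apply/matrixP => k j; rewrite !mxE !ord1 eqxx !mulr1n.
rewrite !mulmxN -[map_mx h (ursubmx _)]/r' -[map_mx h (dlsubmx _)]/c'.
rewrite !mulmxA -scalar_mxM mulrV ?D_skew// mul1mx addNr.
rewrite hE mulmxBl in w0.
rewrite addrC w0 col_mx0 => /(_ erefl) /eqP; rewrite col_mx_eq0 => /andP[_ /eqP].
by [].
Qed.

End LocalElimination.

Section SkewLinearAlgebra.

Variable F : unitRingType.
Hypothesis F_skew : is_skew_field F.

Lemma injective_invertible n (M : 'M[F]_n) :
  (forall w : 'cV[F]_n, M *m w = 0 -> w = 0) -> invertible_mx M.
Proof.
move=> inj; apply: (@local_elimination F F (fun=> True) id) => //.
by move=> w; rewrite map_mx_id//; exact: inj.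
Qed.

Lemma left_inv_invertible n (M N : 'M[F]_n) : N *m M = 1%:M -> M *m N = 1%:M.
Proof.
move=> NM; have [] := @injective_invertible _ M.
  by move=> w Mw; rewrite -[w]mul1mx -NM -mulmxA Mw mulmx0.
move=> N' [MN' _]; suff -> : N = N' by [].
by rewrite -[N]mulmx1 -MN' mulmxA NM mul1mx.
Qed.

End SkewLinearAlgebra.

(** * Matrix pencils and independence over the centre *)

(** Coefficients of an affine matrix [A_0 + A_1 x_1 + ... + A_q x_q]; the index [ord0] is the
    constant term, whence [y ord0 = 1] below. *)
Definition pencil (K : fieldType) q m n := 'I_q.+1 -> 'M[K]_(m, n).

Definition hollow (K : fieldType) q n (A : pencil K q n n) :=
  exists r s (P : 'M[K]_(r, n)) (Q : 'M[K]_(n, s)),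
    [/\ row_free P, row_free Q^T, (n < r + s)%N &
      forall k, P *m A k *m Q = 0].

Section Pencils.

Variables (K : fieldType) (F : unitRingType) (kap : {rmorphism K -> F}).
Hypothesis kapC : forall a x, kap a * x = x * kap a.
Variables (q : nat) (y : 'I_q.+1 -> F).
Hypothesis y0 : y ord0 = 1.

Local Notation pencil := (pencil K q).
Local Notation km := (map_mx kap).

Definition ev m n (A : pencil m n) : 'M[F]_(m, n) :=
  \matrix_(i, j) \sum_k kap (A k i j) * y k.

Definition pindep m n (A : pencil m n) :=
  forall c : 'rV[K]_m, (forall k, c *m A k = 0) -> c = 0.

Definition indep m (e : 'cV[F]_m) :=
  forall c : 'rV[K]_m, km c *m e = 0 -> c = 0.

Lemma eq_ev m n (A B : pencil m n) : (forall k, A k = B k) -> ev A = ev B.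
Proof.
by move=> AB; apply/matrixP => i j; rewrite !mxE; apply: eq_bigr => k _; rewrite AB.
Qed.

Lemma evMl m n p (P : 'M_(m, n)) (A : pencil n p) :
  ev (fun k => P *m A k) = km P *m ev A.
Proof.
apply/matrixP => i j; rewrite !mxE.
under [RHS]eq_bigr do rewrite !mxE mulr_sumr.
rewrite exchange_big; apply: eq_bigr => k _ /=.
rewrite !mxE rmorph_sum mulr_suml; apply: eq_bigr => l _.
by rewrite rmorphM mulrA.
Qed.

Lemma evMr m n p (A : pencil m n) (Q : 'M_(n, p)) :
  ev (fun k => A k *m Q) = ev A *m km Q.
Proof.
apply/matrixP => i j; rewrite !mxE.
under [RHS]eq_bigr do rewrite !mxE mulr_suml.
rewrite exchange_big; apply: eq_bigr => k _ /=.
rewrite !mxE rmorph_sum mulr_suml; apply: eq_bigr => l _.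
by rewrite rmorphM -!mulrA; congr (_ * _); exact: kapC.
Qed.

Lemma ev_row_mx m n p (A : pencil m n) (B : pencil m p) :
  ev (fun k => row_mx (A k) (B k)) = row_mx (ev A) (ev B).
Proof.
apply/matrixP => i j; rewrite mxE; case: (split_ordP j) => l ->;
  rewrite (row_mxEl, row_mxEr) mxE; apply: eq_bigr => k _;
  by rewrite (row_mxEl, row_mxEr).
Qed.

Lemma ev_col_mx m n p (A : pencil m n) (B : pencil p n) :
  ev (fun k => col_mx (A k) (B k)) = col_mx (ev A) (ev B).
Proof.
apply/matrixP => i j; rewrite mxE; case: (split_ordP i) => l ->;
  rewrite (col_mxEu, col_mxEd) mxE; apply: eq_bigr => k _;
  by rewrite (col_mxEu, col_mxEd).
Qed.

Lemma ev_block_mx m n p r (A : pencil m n) (B : pencil m p) (C : pencil r n)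
    (D : pencil r p) :
  ev (fun k => block_mx (A k) (B k) (C k) (D k)) =
  block_mx (ev A) (ev B) (ev C) (ev D).
Proof. by rewrite /block_mx ev_col_mx !ev_row_mx. Qed.

Definition pconst m n (M : 'M[K]_(m, n)) : pencil m n :=
  fun k => if k == ord0 then M else 0.

Lemma ev_const m n (M : 'M_(m, n)) : ev (pconst M) = km M.
Proof.
apply/matrixP => i j; rewrite !mxE (bigD1 ord0)//= /pconst eqxx y0 mulr1.
by rewrite big1 ?addr0// => k /negPf ->; rewrite mxE rmorph0 mul0r.
Qed.

Lemma kap_inj : injective kap. Proof. exact: fmorph_inj. Qed.

Lemma km_inj m n : injective (fun M : 'M[K]_(m, n) => km M).
Proof.
move=> M N /matrixP MN; apply/matrixP => i j.
by move: (MN i j); rewrite !mxE => /kap_inj.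
Qed.

Lemma km_eq0 m n (M : 'M[K]_(m, n)) : km M = 0 -> M = 0.
Proof. by move=> M0; apply: km_inj; rewrite M0 map_mx0. Qed.

Lemma km_unit n (P : 'M[K]_n) : P \in unitmx -> invertible_mx (km P).
Proof.
by move=> uP; exists (km (invmx P)); rewrite -!map_mxM ?mulmxV ?mulVmx ?map_mx1.
Qed.

Lemma indep_mul m n (P : 'M_(n, m)) (e : 'cV[F]_m) :
  row_free P -> indep e -> indep (km P *m e).
Proof.
move=> fP ie c; rewrite mulmxA -map_mxM => /ie cP.
by apply: (row_free_inj fP); rewrite mul0mx.
Qed.

Lemma indep_row_free m n (C : 'M_(n, m)) (e : 'cV[F]_m) :
  indep (km C *m e) -> row_free C.
Proof.
move=> ie; rewrite -kermx_eq0; apply/eqP/row_matrixP => i; rewrite row0.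
by apply: ie; rewrite mulmxA -map_mxM -row_mul mulmx_ker row0 map_mx0 mul0mx.
Qed.

Lemma pindep_mul m n p (P : 'M_(p, m)) (A : pencil m n) :
  row_free P -> pindep A -> pindep (fun k => P *m A k).
Proof.
move=> fP iA c cPA; apply: (row_free_inj fP); rewrite mul0mx.
by apply: iA => k; rewrite -mulmxA.
Qed.

Lemma pindep_ev n (A : pencil n n) : invertible_mx (ev A) -> pindep A.
Proof.
move=> [N [AN _]] c cA; apply: km_eq0.
rewrite -[km c]mulmx1 -AN mulmxA -evMl.
have -> : ev (fun k => c *m A k) = 0.
  by apply/matrixP => i j; rewrite !mxE big1// => k _; rewrite cA mxE rmorph0 mul0r.
by rewrite mul0mx.
Qed.

(** With all coefficients side by side, independence of the rows of a pencil becomes the rank of a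
    single matrix over [K]. *)
Lemma flat_eq0 m n (A : pencil m n) p (c : 'M[K]_(p, m)) :
  c *m \mxrow_k A k = 0 <-> forall k, c *m A k = 0.
Proof.
rewrite mul_mxrow -mxrow0; split=> [/eq_mxrowP //|H].
exact/eq_mxrowP.
Qed.

Lemma pindep_base m n (A : pencil m n) :
  exists2 P : 'M_(\rank (\mxrow_k A k), m), row_free P & pindep (fun k => P *m A k).
Proof.
set X := \mxrow_k A k.
have [P PX] : exists P, row_base X = P *m X.
  by apply/submxP; rewrite eq_row_base.
have fB := row_base_free X.
have inj (c : 'rV_(\rank X)) : (forall k, c *m (P *m A k) = 0) -> c = 0.
  move=> cPA; apply: (row_free_inj fB); rewrite mul0mx PX mulmxA.
  by apply/flat_eq0 => k; rewrite -mulmxA.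
exists P => //; rewrite -kermx_eq0; apply/eqP/row_matrixP => i; rewrite row0.
by apply: inj => k; rewrite mulmxA -row_mul mulmx_ker row0 mul0mx.
Qed.

Lemma dep_reduce m (c : 'rV[K]_(1 + m)) (e : 'cV[F]_(1 + m)) :
  c != 0 -> km c *m e = 0 -> exists (X : 'M[K]_(1 + m, m)) e1, e = km X *m e1.
Proof.
(* The first row of [row_ebase c] is proportional to [c], so the first entry of [B e] vanishes and
   the others generate [e]. *)
move=> c0 ce; pose B : 'M[K]_(1 + m) := row_ebase c.
have Be : usubmx (km B *m e) = 0.
  move: ce; rewrite -[c]mulmx_ebase rank_rV c0 -/B.
  have -> : (pid_mx 1 : 'M[K]_(1, 1 + m)) = row_mx 1%:M 0.
    by rewrite pid_mx_row.
  rewrite !map_mxM map_row_mx map_mx1 map_mx0 -!mulmxA.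
  rewrite -[km B *m e](vsubmxK (m1 := 1)) mul_row_col mul1mx mul0mx addr0.
  rewrite vsubmxK => E; have := col_ebase_unit c => /km_unit [N' [_ N'c]].
  by rewrite -[usubmx _]mul1mx -N'c -mulmxA E mulmx0.
have eE : e = km (invmx B) *m (km B *m e).
  by rewrite mulmxA -map_mxM mulVmx ?map_mx1 ?mul1mx// row_ebase_unit.
exists (rsubmx (invmx B)), (dsubmx (km B *m e)).
rewrite {1}eE -[km B *m e](vsubmxK (m1 := 1)) Be.
rewrite -[X in km X](hsubmxK (n1 := 1)) map_row_mx mul_row_col mulmx0 add0r.
by rewrite ?row_mxKr ?col_mxKd.
Qed.

(** Take a factorization [s = C e] with the fewest entries in [e]: a rank defect of [C] or a
    dependency in [e] would shorten it. *)
Lemma indep_basis N (s : 'cV[F]_N) : exists m (C : 'M[K]_(N, m)) C' (e : 'cV_m),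
  [/\ indep e, s = km C *m e & C' *m C = 1%:M].
Proof.
pose P m := `[< exists (C : 'M[K]_(N, m)) (e : 'cV_m), s = km C *m e >].
have exP : exists m, P m.
  by exists N; apply/asboolP; exists 1%:M, s; rewrite map_mx1 mul1mx.
case: (ex_minnP exP) => m /asboolP[C [e sE]] mmin.
have small m' C1 e1 : s = map_mx kap (C1 : 'M[K]_(N, m')) *m e1 -> (m <= m')%N.
  by move=> E; apply: mmin; apply/asboolP; exists C1, e1.
have fC : row_full C.
  rewrite /row_full eqn_leq rank_leq_col /=.
  apply: (small _ (col_base C) (km (row_base C) *m e)).
  by rewrite mulmxA -map_mxM mulmx_base.
have [C' C'C] := row_fullP fC.
exists m, C, C', e; split=> // c ce; apply/eqP; apply: contraT => c0.
case: m => [|m] in C e sE mmin small fC C' C'C c ce c0 *.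
  by rewrite [c]thinmx0 eqxx in c0.
have [X [e1 eE]] := dep_reduce c0 ce.
have := small _ (C *m X) e1; rewrite map_mxM -mulmxA -eE => /(_ sE).
by rewrite ltnn.
Qed.

Section Hollow.

Hypothesis hollowP : forall n (A : pencil n n),
  ~ invertible_mx (ev A) -> hollow A.

(* The left spans satisfy [dim (W + sum x_i W) > d * dim W]. *)
Lemma key m (e : 'cV[F]_m) s (A : pencil s m) :
  indep e -> pindep A -> ev A *m e = 0 -> (0 < m)%N -> (s < m)%N.
Proof.
have [n] := ubnP m; elim: n m e s A => // n IH m e s A mn ie iA Ae m0.
rewrite ltnNge; apply/negP => ms.
(* If [m <= s], the first [m] rows form a square pencil that kills [e], hence a hollow one. *)
pose A' k := (pid_mx m : 'M[K]_(m, s)) *m A k.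
have iA' : pindep A'.
  by apply: pindep_mul iA; rewrite /row_free rank_pid_mx.
have A'e : ev A' *m e = 0 by rewrite evMl -mulmxA Ae mulmx0.
have [|r [t [P [Q [fP fQ rt PAQ]]]]] := @hollowP m A'.
  move=> [N [_ NA]]; have e0 : e = 0 by rewrite -[e]mul1mx -NA -mulmxA A'e mulmx0.
  have : const_mx 1 = 0 :> 'rV[K]_m by apply: ie; rewrite e0 mulmx0.
  by move/matrixP/(_ ord0 (Ordinal m0))/eqP; rewrite !mxE oner_eq0.
(* The zero block places the rows of [P *m A' k] in the left kernel of [Q], of dimension
   [m - t < r]. Factored through its basis [N], they give a smaller counterexample: [r] independent
   relations on the fewer entries of [N e]. *)
pose N := row_base (kermx Q); pose nu : nat := \rank (kermx Q).
have nuE : nu = (m - t)%N.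
  by rewrite /nu mxrank_ker -mxrank_tr; move/eqP: fQ => ->.
pose D k := P *m A' k *m pinvmx N.
have DN k : D k *m N = P *m A' k.
  rewrite /D mulmxKpV// eq_row_base; apply/sub_kermxP; exact: PAQ.
have ie' : indep (km N *m e) by apply: indep_mul ie; exact: row_base_free.
have De : ev D *m (km N *m e) = 0.
  by rewrite mulmxA -evMr (eq_ev DN) evMl -mulmxA A'e mulmx0.
have iD : pindep D.
  move=> c cD; have iPA : pindep (fun k => P *m A' k) by exact: pindep_mul.
  by apply: iPA => k; rewrite -DN mulmxA cD mul0mx.
have rm : (r <= m)%N by move/eqP: fP => <-; exact: rank_leq_col.
have tm : (t <= m)%N by move/eqP: fQ => <-; exact: rank_leq_col.
have r0 : (nu < r)%N by rewrite nuE; lia.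
case: (posnP nu) => [nu0|nu0].
  have : const_mx 1 = 0 :> 'rV[K]_r.
    apply: iD => k; apply/matrixP => i [j jlt]; exfalso.
    by move: jlt; rewrite -/nu nu0.
  move/matrixP/(_ ord0 (Ordinal (leq_ltn_trans (leq0n _) r0)))/eqP.
  by rewrite !mxE oner_eq0.
have nun : (nu < n)%N by lia.
by have := IH _ _ _ D nun ie' iD De nu0; rewrite ltnNge (ltnW r0).
Qed.

(** The combinations of rows that kill [v] have codimension at most one and obey the strict bound of
    [key]; constant right-hand sides thus cost one relation. *)
Lemma key1 m (e : 'cV[F]_m) s (A : pencil s m) (v : 'cV[K]_s) :
  indep e -> ev A *m e = km v ->
  (forall c : 'rV[K]_s, (forall k, c *m A k = 0) -> c *m v = 0 -> c = 0) ->
  (s <= m)%N.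
Proof.
move=> ie Ae iA; case: (posnP m) => [m0|m0].
  have v0 : v = 0.
    apply: km_eq0; rewrite -Ae; apply/matrixP => i j; rewrite !mxE big1// => k _.
    by move: (ltn_ord k); rewrite {2}m0.
  rewrite m0 leqn0; apply: contraT; rewrite -lt0n => s0.
  have /matrixP/(_ ord0 (Ordinal s0)) : const_mx 1 = 0 :> 'rV[K]_s.
    apply: iA => [k|]; last by rewrite v0 mulmx0.
    by apply/matrixP => i j; move: (ltn_ord j); rewrite {2}m0.
  by rewrite !mxE => /eqP; rewrite oner_eq0.
pose P := row_base (kermx v).
have Pv : P *m v = 0 by apply/sub_kermxP; rewrite eq_row_base.
have fP : row_free P by exact: row_base_free.
have iPA : pindep (fun k => P *m A k).
  move=> c cPA; apply: (row_free_inj fP); rewrite mul0mx; apply: iA => [k|].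
    by rewrite -mulmxA.
  by rewrite -mulmxA Pv mulmx0.
have := key ie iPA _ m0; rewrite evMl -mulmxA Ae -map_mxM Pv map_mx0.
move=> /(_ erefl); rewrite mxrank_ker.
have := rank_leq_col v; lia.
Qed.

End Hollow.

End Pencils.

Arguments eq_ev {K F kap q y m n A B}.

(** * Spans of linear representations *)

Section Representations.

Variables (K : fieldType) (F : unitRingType) (kap : {rmorphism K -> F}).
Variables (q : nat) (y : 'I_q.+1 -> F).

Local Notation pencil := (pencil K q).
Local Notation km := (map_mx kap).
Local Notation ev := (ev kap y).
Local Notation indep := (indep kap).

Definition indepr m (t : 'rV[F]_m) :=
  forall c : 'cV[K]_m, t *m km c = 0 -> c = 0.

(* [s] and [t] are the left and right families [A^-1 v] and [u A^-1] *)
Definition isrep n (u : 'rV[K]_n) (A : pencil n n) (v : 'cV[K]_n)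
    (s : 'cV[F]_n) (t : 'rV[F]_n) (f : F) :=
  [/\ invertible_mx (ev A), ev A *m s = km v, t *m ev A = km u &
    km u *m s = f%:M].

Hypothesis F_skew : is_skew_field F.
Hypothesis kapC : forall a x, kap a * x = x * kap a.
Hypothesis y0 : y ord0 = 1.
Hypothesis hollowP : forall n (A : pencil n n),
  ~ invertible_mx (ev A) -> hollow A.

Let evMl := evMl kap y.
Let evMr := evMr kapC y.
Let key1 := key1 kapC hollowP.

Lemma isrep_tv n u A v s t f : @isrep n u A v s t f -> t *m km v = f%:M.
Proof. by move=> [_ As tA us]; rewrite -As mulmxA tA. Qed.

(** Each row lists all coefficients of one relation of the system [B e = w], so that ranks count
    independent relations. *)
Definition relmx m n (B : pencil m n) (w : 'cV[K]_m) := row_mx (\mxrow_k B k) w.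

Lemma relmxM m n p (c : 'M_(p, m)) (B : pencil m n) (w : 'cV_m) :
  c *m relmx B w = row_mx (\mxrow_k (c *m B k)) (c *m w).
Proof. by rewrite mul_mx_row mul_mxrow. Qed.

Lemma eq_relmx m n (B B' : pencil m n) (w w' : 'cV_m) :
  row_mx (\mxrow_k B k) w = row_mx (\mxrow_k B' k) w' ->
  (forall k, B k = B' k) /\ w = w'.
Proof. by move=> /eq_row_mx[/eq_mxrowP BB' ww']; split. Qed.

Lemma relmx_eq0 m n (B : pencil m n) (w : 'cV_m) p (c : 'M_(p, m)) :
  c *m relmx B w = 0 <-> (forall k, c *m B k = 0) /\ c *m w = 0.
Proof.
rewrite relmxM -row_mx0 -mxrow0; split=> [/eq_relmx//|[cB ->]].
by rewrite (eq_mxrow cB).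
Qed.

Lemma col_mx_mxrow m n p (B : pencil m n) (B' : pencil p n) :
  col_mx (\mxrow_k B k) (\mxrow_k B' k) = \mxrow_k col_mx (B k) (B' k).
Proof.
apply/mxrowP => k; rewrite mxrowK; apply/matrixP => i j.
rewrite /submxrow mxE; case: (split_ordP i) => l ->;
  rewrite (col_mxEu, col_mxEd) (col_mxEu, col_mxEd);
  by rewrite -?[in RHS](mxrowK B k) -?[in RHS](mxrowK B' k) !mxE.
Qed.

Lemma relation_rank m (e : 'cV[F]_m) n (B : pencil n m) (w : 'cV[K]_n) :
  indep e -> ev B *m e = km w -> (\rank (relmx B w) <= m)%N.
Proof.
move=> ie Be; have [P PX] : exists P, row_base (relmx B w) = P *m relmx B w.
  by apply/submxP; rewrite eq_row_base.
have fB := row_base_free (relmx B w).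
apply: (key1 (e := e) (A := fun k => P *m B k) (v := P *m w)) => //.
  by rewrite evMl -mulmxA Be -map_mxM.
move=> c cB cw; apply: (row_free_inj fB); rewrite mul0mx PX mulmxA.
by apply/relmx_eq0; split=> [k|]; rewrite -mulmxA.
Qed.

Lemma relmx_free n u A v s t f m (C : 'M_(n, m)) :
  @isrep n u A v s t f -> row_free C -> row_free (relmx (fun k => A k *m C) v).
Proof.
move=> [iA _ _ _] fC; apply: inj_row_free => c /relmx_eq0[cA _].
apply: (pindep_ev iA) => k; apply: (row_free_inj fC).
by rewrite mul0mx -mulmxA.
Qed.

(** The relations [A C e = v] on the independent entries of [e] have rank at most [m], so they
    follow from [m] relations [A2 e = v2]. The square matrix [A2] has the left inverse [C' A^-1 E],
    which suffices over a skew field. *)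
Lemma isrep_reduce n u A v s t f m (C : 'M_(n, m)) C' (e : 'cV_m) :
  isrep u A v s t f -> s = km C *m e -> C' *m C = 1%:M -> indep e ->
  exists (E : 'M_(n, m)) A2 v2,
    isrep (u *m C) A2 v2 e (t *m km E) f /\ row_free E^T.
Proof.
move=> [[Ai [AAi AiA]] As tA us] sE C'C ie.
pose R := relmx (fun k => A k *m C) v.
have rR : (\rank R <= m)%N.
  by apply: relation_rank ie _; rewrite evMr -mulmxA -sE.
(* A rank factorization of [R], padded with zeros to inner size [m]; the invertibility of [A2] shows
   afterwards that [E] has full column rank. *)
pose r : nat := \rank R.
pose E : 'M_(n, m) := col_base R *m pid_mx r.
pose Y : 'M_(m, _) := pid_mx r *m row_base R.
have REY : R = E *m Y.
  rewrite /E /Y mulmxA -[_ *m pid_mx r *m pid_mx r]mulmxA pid_mx_id//.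
  by rewrite pid_mx_1 mulmx1 mulmx_base.
pose A2 k := submxrow (lsubmx Y) k; pose v2 := rsubmx Y.
have [AC vE] : (forall k, A k *m C = E *m A2 k) /\ v = E *m v2.
  apply: eq_relmx; rewrite -[LHS]/R REY -[in LHS](hsubmxK Y) mul_mx_row.
  by rewrite -mul_mxrow submxrowK.
have kAC : ev A *m km C = km E *m ev A2 by rewrite -evMr (eq_ev AC) evMl.
have N1 : (km C' *m Ai *m km E) *m ev A2 = 1%:M.
  rewrite -!mulmxA -kAC [Ai *m _]mulmxA AiA mul1mx -map_mxM C'C.
  exact: map_mx1.
have N2 := left_inv_invertible F_skew N1.
have A2e : ev A2 *m e = km v2.
  rewrite -[LHS]mul1mx -[RHS]mul1mx -N2 -!mulmxA; do 3 congr (_ *m _).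
  by rewrite mulmxA -kAC -mulmxA -sE As vE map_mxM.
exists E, A2, v2; split; last first.
  apply: inj_row_free => c cE; apply: trmx_inj; rewrite trmx0; apply: (km_eq0 (kap := kap)).
  rewrite -[km c^T]mul1mx -N2 -!mulmxA -map_mxM -[E *m _]trmxK trmx_mul trmxK cE.
  by rewrite trmx0 map_mx0 !mulmx0.
split=> //; first by exists (km C' *m Ai *m km E).
  by rewrite -mulmxA -kAC mulmxA tA -map_mxM.
by rewrite map_mxM -mulmxA -sE.
Qed.

(** With [B] adjoined to [A] there are [n + 1] relations on [n] independent entries, so some
    combination of them is trivial. It involves [B], because the rows of an invertible pencil are
    independent. *)
Lemma relation_row n u (A : pencil n n) v s t f (B : pencil 1 n) (w : 'cV_1) :
  @isrep n u A v s t f -> indep s -> ev B *m s = km w ->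
  exists b : 'rV_n, (forall k, B k = b *m A k) /\ w = b *m v.
Proof.
move=> [iA As tA us] is_ Bs.
have [c [cA cv c0]] : exists c : 'rV_(n + 1),
    [/\ forall k, c *m col_mx (A k) (B k) = 0, c *m col_mx v w = 0 & c != 0].
  apply: contrapT => no; suff: (n + 1 <= n)%N by rewrite addn1 ltnn.
  apply: (key1 (e := s) (A := fun k => col_mx (A k) (B k))
    (v := col_mx v w)) => //.
    by rewrite ev_col_mx mul_col_mx As Bs map_col_mx.
  move=> c cA cv; apply/eqP; apply: contraT => c0; case: no; by exists c.
pose c1 := lsubmx c; pose a := rsubmx c 0 0.
have cE : c = row_mx c1 a%:M by rewrite -mx11_scalar hsubmxK.
have a0 : a != 0.
  apply: contraNneq c0 => a00; rewrite cE a00 raddf0; suff -> : c1 = 0 by rewrite row_mx0.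
  apply: (pindep_ev iA) => k; have := cA k.
  by rewrite cE a00 raddf0 mul_row_col mul0mx addr0.
exists (- a^-1 *: c1); split=> [k|].
  have := cA k; rewrite cE mul_row_col mul_scalar_mx => /eqP.
  rewrite addr_eq0 => /eqP E; rewrite -scalemxAl E scalerN scaleNr opprK.
  by rewrite scalerA mulVf// scale1r.
have := cv; rewrite cE mul_row_col mul_scalar_mx => /eqP.
rewrite addr_eq0 => /eqP E; rewrite -scalemxAl E scalerN scaleNr opprK.
by rewrite scalerA mulVf// scale1r.
Qed.

(** Write [s = C e] and [s' = C' e] over a common basis [e] of [m] elements. The two spans meet in
    dimension [nu = n + n' - m]; as at most [m] relations on [e] are independent, the two systems
    also share at least [nu] relations. The shared relations involve only the intersection of the
    spans and express [t] through [nu] elements. Independence of [t] forces [n <= nu], so the span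
    of [s] lies in that of [s']. *)
Lemma left_span_sub n u A v s t f n' u' A' v' s' t' :
  @isrep n u A v s t f -> @isrep n' u' A' v' s' t' f ->
  indep s -> indepr t -> indep s' -> exists X : 'M_(n, n'), s = km X *m s'.
Proof.
move=> rep rep' is_ it is'.
have [[Ai [AAi AiA]] As tA us] := rep; have [_ As' _ us'] := rep'.
have [m [CC [CC' [e [ie ssE CC1]]]]] := indep_basis kap (col_mx s s').
pose C := usubmx CC; pose C' := dsubmx CC.
have [sE s'E] : s = km C *m e /\ s' = km C' *m e.
  by apply: eq_col_mx; rewrite ssE -mul_col_mx -map_col_mx vsubmxK.
have fC : row_free C by apply: (indep_row_free (kap := kap) (e := e)); rewrite -sE; exact: is_.
have fC' : row_free C' by apply: (indep_row_free (kap := kap) (e := e)); rewrite -s'E; exact: is'.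
pose B k := A k *m C; pose B' k := A' k *m C'.
have Be : ev B *m e = km v by rewrite evMr -mulmxA -sE.
have Be' : ev B' *m e = km v' by rewrite evMr -mulmxA -s'E.
pose R1 := relmx B v; pose R2 := relmx B' v'.
have fR1 : \rank R1 = n by apply/eqP; exact: relmx_free rep fC.
have fR2 : \rank R2 = n' by apply/eqP; exact: relmx_free rep' fC'.
have rR : (\rank (R1 + R2)%MS <= m)%N.
  rewrite addsmxE; have -> : col_mx R1 R2 =
    relmx (fun k => col_mx (B k) (B' k)) (col_mx v v').
    by rewrite /R1 /R2 /relmx -block_mxEv block_mxEh col_mx_mxrow.
  apply: relation_rank ie _.
  by rewrite ev_col_mx mul_col_mx Be Be' -map_col_mx.
have rC : \rank (C + C')%MS = m.
  rewrite addsmxE vsubmxK; apply/eqP; apply/row_fullP; by exists CC'.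
have nuE := mxrank_sum_cap C C'.
rewrite rC (eqP fC) (eqP fC') in nuE.
have := mxrank_sum_cap R1 R2; rewrite fR1 fR2 => rhoE.
set nu := \rank (C :&: C')%MS in nuE.
have nurho : (nu <= \rank (R1 :&: R2))%N by lia.
have [b0 b0E] : exists b, row_base (R1 :&: R2)%MS = b *m R1.
  by apply/submxP; rewrite eq_row_base capmxSl.
have [b0' b0'E] : exists b, row_base (R1 :&: R2)%MS = b *m R2.
  by apply/submxP; rewrite eq_row_base capmxSr.
pose pd : 'M[K]_(nu, \rank (R1 :&: R2)%MS) := pid_mx nu.
pose b := pd *m b0; pose b' := pd *m b0'.
have bR : b *m R1 = b' *m R2 by rewrite -!mulmxA -b0E -b0'E.
have fb : row_free b.
  apply: inj_row_free => c; rewrite mulmxA => cb.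
  have fpd : row_free pd by rewrite /row_free rank_pid_mx.
  apply: (row_free_inj fpd); rewrite mul0mx.
  apply: (row_free_inj (row_base_free (R1 :&: R2)%MS)).
  by rewrite mul0mx b0E mulmxA cb mul0mx.
have [bB _] : (forall k, b *m B k = b' *m B' k) /\ b *m v = b' *m v'.
  by apply: eq_relmx; rewrite -!relmxM.
have [D DE] : exists D, row_base (C :&: C')%MS = D *m C.
  by apply/submxP; rewrite eq_row_base capmxSl.
(* A shared relation is a combination of rows of [C] and also of rows of [C']; hence [b A] factors
   through the basis [D] of the intersection. The row [u] does too, as both systems represent
   [f]. *)
pose A2 k := b *m B k *m pinvmx (row_base (C :&: C')%MS).
have bA k : b *m A k = A2 k *m D.
  apply: (row_free_inj fC); rewrite -[RHS]mulmxA -DE mulmxKpV.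
    by rewrite [RHS]mulmxA.
  by rewrite eq_row_base sub_capmx {2}bB !mulmxA !submxMl.
have uC : u *m C = u' *m C'.
  have E : km (u *m C) *m e = km (u' *m C') *m e.
    by rewrite !map_mxM -!mulmxA -sE -s'E us us'.
  apply/eqP; rewrite -subr_eq0; apply/eqP/ie.
  by rewrite map_mxB mulmxBl E subrr.
have [u2 u2E] : exists u2, u = u2 *m D.
  have /submxP[u2 u2E] : (u *m C <= row_base (C :&: C')%MS)%MS.
    by rewrite eq_row_base sub_capmx submxMl uC submxMl.
  by exists u2; apply: (row_free_inj fC); rewrite u2E DE mulmxA.
have evb : km b *m ev A = ev A2 *m km D by rewrite -evMl -evMr; apply: eq_ev.
have [bi bbi] := row_freeP fb.
pose N := km D *m Ai *m km bi.
have A2N : ev A2 *m N = 1%:M.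
  rewrite /N !mulmxA -evb -[km b *m _ *m _]mulmxA AAi mulmx1 -map_mxM bbi.
  exact: map_mx1.
have NA2 := left_inv_invertible F_skew A2N.
(* [t] solves [t A = u], and the square system [A2] already solves for [u2]: all of [t] comes from
   the [nu] rows of [b]. *)
have tE : t = km u2 *m N *m km b.
  rewrite -[t]mulmx1 -AAi mulmxA tA u2E map_mxM -!mulmxA; congr (_ *m _).
  rewrite -[km D *m Ai]mul1mx -NA2 -!mulmxA [ev A2 *m _]mulmxA -evb.
  by rewrite -[km b *m _ *m _]mulmxA AAi mulmx1.
have rb : row_free b^T.
  apply: inj_row_free => c cb; apply: trmx_inj; rewrite trmx0; apply: it.
  rewrite tE -!mulmxA -map_mxM -[b *m _]trmxK trmx_mul trmxK cb.
  by rewrite trmx0 map_mx0 !mulmx0.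
have nnu : (n <= nu)%N.
  by move/eqP: rb; rewrite mxrank_tr => <-; exact: rank_leq_row.
have : (C <= C :&: C')%MS.
  rewrite -(mxrank_leqif_sup (capmxSl C C')).
  by rewrite eqn_leq mxrankS ?capmxSl// (eqP fC).
move=> /submx_trans /(_ (capmxSr _ _)) /submxP[X XE].
by exists X; rewrite s'E mulmxA -map_mxM -XE.
Qed.

End Representations.

(** * The converse field *)

Section Converse.

Variables (K : fieldType) (F : unitRingType) (kap : {rmorphism K -> F}).

(** [kap] with values in the opposite ring; it is still multiplicative because [K] is
    commutative. *)
Definition ckap (a : K) : F^c := kap a.

Lemma ckap_zmod : zmod_morphism ckap.
Proof. by move=> a b; rewrite /ckap rmorphB. Qed.

Lemma ckap_monoid : monoid_morphism ckap.
Proof.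
by split=> [|a b]; rewrite /ckap ?rmorph1// mulrC rmorphM.
Qed.

HB.instance Definition _ := GRing.isZmodMorphism.Build K F^c ckap ckap_zmod.
HB.instance Definition _ := GRing.isMonoidMorphism.Build K F^c ckap ckap_monoid.

Variables (q : nat) (y : 'I_q.+1 -> F).
Hypothesis F_skew : is_skew_field F.
Hypothesis kapC : forall a x, kap a * x = x * kap a.
Hypothesis y0 : y ord0 = 1.

Let cy : 'I_q.+1 -> F^c := y.

Lemma invertible_tr n (M : 'M[F]_n) :
  invertible_mx M <-> invertible_mx (M^T : 'M[F^c]_n).
Proof.
split=> [[N [MN NM]]|[N [MN NM]]].
  exists (N^T : 'M[F^c]_n).
  by rewrite -[LHS]trmx_mul_rev -[X in _ /\ X = _]trmx_mul_rev MN NM trmx1.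
exists (N^T : 'M[F]_n); split; apply: trmx_inj.
  by rewrite trmx_mul_rev trmxK trmx1.
by rewrite trmx_mul_rev trmxK trmx1.
Qed.

Lemma ev_tr m n (A : pencil K q m n) :
  ev ckap cy (fun k => (A k)^T) = (ev kap y A)^T :> 'M[F^c]_(n, m).
Proof.
apply/matrixP => i j; rewrite !mxE; apply: eq_bigr => k _; rewrite mxE.
exact/esym/kapC.
Qed.

Lemma map_ckap m n (M : 'M[K]_(m, n)) :
  map_mx ckap M^T = (map_mx kap M)^T :> 'M[F^c]_(n, m).
Proof. by rewrite map_trmx. Qed.

(** Over [F^c] transposition exchanges [u] with [v] and [s] with [t]: the source of all right-handed
    results. *)
Lemma isrep_tr n u (A : pencil K q n n) v s t (f : F) :
  isrep kap y u A v s t f ->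
  isrep ckap cy v^T (fun k => (A k)^T) u^T (t^T : 'M[F^c]_(n, 1))
     (s^T : 'M[F^c]_(1, n)) (f : F^c).
Proof.
move=> rep; have tv := isrep_tv rep; have [iA As tA us] := rep; split.
- by rewrite ev_tr; apply/invertible_tr.
- by rewrite ev_tr map_ckap -tA trmx_mul_rev.
- by rewrite ev_tr map_ckap -As trmx_mul_rev.
by rewrite map_ckap -trmx_mul_rev tv tr_scalar_mx.
Qed.

Lemma isrep_trV n u (A : pencil K q n n) v (s : 'cV[F^c]_n) t (f : F^c) :
  isrep ckap cy u A v s t f ->
  isrep kap y v^T (fun k => (A k)^T) u^T (t^T : 'M[F]_(n, 1))
     (s^T : 'M[F]_(1, n)) (f : F).
Proof.
move=> rep; have tv := isrep_tv rep; have [iA As tA us] := rep.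
have evE : (ev kap y (fun k => (A k)^T))^T = ev ckap cy A :> 'M[F^c]_n.
  by rewrite -ev_tr; apply: eq_ev => k; rewrite trmxK.
split.
- by apply/invertible_tr; rewrite evE.
- apply: trmx_inj; rewrite [LHS]trmx_mul_rev evE trmxK.
  by rewrite [LHS]tA -map_ckap trmxK.
- apply: trmx_inj; rewrite [LHS]trmx_mul_rev evE trmxK.
  by rewrite [LHS]As -map_ckap trmxK.
apply: trmx_inj; rewrite [LHS]trmx_mul_rev trmxK tr_scalar_mx -map_ckap trmxK.
exact: tv.
Qed.

Lemma indep_tr n (s : 'cV[F]_n) :
  indep kap s <-> indepr ckap (s^T : 'M[F^c]_(1, n)).
Proof.
split=> H c.
  move=> /(congr1 trmx) E; apply: trmx_inj; rewrite trmx0; apply: H.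
  by rewrite trmx0 in E; rewrite -E trmx_mul_rev trmxK map_trmx.
move=> E; apply: trmx_inj; rewrite trmx0; apply: H.
by rewrite map_ckap -trmx_mul_rev E trmx0.
Qed.

Lemma indepr_tr n (t : 'rV[F]_n) :
  indepr kap t <-> indep ckap (t^T : 'M[F^c]_(n, 1)).
Proof.
split=> H c.
  move=> /(congr1 trmx) E; apply: trmx_inj; rewrite trmx0; apply: H.
  by rewrite trmx0 in E; rewrite -E trmx_mul_rev trmxK map_trmx.
move=> E; apply: trmx_inj; rewrite trmx0; apply: H.
by rewrite map_ckap -trmx_mul_rev E trmx0.
Qed.

Lemma converse_skew : is_skew_field F^c.
Proof. by move=> x; exact: F_skew. Qed.

Lemma ckapC a x : ckap a * x = x * ckap a.
Proof. exact/esym/kapC. Qed.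

Lemma converse_hollow :
  (forall n (A : pencil K q n n), ~ invertible_mx (ev kap y A) -> hollow A) ->
  forall n (A : pencil K q n n), ~ invertible_mx (ev ckap cy A) -> hollow A.
Proof.
move=> H n A nA; have [|r [s [P [Q [fP fQ rs PAQ]]]]] := H n (fun k => (A k)^T).
  move=> /invertible_tr; rewrite -ev_tr; under eq_ev do rewrite trmxK.
  exact: nA.
exists s, r, Q^T, P^T; split; rewrite ?trmxK// 1?addnC// => k.
by apply: trmx_inj; rewrite trmx0 !trmx_mul !trmxK mulmxA.
Qed.

End Converse.

Section RightHanded.

Variables (K : fieldType) (F : unitRingType) (kap : {rmorphism K -> F}).
Variables (q : nat) (y : 'I_q.+1 -> F).
Hypothesis F_skew : is_skew_field F.
Hypothesis kapC : forall a x, kap a * x = x * kap a.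
Hypothesis y0 : y ord0 = 1.
Hypothesis hollowP : forall n (A : pencil K q n n),
  ~ invertible_mx (ev kap y A) -> hollow A.

Local Notation pencil := (pencil K q).
Local Notation km := (map_mx kap).
Local Notation isrep := (isrep kap y).

Lemma indepr_basis N (t : 'rV[F]_N) : exists m (C : 'M[K]_(m, N)) C' (e : 'rV_m),
  [/\ indepr kap e, t = e *m km C & C *m C' = 1%:M].
Proof.
have [m [C [C' [e [ie tE CC]]]]] :=
  @indep_basis K F^c (ckap kap) N (t^T : 'M[F^c]_(N, 1)).
exists m, C^T, C'^T, (e^T : 'M[F]_(1, m)); split.
- by apply/indepr_tr; rewrite trmxK.
- apply: trmx_inj; rewrite [LHS]tE [RHS]trmx_mul_rev.
  by apply/matrixP => i j; rewrite !mxE; apply: eq_bigr => k _; rewrite !mxE.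
by rewrite -trmx_mul CC trmx1.
Qed.

Lemma isrep_reducer n u A v s t f m (C : 'M_(m, n)) C' (e : 'rV_m) :
  @isrep n u A v s t f -> t = e *m km C -> C *m C' = 1%:M -> indepr kap e ->
  exists (E : 'M_(m, n)) A2 u2,
    isrep u2 A2 (C *m v) (km E *m s) e f /\ row_free E.
Proof.
move=> rep tE CC ie; have rep' := isrep_tr kapC rep.
have [|||E [A2 [v2 [rep2 fE]]]] := @isrep_reduce K F^c (ckap kap) q y
  (converse_skew F_skew) (ckapC kapC) (converse_hollow kapC hollowP) _ _ _ _ _ _ _ m C^T C'^T
  (e^T : 'M[F^c]_(m, 1)) rep'.
- by rewrite map_ckap -trmx_mul_rev tE.
- by rewrite -trmx_mul CC trmx1.
- exact/indepr_tr.
exists E^T, (fun k => (A2 k)^T), v2^T; split=> //.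
have E1 : (v^T *m C^T)^T = C *m v by rewrite trmx_mul !trmxK.
have E2 : ((s^T : 'M[F^c]_(1, n)) *m map_mx (ckap kap) E)^T = km E^T *m s
    :> 'M[F]_(m, 1).
  by apply/matrixP => i j; rewrite !mxE; apply: eq_bigr => k _; rewrite !mxE.
rewrite -E1 -[km _ *m s]E2 -[e]trmxK; exact: (isrep_trV kapC rep2).
Qed.

Lemma right_span_sub n u A v s t f n' u' A' v' s' t' :
  @isrep n u A v s t f -> @isrep n' u' A' v' s' t' f ->
  indep kap s -> indepr kap t -> indepr kap t' ->
  exists X : 'M_(n', n), t = t' *m km X.
Proof.
move=> rep rep' is_ it it'.
have [|||X XE] := @left_span_sub K F^c (ckap kap) q y
  (converse_skew F_skew) (ckapC kapC) (converse_hollow kapC hollowP) _ _ _ _ _ _ _ _ _ _ _ _ _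
  (isrep_tr kapC rep) (isrep_tr kapC rep').
- exact/indepr_tr.
- exact/indep_tr.
- exact/indepr_tr.
exists X^T; apply: trmx_inj; rewrite [LHS]XE.
by apply/matrixP => i j; rewrite !mxE; apply: eq_bigr => k _; rewrite !mxE.
Qed.

Lemma relation_col n u A v s t f (B : pencil n 1) (w : 'rV_1) :
  @isrep n u A v s t f -> indepr kap t -> t *m ev kap y B = km w ->
  exists b : 'cV_n, (forall k, B k = A k *m b) /\ w = u *m b.
Proof.
move=> rep it tB.
have [||b [bA bw]] := @relation_row K F^c (ckap kap) q y (ckapC kapC)
  (converse_hollow kapC hollowP) _ _ _ _ _ _ _ (fun k => (B k)^T) w^T (isrep_tr kapC rep).
- exact/indepr_tr.
- by rewrite (ev_tr y kapC) map_ckap -tB trmx_mul_rev.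
exists b^T; split=> [k|]; apply: trmx_inj; first by rewrite bA trmx_mul trmxK.
by rewrite bw trmx_mul trmxK.
Qed.

End RightHanded.

(** * Products and inverses *)

Section ProductInverse.

Variables (K : fieldType) (F : unitRingType) (kap : {rmorphism K -> F}).
Variables (q : nat) (y : 'I_q.+1 -> F).
Hypothesis F_skew : is_skew_field F.
Hypothesis kapC : forall a x, kap a * x = x * kap a.
Hypothesis y0 : y ord0 = 1.
Hypothesis hollowP : forall n (A : pencil K q n n),
  ~ invertible_mx (ev kap y A) -> hollow A.

Local Notation pencil := (pencil K q).
Local Notation km := (map_mx kap).
Local Notation ev := (ev kap y).
Local Notation isrep := (isrep kap y).
Local Notation indep := (indep kap).
Local Notation indepr := (indepr kap).

Lemma ev0 m n : ev (fun=> 0 : 'M_(m, n)) = 0.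
Proof.
by apply/matrixP => i j; rewrite !mxE big1// => k _; rewrite ?mxE rmorph0 mul0r.
Qed.

Lemma km_scalar a : km a%:M = (kap a)%:M :> 'M_1.
Proof. by rewrite map_scalar_mx. Qed.

Definition mul_pencil n n' (A : pencil n n) (v : 'cV[K]_n) (u' : 'rV[K]_n')
    (A' : pencil n' n') :
    pencil (n + n') (n + n') :=
  fun k => block_mx (A k) (pconst (- (v *m u')) k) 0 (A' k).

(** Besides representing the product, this identifies its two families, [(s g, s')] and [(t, f t')];
    minimality of the product system is the independence of both. *)
Lemma isrep_mul n u A v s t f n' u' A' v' s' t' g :
  @isrep n u A v s t f -> @isrep n' u' A' v' s' t' g ->
  isrep (row_mx u 0) (mul_pencil A v u' A') (col_mx 0 v')
    (col_mx (s *m g%:M) s') (row_mx t (f%:M *m t')) (f * g).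
Proof.
move=> rep rep'; have tv := isrep_tv rep.
have [iA As tA us] := rep; have [iA' As' tA' us'] := rep'.
have evE : ev (mul_pencil A v u' A') =
    block_mx (ev A) (- (km v *m km u')) 0 (ev A').
  by rewrite ev_block_mx ev_const// ev0 map_mxN map_mxM.
split.
- by rewrite evE; exact: invertible_ublock.
- rewrite evE mul_block_col mul0mx add0r As' mulmxA As mulNmx -mulmxA us' subrr.
  by rewrite map_col_mx map_mx0.
- rewrite evE mul_row_block mulmx0 addr0 tA -mulmxA tA' mulmxN mulmxA tv addNr.
  by rewrite map_row_mx map_mx0.
by rewrite map_row_mx map_mx0 mul_row_col mul0mx addr0 mulmxA us scalar_mxM.
Qed.

(** The matrix with rows [(0, u)] and [(-v, A)]: the Schur complement of [A] in it is
    [u A^-1 v = f], so the upper left entry of its inverse is [f^-1]. *)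
Definition inv_pencil n (u : 'rV[K]_n) (A : pencil n n) (v : 'cV[K]_n) : pencil (1 + n) (1 + n) :=
  fun k => block_mx 0 (pconst u k) (pconst (- v) k) (A k).

Lemma isrep_inv n u A v s t (f : F) : f != 0 -> @isrep n u A v s t f ->
  isrep (row_mx 1%:M 0) (inv_pencil u A v) (col_mx 1%:M 0)
    (col_mx f^-1%:M (s *m f^-1%:M)) (row_mx f^-1%:M (- (f^-1%:M *m t))) f^-1.
Proof.
move=> f0 rep; have tv := isrep_tv rep.
have [[Ai [AAi AiA]] As tA us] := rep.
have uf := F_skew f0.
have evE : ev (inv_pencil u A v) = block_mx 0 (km u) (- km v) (ev A).
  by rewrite ev_block_mx !ev_const// ev0 map_mxN.
split.
- rewrite evE; apply: injective_invertible => // w.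
  rewrite -[w](vsubmxK (m1 := 1)) mul_block_col mul0mx add0r.
  move=> E; have [E1 E2] := eq_col_mx (etrans E (esym (@col_mx0 _ _ _ _))).
  have w2E : dsubmx w = s *m usubmx w.
    rewrite -[dsubmx w]mul1mx -AiA -mulmxA.
    move/eqP: E2; rewrite mulNmx addrC subr_eq0 => /eqP ->.
    by rewrite -As !mulmxA AiA mul1mx.
  have w1 : usubmx w = 0.
    rewrite w2E mulmxA us in E1; rewrite -[usubmx w]mul1mx -(mulVr uf).
    by rewrite scalar_mxM -mulmxA E1 mulmx0.
  by rewrite w2E w1 mulmx0 col_mx0.
- rewrite evE mul_block_col mul0mx add0r mulmxA us -scalar_mxM divrr//.
  by rewrite mulmxA As mulNmx addNr map_col_mx map_mx1 map_mx0.
- rewrite evE mul_row_block mulmx0 add0r mulmxN mulNmx opprK -mulmxA tv.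
  rewrite -scalar_mxM mulVr// mulNmx -mulmxA tA subrr.
  by rewrite map_row_mx map_mx1 map_mx0.
by rewrite map_row_mx map_mx0 map_mx1 mul_row_col mul0mx addr0 mul1mx.
Qed.

Lemma span_one_indep n (s : 'cV[F]_n) : indep s ->
  (forall c : 'rV_n, km c *m s <> 1%:M) -> indep (col_mx 1%:M s : 'cV_(1 + n)).
Proof.
move=> is_ n1 c; rewrite -[c](hsubmxK (n1 := 1)) map_row_mx mul_row_col mulmx1.
set c0 := lsubmx c; set c1 := rsubmx c => E.
have c0E : c0 = (c0 0 0)%:M by exact: mx11_scalar.
suff c00 : c0 = 0.
  by move: E; rewrite c00 map_mx0 add0r => /is_ ->; rewrite row_mx0.
rewrite c0E; apply/eqP; apply: contraT => nc.
have a0 : c0 0 0 != 0 by apply: contraNneq nc => ->; rewrite raddf0.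
case: (n1 (- (c0 0 0)^-1 *: c1)).
rewrite scaleNr map_mxN map_mxZ mulNmx -scalemxAl.
move/eqP: E; rewrite addrC addr_eq0 => /eqP ->.
rewrite scalerN opprK {2}c0E km_scalar scale_scalar_mx -rmorphM mulVf//.
by rewrite rmorph1.
Qed.

Lemma inv_left_indep n (s : 'cV[F]_n) (f : F) : f != 0 ->
  indep (col_mx 1%:M s : 'cV_(1 + n)) -> indep (col_mx f%:M (s *m f%:M) : 'cV_(1 + n)).
Proof.
move=> f0 is_ c E; apply: is_.
transitivity (km c *m col_mx f%:M (s *m f%:M) *m f^-1%:M); last by rewrite E mul0mx.
rewrite -[RHS]mulmxA mul_col_mx -mulmxA -scalar_mxM divrr ?mulmx1//.
exact: F_skew.
Qed.

(** If [1] is not in the span of [s'], the inverse system of [f^-1] has the independent left family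
    [(f, s' f)]. The span of its right family then lies in that of [t], and it contains
    [f t' v' = f f^-1 = 1]. *)
Lemma inv_left_one n u A v s t (f : F) n' u' A' v' s' t' : f != 0 ->
  @isrep n u A v s t f -> @isrep n' u' A' v' s' t' f^-1 ->
  indep s -> indepr t -> indep s' -> indepr t' ->
  (exists c : 'rV_n', km c *m s' = 1%:M) \/
  (exists c : 'cV_n, t *m km c = 1%:M).
Proof.
move=> f0 rep rep' is_ it is' it'.
case: (pselect (exists c : 'rV_n', km c *m s' = 1%:M)) => [?|n1]; first by left.
right; have fV0 : f^-1 != 0 by rewrite invr_eq0.
have := isrep_inv fV0 rep'; rewrite invrK.
set S := col_mx f%:M _; set T := row_mx f%:M _ => repM.
have iS : indep S.
  apply: inv_left_indep => //; apply: span_one_indep => // c c1.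
  by apply: n1; exists c.
have [m [C [C' [e [ie TE CC]]]]] := indepr_basis kap T.
have [E [A2 [u2 [rep2 fE]]]] := isrep_reducer F_skew kapC hollowP repM TE CC ie.
have [] := right_span_sub F_skew kapC hollowP rep2 rep _ ie it.
  exact: indep_mul.
(* The vector [(0, -v')] extracts [f t' v'] from the right family [T]. *)
move=> X eE; exists (X *m C *m col_mx 0 (- v')).
rewrite !map_mxM !mulmxA -eE -TE map_col_mx mul_row_col map_mx0 mulmx0 add0r.
rewrite map_mxN mulNmx mulmxN opprK -mulmxA (isrep_tv rep') -scalar_mxM.
by rewrite divrr// F_skew.
Qed.

(** The inverse system of [f^-1] represents [f], so its left family [(f, s' f)] generates the span
    of [s]; multiplied by [f^-1], it becomes [(1, s')]. *)
Lemma inv_left_sub n u A v s t (f : F) n' u' A' v' s' t' (c : 'rV[K]_n) : f != 0 ->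
  @isrep n u A v s t f -> @isrep n' u' A' v' s' t' f^-1 ->
  indep s -> indepr t ->
  exists (a : K) (b : 'rV_n'),
    km c *m s *m f^-1%:M = (kap a)%:M + km b *m s'.
Proof.
move=> f0 rep rep' is_ it.
have fV0 : f^-1 != 0 by rewrite invr_eq0.
have := isrep_inv fV0 rep'; rewrite invrK.
set S := col_mx f%:M _; set T := row_mx f%:M _ => repM.
have [m [C [C' [e [ie SE CC]]]]] := indep_basis kap S.
have [E [A2 [u2 [rep2 fE]]]] := isrep_reduce F_skew kapC hollowP repM SE CC ie.
have [X sE] := left_span_sub F_skew kapC hollowP rep rep2 is_ it ie.
have eE : e = km C' *m S by rewrite SE mulmxA -map_mxM CC map_mx1 mul1mx.
pose b := c *m X *m C'.
exists (lsubmx b 0 0), (rsubmx b).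
rewrite sE eE !mulmxA -!map_mxM -/b -[in LHS](hsubmxK b) map_row_mx.
rewrite mul_row_col mulmxDl -!mulmxA -scalar_mxM divrr ?F_skew//.
by rewrite !mulmx1 -km_scalar -mx11_scalar.
Qed.

End ProductInverse.

(** * Independence of the families of a product system *)

Section ProductIndependence.

Variables (K : fieldType) (F : unitRingType) (kap : {rmorphism K -> F}).
Variables (q : nat) (y : 'I_q.+1 -> F).
Hypothesis F_skew : is_skew_field F.
Hypothesis kapC : forall a x, kap a * x = x * kap a.
Hypothesis y0 : y ord0 = 1.
Hypothesis hollowP : forall n (A : pencil K q n n),
  ~ invertible_mx (ev kap y A) -> hollow A.

Local Notation pencil := (pencil K q).
Local Notation km := (map_mx kap).
Local Notation ev := (ev kap y).
Local Notation isrep := (isrep kap y).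
Local Notation indep := (indep kap).
Local Notation indepr := (indepr kap).

(* A dependency of rank one between [s * g] and [s'] produces an element
   [kap c * Q^-1] of the left span of [f], with [Q] a linear polynomial. *)
Lemma product_dependency n u (A : pencil n n) v s t (f : F)
    n' u' (A' : pencil n' n') v' s' t' (g : F) :
  isrep u A v s t f -> isrep u' A' v' s' t' g -> indep s -> indep s' ->
  (forall N U (B : pencil N N) V S T, isrep U B V S T (f * g) ->
     (n + n' <= N + 1)%N) ->
  ~ indep (col_mx (s *m g%:M) s') ->
  exists (c1 : 'rV[K]_n) (c2 : 'rV[K]_n') (Q : pencil 1 1) (c : K),
    [/\ km c1 *m s *m g%:M = km c2 *m s', c != 0 &
        ev Q *m (km c1 *m s) = km c%:M].
Proof.
move=> rep rep' is_ is' min nind.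
have repP := isrep_mul y0 rep rep'.
move: nind repP; set S := col_mx (s *m _) _; set P := mul_pencil _ _ _ _.
set V := col_mx 0 v' => nind repP.
have [m [C [C' [e [ie SE CC]]]]] := indep_basis kap S.
have [E [A2 [u2 [rep2 fE]]]] := isrep_reduce F_skew kapC hollowP repP SE CC ie.
have mN := min _ _ _ _ _ _ rep2.
have rC : \rank C = m by apply/eqP/row_fullP; exists C'.
have [l [lC l0]] : exists l : 'rV_(n + n'), l *m C = 0 /\ l != 0.
  apply: contrapT => no; apply: nind => l; rewrite SE mulmxA -map_mxM => /ie lC.
  by apply/eqP; apply: contraT => l0; case: no; exists l.
(* The dimension bound [mN] leaves room for a single dependency, so [l] generates them all. *)
have rker : \rank (kermx C) = (n + n' - m)%N by rewrite mxrank_ker rC.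
have lker : (l <= kermx C)%MS by apply/sub_kermxP.
have rk1 : \rank (kermx C) = 1%N.
  have := mxrankS lker; rewrite rank_rV l0 /= rker; lia.
have kerl : (kermx C <= l)%MS.
  by rewrite -(mxrank_leqif_sup lker) rk1 rank_rV l0.
have [iP PS _ _] := repP.
pose R := relmx (fun k => P k *m C) V.
have rR : (\rank R <= m)%N.
  by apply: (relation_rank kapC hollowP ie); rewrite evMr// -mulmxA -SE.
(* There are [n + n'] relations of rank at most [m] on [e], so some combination [c] of the rows of
   the product system becomes trivial on [e]. Its coefficients are then multiples of [l], and the
   factors form the linear polynomial [Q]. *)
have /rowV0Pn[c /sub_kermxP cR c0] : kermx R != 0.
  by rewrite -mxrank_eq0 mxrank_ker subn_eq0 -ltnNge; move: rk1; rewrite rker; lia.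
have [cPC cV] := (relmx_eq0 _ _ _).1 cR.
pose Q k : 'M[K]_1 := c *m P k *m pinvmx l.
have QE k : c *m P k = Q k *m l.
  rewrite /Q mulmxKpV//; apply: submx_trans kerl; apply/sub_kermxP.
  by rewrite -mulmxA cPC.
have evQ : km c *m ev P = ev Q *m km l by rewrite -evMl -evMr//; apply: eq_ev.
pose l1 := lsubmx l; pose l2 := rsubmx l; pose c1 := lsubmx c.
have QE1 k : c1 *m A k = Q k *m l1.
  have := QE k; rewrite -[c]hsubmxK -[l]hsubmxK /P /mul_pencil mul_row_block.
  by rewrite mulmx0 addr0 mul_mx_row => /eq_row_mx[+ _].
have evQ1 : km c1 *m ev A = ev Q *m km l1 by rewrite -evMl -evMr//; apply: eq_ev.
have lS : km l1 *m s *m g%:M = - (km l2 *m s').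
  apply/eqP; rewrite -addr_eq0 -mulmxA -mul_row_col -map_row_mx hsubmxK.
  by rewrite -/S SE mulmxA -map_mxM lC map_mx0 mul0mx.
have l1n0 : l1 != 0.
  apply: contraNneq l0 => l10; have := lS; rewrite l10 map_mx0 !mul0mx.
  move=> /esym/eqP; rewrite oppr_eq0 => /eqP /is' l20.
  by rewrite -[l]hsubmxK -/l1 -/l2 l10 l20 row_mx0.
have [_ As _ _] := rep.
have Ql : ev Q *m (km l1 *m s) = km (c1 *m v).
  by rewrite mulmxA -evQ1 -mulmxA As map_mxM.
exists l1, (- l2), Q, ((c1 *m v) 0 0); split.
- by rewrite map_mxN mulNmx.
- have Q0 : ev Q 0 0 != 0.
    apply: contraNneq c0 => Q00; apply: contraT => nc; case/eqP: (nc).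
    have [N [PN _]] := iP; apply: (km_eq0 (kap := kap)).
    by rewrite -[km c]mulmx1 -PN mulmxA evQ [ev Q]mx11_scalar Q00 raddf0 !mul0mx.
  have s0 : (km l1 *m s) 0 0 != 0.
    apply: contraNneq l1n0 => s00; apply/eqP/is_.
    by rewrite [LHS]mx11_scalar s00 raddf0.
  apply/negP => /eqP cv0; move: Ql; rewrite [c1 *m v]mx11_scalar cv0 raddf0 map_mx0.
  rewrite [ev Q]mx11_scalar [km l1 *m s]mx11_scalar -scalar_mxM.
  move=> /matrixP /(_ 0 0); rewrite !mxE eqxx mulr1n => E0.
  case/eqP: s0; apply: (mulrI (F_skew Q0)); rewrite mulr0 -E0.
  by rewrite !mxE.
by rewrite -mx11_scalar.
Qed.

Lemma product_left_indep nf uf (Af : pencil nf nf) vf sf tf (f : F)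
    ng ug (Ag : pencil ng ng) vg sg tg (g : F)
    ni ui (Ai : pencil ni ni) vi si ti nj uj (Aj : pencil nj nj) vj sj tj :
  f != 0 -> g != 0 ->
  isrep uf Af vf sf tf f -> indep sf -> indepr tf ->
  isrep ug Ag vg sg tg g -> indep sg -> indepr tg ->
  isrep ui Ai vi si ti f^-1 -> indep si ->
  isrep uj Aj vj sj tj g^-1 -> indep sj -> indepr tj ->
  (forall n u (A : pencil n n) v s t, isrep u A v s t (f * g) ->
     (nf + ng <= n + 1)%N) ->
  (forall n u (A : pencil n n) v s t, isrep u A v s t (g^-1 * f^-1) ->
     (nj + ni <= n + 1)%N) ->
  (forall c : 'rV_nf, km c *m sf <> 1%:M) ->
  (forall c : 'cV_ng, tg *m km c <> 1%:M) ->
  indep (col_mx (sf *m g%:M) sg).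
Proof.
move=> f0 g0 repf isf itf repg isg itg repi isi repj isj itj min1 min2 f1 g1.
apply: contrapT => nind.
have [c1 [c2 [Q [c [dep c0 Ql]]]]] := product_dependency repf repg isf isg min1 nind.
set l := km c1 *m sf in dep Ql.
have uf' := F_skew f0; have ug' := F_skew g0.
(* A nonzero scalar [l] would put [1] in [L(f)], and [l = 0] contradicts [Q l = c]. *)
have lnconst a : l <> (kap a)%:M.
  move=> lE; case: (eqVneq a 0) => [a0|a0].
    move: Ql; rewrite lE a0 rmorph0 raddf0 mulmx0 => /esym /(km_eq0 (kap := kap)).
    by move/matrixP/(_ 0 0)/eqP; rewrite !mxE eqxx mulr1n (negPf c0).
  apply: (f1 (a^-1 *: c1)); rewrite map_mxZ -scalemxAl -/l lE scale_scalar_mx.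
  by rewrite -rmorphM mulVf// rmorph1.
have [k [k0 Qk0]] : exists k, k != ord0 /\ Q k != 0.
  apply: contrapT => no; have QE : ev Q = km (Q ord0).
    rewrite -(ev_const kap y0); apply: eq_ev => k; rewrite /pconst.
    case: eqVneq => [->//|k0]; apply/eqP; apply: contraT => Qk0.
    by case: no; exists k.
  have Q0 : Q ord0 0 0 != 0.
    apply/negP => /eqP Q00; move: Ql; rewrite QE [Q ord0]mx11_scalar Q00 raddf0.
    rewrite map_mx0 mul0mx => /esym /(km_eq0 (kap := kap)).
    by move/matrixP/(_ 0 0)/eqP; rewrite !mxE eqxx mulr1n (negPf c0).
  case: (lnconst ((Q ord0 0 0)^-1 * c)).
  rewrite rmorphM scalar_mxM -km_scalar -(km_scalar kap c) -Ql QE mulmxA -map_mxM.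
  by rewrite {2}[Q ord0]mx11_scalar -scalar_mxM mulVf// map_mx1 mul1mx.
(* Since [1] is not in [R(g)], the dichotomy of [inv_left_one] places [1] in [L(g^-1)]; this absorbs
   the scalar when [l = c2 s_g g^-1] is expressed next. *)
have [nu nu1] : exists nu : 'rV_nj, km nu *m sj = 1%:M.
  have [//|[c' c'1]] := inv_left_one F_skew kapC y0 hollowP g0 repg repj isg itg isj itj.
  by case: (g1 c').
have [nu' nu'l] : exists nu' : 'rV_nj, km nu' *m sj = l.
  have [a [b ab]] := inv_left_sub F_skew kapC y0 hollowP c2 g0 repg repj isg itg.
  exists (a *: nu + b); rewrite map_mxD map_mxZ mulmxDl -scalemxAl nu1.
  rewrite scale_scalar_mx mulr1 -ab -dep -mulmxA -scalar_mxM divrr//.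
  by rewrite mulmx1.
have [mu' mu'l] : exists mu : 'rV_ni, km mu *m si = l *m f^-1%:M.
  have [a [mu amu]] := inv_left_sub F_skew kapC y0 hollowP c1 f0 repf repi isf itf.
  rewrite -/l in amu.
  case: (pselect (exists c : 'rV_ni, km c *m si = 1%:M)) => [[c' c'1]|no].
    exists (a *: c' + mu); rewrite map_mxD map_mxZ mulmxDl -scalemxAl c'1.
    by rewrite scale_scalar_mx mulr1 amu.
  suff a0 : a = 0 by exists mu; rewrite amu a0 rmorph0 raddf0 add0r.
  apply/eqP; apply: contraT => a0.
  have iE : indep (col_mx 1%:M si : 'cV_(1 + ni)).
    by apply: span_one_indep => // c' c'1; apply: no; exists c'.
  (* If the scalar [a] is nonzero and [1] is not in [L(f^-1)], the [1 + ni] entries [(1, si)] are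
     independent. They satisfy [1 = 1], [Ai si = vi] and [Q (a + mu si) - c ui si = 0], the last
     because both terms equal [c f^-1]. These are [1 + ni + 1] relations, independent because [Q]
     has a nonzero coefficient off [ord0]. *)
  pose B1 : pencil 1 (1 + ni) := fun k => row_mx (pconst 1%:M k) 0.
  pose B2 : pencil ni (1 + ni) := fun k => row_mx 0 (Ai k).
  pose B3 : pencil 1 (1 + ni) := fun k =>
    row_mx (Q k *m a%:M) (Q k *m mu - pconst (c%:M *m ui) k).
  have [iAi Asi _ usi] := repi.
  suff : (1 + ni + 1 <= 1 + ni)%N by rewrite addn1 ltnn.
  apply: (key1 kapC hollowP (e := col_mx 1%:M si)
    (A := fun k => col_mx (col_mx (B1 k) (B2 k)) (B3 k))
    (v := col_mx (col_mx 1%:M vi) 0) iE).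
    rewrite !ev_col_mx !mul_col_mx !ev_row_mx ev0 ev_const// !mul_row_col.
    rewrite map_mx1 mulmx1 mul0mx addr0 mulmx1 ev0 add0r Asi.
    have -> : ev (fun k => Q k *m a%:M) = ev Q *m km a%:M by exact: evMr.
    have -> : ev (fun k => Q k *m mu - pconst (c%:M *m ui) k) =
        ev Q *m km mu - km (c%:M *m ui).
      rewrite -evMr// -(ev_const kap y0); apply/matrixP => i j.
      rewrite !mxE -sumrB; apply: eq_bigr => k' _.
      by rewrite !mxE rmorphB mulrBl.
    rewrite mulmxBl mulmx1 addrA -[ev Q *m _ *m si]mulmxA -mulmxDr km_scalar -amu mulmxA Ql.
    by rewrite map_mxM -mulmxA usi subrr !map_col_mx map_mx1 map_mx0.
  move=> d dB dv; rewrite -[d](hsubmxK (n1 := 1 + ni)) -[lsubmx d](hsubmxK (n1 := 1)).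
  set d0 := lsubmx (lsubmx d); set d1 := rsubmx (lsubmx d); set d2 := rsubmx d.
  have dE k' : d0 *m pconst 1%:M k' + d2 *m (Q k' *m a%:M) = 0 /\
      d1 *m Ai k' + d2 *m (Q k' *m mu - pconst (c%:M *m ui) k') = 0.
    have := dB k'; rewrite -[d](hsubmxK (n1 := 1 + ni)) -[lsubmx d](hsubmxK (n1 := 1)).
    rewrite !mul_row_col !mul_mx_row !mulmx0 !add_row_mx addr0 add0r -row_mx0.
    exact: eq_row_mx.
  have d20 : d2 = 0.
    have [+ _] := dE k; rewrite /pconst (negPf k0) mulmx0 add0r.
    rewrite [d2]mx11_scalar [Q k]mx11_scalar -!scalar_mxM.
    move/matrixP/(_ 0 0)/eqP; rewrite !mxE eqxx mulr1n !mulf_eq0 (negPf a0) orbF.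
    case/orP => /eqP E; first by rewrite E raddf0.
    by case/eqP: Qk0; rewrite [Q k]mx11_scalar E raddf0.
  have d10 : d1 = 0.
    by apply: (pindep_ev iAi) => k'; have [_] := dE k'; rewrite d20 mul0mx addr0.
  have d00 : d0 = 0.
    by have [+ _] := dE ord0; rewrite d20 mul0mx addr0 /pconst eqxx mulmx1.
  by rewrite d00 d10 d20 !row_mx0.
(* The two dependencies write [f^-1] and [l f^-1] both through [sj f^-1] and through [si]. They are
   independent since [1] and [l] are. *)
pose L : 'M[K]_(1 + 1, nj + ni) := block_mx nu (- ui) nu' (- mu').
have repP := isrep_mul y0 repj repi.
have [_ _ _ usi] := repi.
have LS : km L *m col_mx (sj *m f^-1%:M) si = 0.
  rewrite map_block_mx mul_block_col !mulmxA nu1 nu'l mul1mx !map_mxN !mulNmx.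
  by rewrite usi mu'l !subrr col_mx0.
have fL : row_free L.
  apply: inj_row_free => ab; rewrite -[ab](hsubmxK (n1 := 1)).
  set a := lsubmx ab; set b := rsubmx ab; rewrite mul_row_block => abL.
  have : km (a *m nu + b *m nu') *m sj = 0.
    have [-> _] : a *m nu + b *m nu' = 0 /\ a *m (- ui) + b *m (- mu') = 0.
      by apply: eq_row_mx; rewrite row_mx0.
    by rewrite map_mx0 mul0mx.
  rewrite map_mxD !map_mxM mulmxDl -!mulmxA nu1 nu'l mulmx1 => E.
  have b0 : b = 0.
    apply/eqP; apply: contraT => bn0.
    have b00 : b 0 0 != 0.
      by apply: contraNneq bn0 => b00; rewrite [b]mx11_scalar b00 raddf0.
    case: (lnconst (- (b 0 0)^-1 * a 0 0)).
    rewrite rmorphM rmorphN scalar_mxM.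
    have -> : l = (kap (b 0 0)^-1)%:M *m (km b *m l).
      rewrite {2}[b]mx11_scalar km_scalar mulmxA -scalar_mxM -rmorphM mulVf//.
      by rewrite rmorph1 mul1mx.
    move/eqP: E; rewrite addrC addr_eq0 => /eqP ->.
    by rewrite {1}[a]mx11_scalar km_scalar mulmxN raddfN mulNmx.
  by move: E; rewrite b0 map_mx0 mul0mx addr0 => /(km_eq0 (kap := kap)) ->; rewrite row_mx0.
have [m [C [C' [e [ie SE CC]]]]] := indep_basis kap (col_mx (sj *m f^-1%:M) si).
have [E [A2 [u2 [rep2 fE]]]] := isrep_reduce F_skew kapC hollowP repP SE CC ie.
have mN := min2 _ _ _ _ _ _ rep2.
have rC : \rank C = m by apply/eqP/row_fullP; exists C'.
have LC : L *m C = 0.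
  apply/row_matrixP => i; rewrite row0; apply: ie.
  by rewrite row_mul map_mxM -mulmxA -SE map_row -row_mul LS row0.
move: mN (mulmx0_rank_max LC); rewrite rC (eqP fL); clear; lia.
Qed.

End ProductIndependence.

Section ProductRightIndependence.

Variables (K : fieldType) (F : unitRingType) (kap : {rmorphism K -> F}).
Variables (q : nat) (y : 'I_q.+1 -> F).
Hypothesis F_skew : is_skew_field F.
Hypothesis kapC : forall a x, kap a * x = x * kap a.
Hypothesis y0 : y ord0 = 1.
Hypothesis hollowP : forall n (A : pencil K q n n),
  ~ invertible_mx (ev kap y A) -> hollow A.

Local Notation pencil := (pencil K q).
Local Notation km := (map_mx kap).
Local Notation isrep := (isrep kap y).
Local Notation indepc := (@indep K F^c (ckap kap) _).
Local Notation indep := (indep kap).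
Local Notation indepr := (indepr kap).

(** In [F^c] products are reversed: [g] and [f] exchange roles, and so do the conditions on [L(f)]
    and [R(g)]. *)
Lemma product_right_indep nf uf (Af : pencil nf nf) vf sf tf (f : F)
    ng ug (Ag : pencil ng ng) vg sg tg (g : F)
    ni ui (Ai : pencil ni ni) vi si ti nj uj (Aj : pencil nj nj) vj sj tj :
  f != 0 -> g != 0 ->
  isrep uf Af vf sf tf f -> indep sf -> indepr tf ->
  isrep ug Ag vg sg tg g -> indep sg -> indepr tg ->
  isrep ui Ai vi si ti f^-1 -> indep si -> indepr ti ->
  isrep uj Aj vj sj tj g^-1 -> indepr tj ->
  (forall n u (A : pencil n n) v s t, isrep u A v s t (f * g) ->
     (nf + ng <= n + 1)%N) ->
  (forall n u (A : pencil n n) v s t, isrep u A v s t (g^-1 * f^-1) ->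
     (nj + ni <= n + 1)%N) ->
  (forall c : 'rV_nf, km c *m sf <> 1%:M) ->
  (forall c : 'cV_ng, tg *m km c <> 1%:M) ->
  indepr (row_mx tf (f%:M *m tg)).
Proof.
move=> f0 g0 repf isf itf repg isg itg repi isi iti repj itj min1 min2 f1 g1.
have main : indepc (col_mx ((tg^T : 'M[F^c]_(ng, 1)) *m (f : F^c)%:M)
    (tf^T : 'M[F^c]_(nf, 1))).
  have H := @product_left_indep K F^c (ckap kap) q y (converse_skew F_skew)
    (ckapC kapC) y0 (converse_hollow kapC hollowP).
  have H1 := H _ _ _ _ _ _ _ _ _ _ _ _ _ _ _ _ _ _ _ _ _ _ _ _ _ _ g0 f0 (isrep_tr kapC repg).
  apply: (H1 _ _ _ _ _ _ _ _ _ _ _ _ _ _ _ _ _ _ _ _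
    (isrep_tr kapC repf) _ _ (isrep_tr kapC repj) _ (isrep_tr kapC repi)).
  - exact/indepr_tr.
  - exact/indep_tr.
  - exact/indepr_tr.
  - exact/indep_tr.
  - exact/indepr_tr.
  - exact/indepr_tr.
  - exact/indep_tr.
  - move=> n u A v s t /(isrep_trV kapC) /min1; by rewrite addnC.
  - move=> n u A v s t /(isrep_trV kapC) /min2; by rewrite addnC.
  - move=> c E; apply: (g1 c^T); apply: trmx_inj; rewrite tr_scalar_mx -[RHS]E.
    by apply/matrixP => i j; rewrite !mxE; apply: eq_bigr => k _; rewrite !mxE.
  move=> c E; apply: (f1 c^T); apply: trmx_inj; rewrite tr_scalar_mx -[RHS]E.
  by apply/matrixP => i j; rewrite !mxE; apply: eq_bigr => k _; rewrite !mxE.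
move=> c E; have := main (row_mx (dsubmx c)^T (usubmx c)^T).
rewrite map_row_mx mul_row_col.
have E2 : tf *m km (usubmx c) + f%:M *m tg *m km (dsubmx c) = 0.
  by rewrite -mul_row_col -map_col_mx vsubmxK.
move=> /(_ _)/eqP; rewrite row_mx_eq0 => H.
have /andP[/eqP /(congr1 trmx) d0 /eqP /(congr1 trmx) u0] :
    ((dsubmx c)^T == 0) && ((usubmx c)^T == 0).
  apply: H; apply: trmx_inj; rewrite trmx0 -[RHS]E2 addrC.
  rewrite raddfD /=; congr (_ + _).
    by apply/matrixP => i j; rewrite !mxE; apply: eq_bigr => k _; rewrite !mxE.
  apply/matrixP => i j; rewrite !mxE; apply: eq_bigr => k _.
  by rewrite !mxE !big_ord1 !mxE !ord1 eqxx mulr1n.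
by rewrite -[c]vsubmxK -[usubmx c]trmxK -[dsubmx c]trmxK d0 u0 !trmx0 col_mx0.
Qed.

End ProductRightIndependence.

(** * Malcev-Neumann series over an ordered group *)

Record ogroup := OGroup {
  ocar :> choiceType;
  gmul : ocar -> ocar -> ocar;
  gone : ocar;
  ginv : ocar -> ocar;
  glt : rel ocar;
  gmulA : associative gmul;
  gmul1g : left_id gone gmul;
  gmulg1 : right_id gone gmul;
  gmulVg : left_inverse gone ginv gmul;
  gmulgV : right_inverse gone ginv gmul;
  glt_irr : irreflexive glt;
  glt_trans : transitive glt;
  glt_total : forall a b, a != b -> glt a b || glt b a;
  glt_mul2l : forall c a b, glt (gmul c a) (gmul c b) = glt a b;
  glt_mul2r : forall c a b, glt (gmul a c) (gmul b c) = glt a b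
}.

Arguments gone {_}.

Section OrderedGroup.

Variable G : ogroup.
Implicit Types (a b c : G) (A B C : set G).

Local Notation "a * b" := (gmul a b) : group_scope.
Local Notation "a ^-1" := (ginv a) : group_scope.
Local Notation "a < b" := (glt a b) : group_scope.
Local Open Scope group_scope.

Lemma gmulKg a b : a^-1 * (a * b) = b.
Proof. by rewrite gmulA gmulVg gmul1g. Qed.

Lemma gmulVKg a b : a * (a^-1 * b) = b.
Proof. by rewrite gmulA gmulgV gmul1g. Qed.

Lemma ginvM a b : (a * b)^-1 = b^-1 * a^-1.
Proof.
rewrite -[RHS](gmulKg (a * b)) -gmulA gmulVKg.
by rewrite gmulgV gmulg1.
Qed.

Lemma ginvK a : a^-1^-1 = a.
Proof. by rewrite -[LHS]gmulg1 -(gmulVg a) gmulKg. Qed.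

Lemma glt_asym a b : a < b -> (b < a) = false.
Proof. by move=> ab; apply/negP => /(glt_trans ab); rewrite glt_irr. Qed.

Lemma glt_ge a b : ~~ (a < b) -> a = b \/ b < a.
Proof.
move=> nab; case: (eqVneq a b) => [->|/glt_total]; first by left.
by rewrite (negPf nab) => /= ba; right.
Qed.

Lemma glt_le_trans a b c : ~~ (b < a) -> b < c -> a < c.
Proof. by move=> /glt_ge[->//|]; apply: glt_trans. Qed.

Lemma glt_lt_le a b c : a < b -> ~~ (c < b) -> a < c.
Proof. by move=> ab /glt_ge[->//|]; apply: glt_trans. Qed.

(** Well-ordered subsets; these will be the supports of the series. *)
Definition wo A := forall B, (B `<=` A)%classic -> (B !=set0)%classic ->
  exists2 m, B m & forall b, B b -> ~~ (b < m).

Lemma wo_sub A B : (B `<=` A)%classic -> wo A -> wo B.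
Proof. by move=> BA wA C CB; apply: wA => x /CB /BA. Qed.

Lemma wo_ind A (P : G -> Prop) : wo A ->
  (forall a, A a -> (forall b, A b -> b < a -> P b) -> P a) ->
  forall a, A a -> P a.
Proof.
move=> wA IH a Aa; apply: contrapT => nPa.
case: (wA [set b | A b /\ ~ P b]%classic) => [b []//||m [Am nPm] mmin].
  by exists a.
apply: nPm; apply: IH => // b Ab bm; apply: contrapT => nPb.
by have := mmin b (conj Ab nPb); rewrite bm.
Qed.

Lemma wo1 a : wo [set a]%classic.
Proof.
move=> B Ba [b Bb]; exists b => // c /Ba -> ; rewrite (Ba _ Bb).
by rewrite glt_irr.
Qed.

Lemma woU A B : wo A -> wo B -> wo (A `|` B)%classic.
Proof.
move=> wA wB C CAB [c Cc].
case: (pselect (C `&` A !=set0)%classic) => [CA0|CA0]; last first.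
  apply: wB; last by exists c.
  by move=> x Cx; case: (CAB _ Cx) => // Ax; case: CA0; exists x.
case: (pselect (C `&` B !=set0)%classic) => [CB0|CB0]; last first.
  apply: wA; last by exists c.
  by move=> x Cx; case: (CAB _ Cx) => // Bx; case: CB0; exists x.
case: (wA (C `&` A)%classic) => [x []//|//|m [Cm Am] mmin].
case: (wB (C `&` B)%classic) => [x []//|//|n [Cn Bn] nmin].
case: (boolP (n < m)) => nm.
  exists n => // b Cb; case: (CAB _ Cb) => [Ab|Bb]; last exact: nmin.
  apply/negP => bn; have := mmin b (conj Cb Ab).
  by rewrite (glt_trans bn nm).
exists m => // b Cb; case: (CAB _ Cb) => [Ab|Bb]; first exact: mmin.
apply/negP => bm; have := nmin b (conj Cb Bb).
by rewrite (glt_lt_le bm nm).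
Qed.

(** Initial segments are finite by induction, each being the segment below its own maximum together
    with that maximum; the same step at the maximum of [A] concludes. *)
Lemma wo_fin A : wo A ->
  (forall B, (B `<=` A)%classic -> (B !=set0)%classic ->
    exists2 m, B m & forall b, B b -> ~~ (m < b)) -> finite_set A.
Proof.
move=> wA wA'; apply: contrapT => infA.
pose below a := [set b | A b /\ (b < a)]%classic.
have fin_below a : A a -> finite_set (below a).
  move: a; apply: (wo_ind wA) => a Aa IH.
  case: (pselect (below a !=set0)%classic) => [ne|e]; last first.
    suff -> : below a = set0 by exact: finite_set0.
    by apply/seteqP; split=> // x bx; case: e; exists x.
  case: (wA' (below a)) => [x []//|//|m [Am ma] mmax].
  apply: (@sub_finite_set _ _ (below m `|` [set m])%classic).
    move=> x [Ax xa]; case: (eqVneq x m) => [->|xm]; first by right.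
    left; split=> //; have := mmax x (conj Ax xa).
    by have := glt_total xm; case: (x < m) => //= ->.
  by rewrite finite_setU; split; [exact: IH|exact: finite_set1].
case: (pselect (A !=set0)%classic) => [ne|e]; last first.
  apply: infA; suff -> : A = set0 by exact: finite_set0.
  by apply/seteqP; split=> // x bx; case: e; exists x.
case: (wA' A) => // m Am mmax; apply: infA.
apply: (@sub_finite_set _ _ (below m `|` [set m])%classic).
  move=> x Ax; case: (eqVneq x m) => [->|xm]; first by right.
  left; split=> //; have := mmax x Ax.
  by have := glt_total xm; case: (x < m) => //= ->.
by rewrite finite_setU; split; [exact: fin_below|exact: finite_set1].
Qed.

Lemma glt_inv2 a b : (a^-1 < b^-1) = (b < a).
Proof.
by rewrite -(glt_mul2l a) gmulgV -(glt_mul2r b) gmul1g -gmulA gmulVg gmulg1.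
Qed.

(** As [a] grows, its partner [a^-1 * c] decreases; well-ordering of [B] thus gives maxima on the
    side of [A], and [wo_fin] applies. *)
Lemma wo_fin_pairs A B c : wo A -> wo B ->
  finite_set [set a | A a /\ B (a^-1 * c)]%classic.
Proof.
move=> wA wB; apply: wo_fin; first by apply: wo_sub wA => a [].
move=> C CAB [x Cx].
pose D := [set b | B b /\ exists2 a, C a & b = a^-1 * c]%classic.
case: (wB D) => [b []//||m [Bm [a Ca ->]] mmin].
  by exists (x^-1 * c); split; [case: (CAB _ Cx)|exists x].
exists a => // y Cy; rewrite -glt_inv2 -(glt_mul2r c).
by apply: mmin; split; [case: (CAB _ Cy)|exists y].
Qed.

Definition oset_mul A B : set G :=
  [set c | exists a b, [/\ A a, B b & c = a * b]]%classic.

(* With [v a] the least element of [C] in [a * B], the records of [v] have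
   decreasing [B]-components, so the last record gives the minimum of [C]. *)
Lemma wo_mul A B : wo A -> wo B -> wo (oset_mul A B).
Proof.
move=> wA wB C CAB [c0 Cc0].
pose AC := [set a | A a /\ exists2 b, B b & C (a * b)]%classic.
have hb a : exists b, AC a -> [/\ B b, C (a * b) &
    forall b', B b' -> C (a * b') -> ~~ (b' < b)].
  case: (pselect (AC a)) => [[Aa [b Bb Cb]]|nA]; last by exists gone.
  case: (wB [set b | B b /\ C (a * b)]%classic) => [x []//||m [Bm Cm] mmin].
    by exists b.
  by exists m => _; split=> // b' Bb' Cb'; apply: mmin.
have [v hv] := choice hb.
pose w a := a * v a.
have ACne : exists a, AC a.
  have [a [b [Aa Bb cE]]] := CAB _ Cc0.
  by exists a; split=> //; exists b => //; rewrite -cE.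
pose T := [set b | exists a, [/\ AC a, b = v a &
   forall a', AC a' -> a' < a -> w a < w a']]%classic.
have wAC : wo AC by apply: wo_sub wA => a [].
case: (wB T) => [b [a [ACa -> _]]||m [a [ACa -> ra]] mmin].
- by have [] := hv a ACa.
- have [a ACa amin] : exists2 a, AC a & forall b, AC b -> ~~ (b < a).
    by apply: wAC.
  exists (v a), a; split=> // a' ACa' a'a; have := amin a' ACa'.
  by rewrite a'a.
(* [a] is the record with least [v a]. The first [x] with [w x < w a] is again a record, and it
   comes after [a]; from [a * v x < x * v x < a * v a] it has smaller [v x], a contradiction. *)
have wmin a' : AC a' -> ~~ (w a' < w a).
  move=> ACa'; apply/negP => lt'.
  case: (wAC [set x | AC x /\ (w x < w a)]%classic) => [x []//||x [ACx xa] xmin].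
    by exists a'.
  have rx y : AC y -> y < x -> w x < w y.
    move=> ACy yx; apply: glt_lt_le xa _; apply/negP => yltx.
    by have := xmin y (conj ACy yltx); rewrite yx.
  have ax : a < x.
    have [|xE|] := glt_ge (a := x) (b := a) _ => //; last first.
      by rewrite xE glt_irr in xa.
    by apply/negP => xlta; have := ra x ACx xlta; rewrite (glt_asym xa).
  have : v x < v a.
    rewrite -(glt_mul2l a); apply: glt_trans xa.
    by rewrite /w glt_mul2r.
  by apply/negP; apply: mmin; exists x; split.
exists (w a); first by have [] := hv a ACa.
move=> c Cc; apply/negP => ca.
have [a' [b [Aa' Bb cE]]] := CAB _ Cc; rewrite {}cE in ca Cc.
have ACa' : AC a' by split=> //; exists b.
have [_ _ /(_ b Bb Cc)] := hv a' ACa'.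
rewrite -(glt_mul2l a') => nb; have := wmin a' ACa'.
have [ba'|ba'] := glt_ge nb; first by rewrite /w -ba' ca.
by rewrite /w (glt_trans ba' ca).
Qed.

End OrderedGroup.

Arguments wo1 {G} a B _ _.

Lemma finite_uniq_seq (T : choiceType) (A : set T) : finite_set A ->
  exists2 s : seq T, uniq s & forall x, (x \in s) <-> A x.
Proof.
move=> finA; exists (finmap.enum_fset (fset_set A)); first exact: finmap.fset_uniq.
move=> x; have -> : (x \in finmap.enum_fset (fset_set A)) = (x \in A).
  exact: in_fset_set finA x.
by split; [exact: set_mem|exact: mem_set].
Qed.

Section MalcevNeumann.

Variables (K : fieldType) (G : ogroup).

Local Notation "a *g b" := (gmul a b) (at level 40, left associativity).
Local Notation "a ^g" := (ginv a) (at level 2, format "a ^g").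
Local Notation "a <g b" := (glt a b) (at level 70).

Definition msup (f : G -> K) : set G := [set a | f a != 0]%classic.

Definition mn_pred : pred (G -> K) := fun f => `[< wo (msup f) >].

Record mn := MN { mn_val :> G -> K; mn_valP : mn_val \in mn_pred }.

HB.instance Definition _ := [isSub for mn_val].
HB.instance Definition _ := [Choice of mn by <:].

Lemma mn_pred_zmod : zmod_closed mn_pred.
Proof.
split=> [|f g /asboolP wf /asboolP wg]; apply/asboolP.
  by move=> B B0 [b /B0]; rewrite /msup /= eqxx.
apply: wo_sub (woU wf wg) => a; rewrite /msup /=.
apply: contraPP => /not_orP[/negP + /negP]; rewrite !negbK => /eqP fa /eqP ga.
have -> : (f - g) a = f a - g a by [].
by rewrite fa ga subrr eqxx.
Qed.

HB.instance Definition _ := GRing.isZmodClosed.Build (G -> K) mn_pred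
  mn_pred_zmod.
HB.instance Definition _ := [SubChoice_isSubZmodule of mn by <:].

Implicit Types f g h : mn.

Lemma mn_wo f : wo (msup f).
Proof. by case: f => f /= /asboolP. Qed.

Arguments mn_wo : clear implicits.

Lemma mnP f g : (forall a, f a = g a) -> f = g.
Proof. by move=> fg; apply/val_inj/funext. Qed.

Lemma mnD f g a : (f + g) a = f a + g a. Proof. by []. Qed.
Lemma mnB f g a : (f - g) a = f a - g a. Proof. by []. Qed.
Lemma mn0 a : (0 : mn) a = 0. Proof. by []. Qed.

Definition mn_pairs f g c := [set a | f a != 0 /\ g (a^g *g c) != 0]%classic.

Lemma mn_pairs_fin f g c : finite_set (mn_pairs f g c).
Proof. exact: (wo_fin_pairs c (mn_wo f) (mn_wo g)). Qed.

Definition mn_mul_fun f g c : K :=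
  \sum_(a \in mn_pairs f g c) f a * g (a^g *g c).

(** Widening the index set lets several convolutions run over one common list. *)
Lemma mn_mul_funE f g c (s : seq G) : uniq s ->
  (forall a, mn_pairs f g c a -> a \in s) ->
  mn_mul_fun f g c = \sum_(a <- s) f a * g (a^g *g c).
Proof.
move=> us ss; rewrite /mn_mul_fun; apply: fsbig_fwiden => // a /= [_ na].
apply/eqP; apply: contra_notT na; rewrite mulf_eq0 negb_or => /andP[fa ga].
by split.
Qed.

Lemma mn_mul_funP f g : mn_mul_fun f g \in mn_pred.
Proof.
apply/asboolP; apply: wo_sub (wo_mul (mn_wo f) (mn_wo g)) => c.
rewrite /msup /=; apply: contraPP => nc; apply/negP; rewrite negbK.
rewrite /mn_mul_fun fsbig1// => a [fa ga]; case: nc.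
by exists a, (a^g *g c); rewrite gmulVKg.
Qed.

Definition mn_mul f g : mn := MN (mn_mul_funP f g).

Definition mn_C_fun (b : G) (k : K) (a : G) : K := if a == b then k else 0.

Lemma mn_C_funP b k : mn_C_fun b k \in mn_pred.
Proof.
apply/asboolP; apply: wo_sub (wo1 b) => a.
by rewrite /msup /mn_C_fun /=; case: (eqVneq a b) => // _; rewrite eqxx.
Qed.

Definition mn_C b k : mn := MN (mn_C_funP b k).
Local Notation mn_one := (mn_C gone 1).

Lemma mn_CE b k a : mn_C b k a = if a == b then k else 0. Proof. by []. Qed.

Lemma mn_CM b k f c : mn_mul (mn_C b k) f c = k * f (b^g *g c).
Proof.
rewrite [LHS](@mn_mul_funE _ _ _ [:: b])//; last first.
  by move=> a [] + _; rewrite mn_CE inE; case: (a == b); rewrite ?eqxx.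
by rewrite big_seq1 mn_CE eqxx.
Qed.

Lemma mn_MC b k f c : mn_mul f (mn_C b k) c = f (c *g b^g) * k.
Proof.
rewrite [LHS](@mn_mul_funE _ _ _ [:: c *g b^g])//; last first.
  move=> a [] _; rewrite mn_CE inE.
  case: (eqVneq (a^g *g c) b) => [<- _|]; last by rewrite eqxx.
  by rewrite ginvM ginvK gmulA gmulgV gmul1g.
by rewrite big_seq1 mn_CE ginvM ginvK -gmulA gmulVg gmulg1 eqxx.
Qed.

Lemma mn_mulA : associative mn_mul.
Proof.
move=> f g h; apply: mnP => c.
pose wf := mn_wo f; pose wg := mn_wo g; pose wh := mn_wo h.
have finP := wo_fin_pairs c (wo_mul wf wg) wh.
have finS := wo_fin_pairs c wf (wo_mul wg wh).
(* [r] lists the possible products of the first two exponents, [s] the possible first exponents;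
   both sides become one double sum over [s] and [r]. *)
have [r ur PP] := finite_uniq_seq finP; have [s us SP] := finite_uniq_seq finS.
have inr a : oset_mul (msup f) (msup g) a -> h (a^g *g c) != 0 -> a \in r.
  by move=> fga ha; rewrite PP.
have ins a : f a != 0 -> oset_mul (msup g) (msup h) (a^g *g c) -> a \in s.
  by move=> fa gha; rewrite SP.
rewrite [RHS](@mn_mul_funE _ _ _ r)//; last first.
  move=> a [fga ha]; apply: inr => //.
  apply: contrapT => na; move: fga; rewrite /= /mn_mul_fun fsbig1 ?eqxx//.
  move=> b [fb gb]; case: na.
  by exists b, (b^g *g a); rewrite gmulVKg.
rewrite [LHS](@mn_mul_funE _ _ _ s)//; last first.
  move=> a [fa gha]; apply: ins => //.
  apply: contrapT => na; move: gha; rewrite /= /mn_mul_fun fsbig1 ?eqxx//.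
  move=> b [gb hb]; case: na.
  by exists b, (b^g *g (a^g *g c)); rewrite gmulVKg.
transitivity (\sum_(b <- s) \sum_(a <- r)
    f b * (g (b^g *g a) * h (a^g *g c))).
  apply: eq_bigr => b _; rewrite -mulr_sumr.
  case: (eqVneq (f b) 0) => [->|fb]; first by rewrite !mul0r.
  congr (_ * _).
  rewrite [LHS](@mn_mul_funE _ _ _ [seq b^g *g a | a <- r]).
  - rewrite big_map; apply: eq_bigr => a _; congr (_ * h _).
    by rewrite ginvM ginvK -gmulA gmulVKg.
  - rewrite map_inj_uniq// => x y /(congr1 (gmul b)).
    by rewrite !gmulVKg.
  move=> e [ge he]; apply/mapP; exists (b *g e); last by rewrite gmulKg.
  by apply: inr; [exists b, e|rewrite ginvM -gmulA].
rewrite exchange_big /=; apply: eq_bigr => a _.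
case: (eqVneq (h (a^g *g c)) 0) => [->|ha].
  by rewrite mulr0 big1// => b _; rewrite !mulr0.
rewrite [mn_mul_fun f g a](@mn_mul_funE _ _ _ s)//.
  by rewrite mulr_suml; apply: eq_bigr => b _; rewrite mulrA.
move=> b [fb gb]; apply: ins => //; exists (b^g *g a), (a^g *g c).
by split=> //; rewrite -gmulA gmulVKg.
Qed.

Lemma mn_mulDl : left_distributive mn_mul +%R.
Proof.
move=> f g h; apply: mnP => c; rewrite mnD.
have fin1 := mn_pairs_fin f h c; have fin2 := mn_pairs_fin g h c.
have finU : finite_set (mn_pairs f h c `|` mn_pairs g h c)%classic.
  by rewrite finite_setU.
have [s us PP] := finite_uniq_seq finU.
have ins a : (mn_pairs f h c `|` mn_pairs g h c)%classic a -> a \in s.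
  by move=> ha; rewrite PP.
rewrite [LHS](@mn_mul_funE _ _ _ s)//; last first.
  move=> a [fga ha]; apply: ins.
  case: (eqVneq (f a) 0) => fa; last by left.
  by right; split=> //; move: fga; rewrite mnD fa add0r.
rewrite [X in _ = X + _](@mn_mul_funE _ _ _ s)//; last by move=> a ?; apply: ins; left.
rewrite [X in _ = _ + X](@mn_mul_funE _ _ _ s)//; last by move=> a ?; apply: ins; right.
by rewrite -big_split; apply: eq_bigr => a _; rewrite mnD mulrDl.
Qed.

Lemma mn_mulDr : right_distributive mn_mul +%R.
Proof.
move=> h f g; apply: mnP => c; rewrite mnD.
have fin1 := mn_pairs_fin h f c; have fin2 := mn_pairs_fin h g c.
have finU : finite_set (mn_pairs h f c `|` mn_pairs h g c)%classic.
  by rewrite finite_setU.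
have [s us PP] := finite_uniq_seq finU.
have ins a : (mn_pairs h f c `|` mn_pairs h g c)%classic a -> a \in s.
  by move=> ha; rewrite PP.
rewrite [LHS](@mn_mul_funE _ _ _ s)//; last first.
  move=> a [ha fga]; apply: ins.
  case: (eqVneq (f (a^g *g c)) 0) => fa; last by left.
  by right; split=> //; move: fga; rewrite mnD fa add0r.
rewrite [X in _ = X + _](@mn_mul_funE _ _ _ s)//; last by move=> a ?; apply: ins; left.
rewrite [X in _ = _ + X](@mn_mul_funE _ _ _ s)//; last by move=> a ?; apply: ins; right.
by rewrite -big_split; apply: eq_bigr => a _; rewrite mnD mulrDr.
Qed.

Lemma ginv1 : (gone : G)^g = gone.
Proof. by rewrite -[LHS]gmulg1 gmulVg. Qed.

Lemma mn_mul1r : left_id mn_one mn_mul.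
Proof.
by move=> f; apply: mnP => c; rewrite mn_CM mul1r ginv1 gmul1g.
Qed.

Lemma mn_mulr1 : right_id mn_one mn_mul.
Proof. by move=> f; apply: mnP => c; rewrite mn_MC mulr1 ginv1 gmulg1. Qed.

Lemma mn_one_neq0 : mn_one != 0.
Proof.
apply/eqP => /(congr1 (fun f : mn => f gone)); rewrite mn_CE eqxx mn0.
by move/eqP; rewrite oner_eq0.
Qed.

HB.instance Definition _ := GRing.Zmodule_isNzRing.Build mn
  mn_mulA mn_mul1r mn_mulr1 mn_mulDl mn_mulDr mn_one_neq0.

Lemma mn_CMr b k f c : (mn_C b k * f) c = k * f (b^g *g c).
Proof. exact: mn_CM. Qed.

Lemma mn_MCr b k f c : (f * mn_C b k) c = f (c *g b^g) * k.
Proof. exact: mn_MC. Qed.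

Definition mn_ge f a := forall b, b <g a -> f b = 0.

Definition mn_lead f a := f a != 0 /\ mn_ge f a.

Lemma mn_lead_ex f : f != 0 -> exists a, mn_lead f a.
Proof.
move=> f0; have [||a fa amin] := mn_wo f (msup f) => //.
  apply: contrapT => e; move/eqP: f0; apply; apply: mnP => a.
  by apply/eqP; apply: contrapT => /negP fa; apply: e; exists a.
exists a; split=> // b ba; apply/eqP; apply: contrapT => /negP /amin.
by rewrite ba.
Qed.

Lemma mn_geB f g a : mn_ge f a -> mn_ge g a -> mn_ge (f - g) a.
Proof. by move=> fa ga b ba; rewrite mnB fa// ga// subrr. Qed.

Lemma mn_geD f g a : mn_ge f a -> mn_ge g a -> mn_ge (f + g) a.
Proof. by move=> fa ga b ba; rewrite mnD fa// ga// addr0. Qed.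

Lemma mn_geW f a b : mn_ge f a -> ~~ (a <g b) -> mn_ge f b.
Proof. by move=> fa ab c cb; apply: fa; apply: glt_lt_le cb ab. Qed.

Lemma mn_mulE f g c : (f * g) c = mn_mul_fun f g c. Proof. by []. Qed.

Lemma mn_mul_ge f g m a : mn_ge f m -> mn_ge g a -> mn_ge (f * g) (m *g a).
Proof.
move=> fm ga c cma; rewrite mn_mulE /mn_mul_fun fsbig1// => x [fx gx].
have xm : ~~ (x <g m) by apply/negP => /fm /eqP; rewrite (negPf fx).
move: gx; rewrite ga ?eqxx// -(glt_mul2l x) gmulVKg.
have [->//|mx] := glt_ge xm; apply: glt_trans cma _.
by rewrite glt_mul2r.
Qed.

Lemma mn_mul_lead f g m a : mn_ge f m -> mn_ge g a ->
  (f * g) (m *g a) = f m * g a.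
Proof.
move=> fm ga; rewrite mn_mulE (@mn_mul_funE _ _ _ [:: m])//; last first.
  move=> x [fx gx]; rewrite inE; apply: contraT => xm.
  case/orP: (glt_total xm) => lt.
    by move: fx; rewrite fm ?eqxx.
  by move: gx; rewrite ga ?eqxx// -(glt_mul2l x) gmulVKg glt_mul2r.
by rewrite big_seq1 gmulKg.
Qed.

Lemma mn_ge_mulI f g m a : mn_lead f m -> mn_ge (f * g) (m *g a) -> mn_ge g a.
Proof.
move=> [fm lf] fga b ba; apply/eqP; apply: contrapT => /negP gb.
have [|c [gc lg]] := @mn_lead_ex g.
  by apply: contraNneq gb => ->; rewrite mn0 eqxx.
have ca : c <g a.
  apply: glt_le_trans ba; apply/negP => bc.
  by move: gb; rewrite lg ?eqxx.
have := mn_mul_lead lf lg; rewrite fga ?glt_mul2l// => /esym/eqP.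
by rewrite mulf_eq0 (negPf fm) (negPf gc).
Qed.

(* Transfinite approximation of the inverse without Neumann's lemma: any two
   [g] solving [f * g = 1] below given bounds agree below the smaller bound,
   so all partial solutions glue to a largest one, which is exact since an
   inexact one can be prolonged. *)
Lemma mn_rinv_ex f : f != 0 -> exists g, f * g = 1.
Proof.
move=> f0; have [m fl] := mn_lead_ex f0; have [fm fge] := fl.
apply: contrapT => noinv.
have res0 g : 1 - f * g != 0.
  by apply/eqP => /subr0_eq E; apply: noinv; exists g.
pose part g b := (forall a, g a != 0 -> a <g b) /\ mn_ge (1 - f * g) (m *g b).
have part_le g b g' b' a : part g b -> part g' b' -> ~~ (b' <g b) -> a <g b ->
    g a = g' a.
  move=> [_ gb] [_ gb'] bb' ab; apply/eqP; rewrite -subr_eq0 -mnB; apply/eqP.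
  apply: (mn_ge_mulI fl) ab; rewrite mulrBr.
  have -> : f * g - f * g' = (1 - f * g') - (1 - f * g).
    by rewrite opprB [RHS]addrC addrA subrK.
  apply: mn_geB => //; apply: mn_geW gb' _; by rewrite glt_mul2l.
have part_eq g b g' b' a : part g b -> part g' b' -> a <g b -> a <g b' ->
    g a = g' a.
  move=> pg pg' ab ab'; case: (boolP (b' <g b)) => bb'.
    apply/esym; apply: part_le pg' pg _ ab'.
    by rewrite (glt_asym bb').
  exact: part_le pg pg' bb' ab.
have hU a : exists k : K,
    (forall g b, part g b -> a <g b -> g a = k) /\
    (k != 0 -> exists g b, part g b /\ a <g b).
  case: (pselect (exists g b, part g b /\ a <g b)) => [[g [b [pg ab]]]|no].
    by exists (g a); split=> [g' b' pg' ab'|_]; [exact: part_eq ab' ab|exists g, b].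
  exists 0; split=> [g b pg ab|]; last by rewrite eqxx.
  by case: no; exists g, b.
have [U UP] := choice hU.
have UE g b a : part g b -> a <g b -> U a = g a.
  by move=> pg ab; have [+ _] := UP a => /(_ _ _ pg ab).
have wU : U \in mn_pred.
  apply/asboolP => B BU [b Bb].
  have [_ /(_ (BU _ Bb)) [g [c [pg bc]]]] := UP b.
  case: (mn_wo g (B `&` [set x | x <g c])%classic) => [x [/BU + xc]||x [Bx xc] xmin].
  - by rewrite /msup /= (UE _ _ _ pg xc).
  - by exists b.
  exists x => // y By; apply/negP => yx.
  by have := xmin y (conj By (glt_trans yx xc)); rewrite yx.
pose u : mn := MN wU.
have uE a : u a = U a by [].
have res_ge g b : part g b -> mn_ge (1 - f * u) (m *g b).
  move=> pg; have -> : 1 - f * u = (1 - f * g) + f * (g - u).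
    by rewrite mulrBr [RHS]addrA subrK.
  apply: mn_geD; first by case: pg.
  by apply: mn_mul_ge => // a ab; rewrite mnB uE (UE _ _ _ pg ab) subrr.
have [b' [rb' rge]] := mn_lead_ex (res0 u).
pose b := m^g *g b'; have b'E : b' = m *g b by rewrite gmulVKg.
rewrite {}b'E in rb' rge.
have part_b g c : part g c -> ~~ (b <g c).
  move=> /res_ge rc; apply/negP => bc; move: rb'.
  by rewrite rc ?eqxx// glt_mul2l.
have supu a : u a != 0 -> a <g b.
  rewrite uE => Ua; have [_ /(_ Ua) [g [c [pg ac]]]] := UP a.
  exact: glt_lt_le ac (part_b _ _ pg).
(* The term [k] at [b] cancels the leading term of the residue of [u]. The new residue starts
   strictly later, so [u'] is a partial solution with a bound above [b], against [part_b]. *)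
pose k := (f m)^-1 * (1 - f * u) (m *g b).
pose u' := u + mn_C b k.
have resE : 1 - f * u' = (1 - f * u) - f * mn_C b k.
  by rewrite mulrDr opprD addrA.
have Cge : mn_ge (mn_C b k) b.
  move=> a ab; rewrite mn_CE; case: eqP => // aE.
  by rewrite aE glt_irr in ab.
have r'ge : mn_ge (1 - f * u') (m *g b).
  by rewrite resE; apply: mn_geB => //; apply: mn_mul_ge.
have r'b : (1 - f * u') (m *g b) = 0.
  rewrite resE mnB mn_mul_lead// mn_CE eqxx /k mulrA mulfV// mul1r.
  by rewrite subrr.
have [c' [rc' rcge]] := mn_lead_ex (res0 u').
pose c := m^g *g c'; have c'E : c' = m *g c by rewrite gmulVKg.
rewrite {}c'E in rc' rcge.
have bc : b <g c.
  have [|cb|] := @glt_ge _ c b; last by [].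
    by apply/negP => cb; move: rc'; rewrite r'ge ?eqxx// glt_mul2l.
  by move: rc'; rewrite cb r'b eqxx.
have /part_b : part u' c; last by rewrite bc.
split=> // a; rewrite mnD mn_CE; case: (eqVneq a b) => [->//|_].
by rewrite addr0 => /supu ab; apply: glt_trans bc.
Qed.

(** A right inverse has itself a right inverse, which must be [f]. The value at [0] follows the
    convention that inversion fixes non-units. *)
Lemma mn_inv_ex f : exists g,
  if f == 0 then g = f else g * f = 1 /\ f * g = 1.
Proof.
case: (eqVneq f 0) => [_|f0]; first by exists f.
have [g fg] := mn_rinv_ex f0.
have g0 : g != 0.
  by apply: contra_eq_neq fg => ->; rewrite mulr0 eq_sym oner_neq0.
have [h gh] := mn_rinv_ex g0; exists g; split=> //.
by rewrite -[X in _ * X = _]mulr1 -gh [f * _]mulrA fg mul1r.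
Qed.

Definition mn_inv f : mn := sval (cid (mn_inv_ex f)).

Lemma mn_mulVr : {in [pred f : mn | f != 0], left_inverse 1 mn_inv *%R}.
Proof.
by move=> f; rewrite inE /mn_inv; case: cid => g /=; case: eqP => // _ [].
Qed.

Lemma mn_mulrV : {in [pred f : mn | f != 0], right_inverse 1 mn_inv *%R}.
Proof.
by move=> f; rewrite inE /mn_inv; case: cid => g /=; case: eqP => // _ [].
Qed.

Lemma mn_unitP f g : g * f = 1 /\ f * g = 1 -> [pred f : mn | f != 0] f.
Proof.
by move=> [+ _] /=; apply: contra_eq_neq => ->; rewrite mulr0 eq_sym oner_neq0.
Qed.

Lemma mn_inv_out : {in [predC [pred f : mn | f != 0]], mn_inv =1 id}.
Proof.
by move=> f; rewrite !inE negbK /mn_inv; case: cid => g /=; case: eqP.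
Qed.

HB.instance Definition _ := GRing.NzRing_hasMulInverse.Build mn
  mn_mulVr mn_mulrV mn_unitP mn_inv_out.

Lemma mn_skew : is_skew_field mn.
Proof. by []. Qed.

End MalcevNeumann.

(** * The ordering of the free group *)

Section FreeGroup.

Variable d : nat.

Local Notation word := (seq 'I_d).
Local Notation letter := ('I_d * bool)%type.
Local Notation series := (word -> int).
Implicit Types (m : word) (phi psi : series) (l : letter) (w : seq letter).

(** A well-order of the words that refines length; [pickle] breaks ties arbitrarily. *)
Definition wlt m m' := (size m < size m')%N ||
  ((size m == size m') && (pickle m < pickle m')%N).

Lemma wlt_trans m2 m1 m3 : wlt m1 m2 -> wlt m2 m3 -> wlt m1 m3.
Proof.
rewrite /wlt => /orP[l12|/andP[/eqP-> p12]] /orP[l23|/andP[/eqP<- p23]].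
- by rewrite (ltn_trans l12 l23).
- by rewrite l12.
- by rewrite l23.
by rewrite eqxx (ltn_trans p12 p23) orbT.
Qed.

Lemma wlt_total m m' : m != m' -> wlt m m' || wlt m' m.
Proof.
move=> mm'; rewrite /wlt; case: (ltngtP (size m) (size m')) => //= _.
case: ltngtP => // /(pcan_inj pickleK) mE.
by rewrite mE eqxx in mm'.
Qed.

Lemma wlt_min (P : word -> Prop) : (exists m, P m) ->
  exists2 m, P m & forall m', wlt m' m -> ~ P m'.
Proof.
move=> [m0 Pm0].
have exn : exists n, `[< exists m, P m /\ size m = n >].
  by exists (size m0); apply/asboolP; exists m0.
case: (ex_minnP exn) => n /asboolP[m1 [Pm1 sm1]] nmin.
have exp : exists p, `[< exists m, [/\ P m, size m = n & pickle m = p] >].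
  by exists (pickle m1); apply/asboolP; exists m1.
case: (ex_minnP exp) => p /asboolP[m [Pm sm pm]] pmin.
exists m => // m' /orP[lt|/andP[/eqP sm' pm']] Pm'.
  by move: lt; rewrite sm ltnNge nmin//; apply/asboolP; exists m'.
by move: pm'; rewrite pm ltnNge pmin//; apply/asboolP; exists m'; rewrite sm' sm.
Qed.

Definition vge phi m := forall m', wlt m' m -> phi m' = 0.

(* multiplication of a noncommutative power series by [1 + x_i] and its
   inverse, on the left *)
Definition actp i phi m : int :=
  phi m + if m is j :: m' then if j == i then phi m' else 0 else 0.

Fixpoint actn i phi m : int :=
  if m is j :: m' then phi m - if j == i then actn i phi m' else 0 else phi m.

Definition act l : series -> series := if l.2 then actp l.1 else actn l.1.

Definition flip l : letter := (l.1, ~~ l.2).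

Lemma flipK : involutive flip.
Proof. by case=> i b; rewrite /flip /= negbK. Qed.

Lemma actpK i : cancel (actp i) (actn i).
Proof.
move=> phi; apply/funext; elim=> [|j m IH]; first by rewrite /= /actp addr0.
rewrite /= /actp; case: (j == i); last by rewrite addr0 subr0.
by rewrite IH addrK.
Qed.

Lemma actnK i : cancel (actn i) (actp i).
Proof.
move=> phi; apply/funext; case=> [|j m] /=; rewrite /actp /= ?addr0//.
by rewrite subrK.
Qed.

Lemma actK l : cancel (act l) (act (flip l)).
Proof.
by case: l => i [] phi; rewrite /act /flip /= ?actpK ?actnK.
Qed.

Lemma actVK l : cancel (act (flip l)) (act l).
Proof. by move=> phi; rewrite -{1}[l]flipK actK. Qed.

Lemma actpB i phi psi m :
  actp i (fun m => phi m - psi m) m = actp i phi m - actp i psi m.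
Proof.
rewrite /actp opprD addrACA; congr (_ + _).
by case: m => [|j m]; [rewrite subr0|case: ifP => _; rewrite ?subr0].
Qed.

Lemma actB l phi psi :
  act l (fun m => phi m - psi m) = (fun m => act l phi m - act l psi m).
Proof.
case: l => i b; rewrite /act /=; case: b; first by apply/funext => m; exact: actpB.
apply: (can_inj (actpK i)); rewrite actnK; apply/funext => m.
by rewrite actpB !actnK.
Qed.

Lemma wlt_irr m : wlt m m = false.
Proof. by rewrite /wlt !ltnn andbF. Qed.

(** Such an operator keeps the position and the value of a leading term, hence the sign of a
    difference; this makes the order of the group invariant under multiplication. *)
Definition vge_stable (L : series -> series) := forall phi m,
  vge phi m -> vge (L phi) m /\ L phi m = phi m.

Lemma vge_stable_size (L : series -> series) :
  (forall phi m, L phi m = phi m \/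
    exists2 m', (size m' < size m)%N & L phi m = phi m + phi m') ->
  vge_stable L.
Proof.
move=> LE phi m pm; have tail m' : ~~ wlt m m' -> L phi m' = phi m'.
  move=> n; have [//|[m1 m1m' ->]] := LE phi m'.
  have lt : wlt m1 m' by rewrite /wlt m1m'.
  suff lt' : wlt m1 m by rewrite (pm _ lt') addr0.
  case: (eqVneq m' m) => [m'm|m'm]; first by rewrite -m'm.
  by apply: wlt_trans lt _; case/orP: (wlt_total m'm) => //; rewrite (negPf n).
split=> [m' m'm|]; last by rewrite tail// wlt_irr.
rewrite tail; first exact: pm.
by apply/negP => /(wlt_trans m'm); rewrite wlt_irr.
Qed.

Lemma vge_stable_inv (L L' : series -> series) :
  cancel L' L -> vge_stable L -> vge_stable L'.
Proof.
move=> LK Lge phi m pm.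
suff ge : vge (L' phi) m by split=> //; have [_ <-] := Lge _ _ ge; rewrite LK.
move=> m' m'm; apply: contrapT => nz.
have [m1 [nz1 lt1] m1min] := @wlt_min (fun x => L' phi x <> 0 /\ wlt x m)
  (ex_intro _ m' (conj nz m'm)).
apply: nz1; have [|_ <-] := Lge (L' phi) m1; last by rewrite LK pm.
move=> x xm1; apply: contrapT => nx; case: (m1min _ xm1).
by split=> //; apply: wlt_trans lt1.
Qed.

Lemma act_ge l : vge_stable (act l).
Proof.
have geT i : vge_stable (act (i, true)).
  apply: vge_stable_size => phi m; rewrite /act /= /actp.
  case: m => [|j m]; first by left; rewrite addr0.
  by case: ifP => _; [right; exists m|left; rewrite addr0].
case: l => i []; first exact: geT.
exact: vge_stable_inv (actVK (i, true)) (geT i).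
Qed.

(** Multiplication on the right, obtained from [act] by reversing words. *)
Definition ract l phi : series := fun m => act l (fun m => phi (rev m)) (rev m).

Lemma ractK l : cancel (ract l) (ract (flip l)).
Proof.
move=> phi; apply/funext => m; rewrite /ract.
have -> : (fun m => act l (fun m => phi (rev m)) (rev (rev m))) =
   act l (fun m => phi (rev m)) by apply/funext => x; rewrite revK.
by rewrite actK revK.
Qed.

Lemma ractB l phi psi :
  ract l (fun m => phi m - psi m) = (fun m => ract l phi m - ract l psi m).
Proof. by rewrite /ract actB. Qed.

Lemma ractVK l : cancel (ract (flip l)) (ract l).
Proof. by move=> phi; rewrite -{1}[l]flipK ractK. Qed.

Lemma ractp_rcons i phi m j : ract (i, true) phi (rcons m j) =
  phi (rcons m j) + if j == i then phi m else 0.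
Proof. by rewrite /ract /act /= rev_rcons /actp revK rev_cons revK. Qed.

Lemma ractp_nil i phi : ract (i, true) phi [::] = phi [::].
Proof. by rewrite /ract /act /= /rev /= /actp addr0. Qed.

Lemma actp_comm i j phi :
  act (i, true) (ract (j, true) phi) = ract (j, true) (act (i, true) phi).
Proof.
apply/funext; case=> [|k m].
  by rewrite ractp_nil /act /= /actp ractp_nil.
rewrite /act /= /actp; case/lastP: m => [|m k'].
  rewrite -[[:: k]]/(rcons [::] k) !ractp_rcons ractp_nil addr0.
  by rewrite -!addrA; congr (_ + _); rewrite addrC.
rewrite -rcons_cons !ractp_rcons rcons_cons.
case: (k == i); case: (k' == j); rewrite ?addr0// -!addrA; congr (_ + _).
by rewrite addrCA.
Qed.

(** Associativity: checked on coefficients for the factors [1 + x_i], then carried to their inverses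
    by cancellation. *)
Lemma act_comm l l' phi : act l (ract l' phi) = ract l' (act l phi).
Proof.
have inv1 j b i :
    (forall phi, act (i, true) (ract (j, b) phi) = ract (j, b) (act (i, true) phi)) ->
    forall phi, act (i, false) (ract (j, b) phi) = ract (j, b) (act (i, false) phi).
  move=> H psi; apply: (can_inj (actK (i, true))).
  by rewrite H !(actVK (i, true)).
have inv2 i j : forall phi,
    act (i, true) (ract (j, false) phi) = ract (j, false) (act (i, true) phi).
  move=> psi; apply: (can_inj (ractK (j, true))).
  by rewrite -actp_comm !(ractVK (j, true)).
case: l => i b; case: l' => j b'.
have H : forall phi, act (i, true) (ract (j, b') phi) = ract (j, b') (act (i, true) phi).
  by case: b' => psi; [exact: actp_comm|exact: inv2].
by case: b; [exact: H|exact: inv1].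
Qed.

Lemma ract_ge l : vge_stable (ract l).
Proof.
have geT i : vge_stable (ract (i, true)).
  apply: vge_stable_size => phi; case/lastP=> [|m j].
    by left; rewrite ractp_nil.
  rewrite ractp_rcons; case: ifP => _; last by left; rewrite addr0.
  by right; exists m => //; rewrite size_rcons.
case: l => i []; first exact: geT.
exact: vge_stable_inv (ractVK (i, true)) (geT i).
Qed.

Definition delta : series := fun m => (m == [::])%:R.

Lemma act_delta l : act l delta = ract l delta.
Proof.
have dr : (fun m => delta (rev m)) = delta.
  by apply/funext => m; rewrite /delta -size_eq0 size_rev size_eq0.
have HT i : act (i, true) delta = ract (i, true) delta.
  apply/funext => m; rewrite /ract dr /act /= /actp.
  have -> : delta (rev m) = delta m by rewrite -[in RHS]dr.
  congr (_ + _); case: m => [//|j [//|k m]].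
  rewrite !rev_cons; case: (rev m) => [|h t] /=; rewrite /delta /=.
    by rewrite !if_same.
  by rewrite -size_eq0 !size_rcons !if_same.
case: l => i []; first exact: HT.
apply: (can_inj (actK (i, true))); rewrite act_comm HT.
by rewrite (actVK (i, true)) (ractK (i, true)).
Qed.

(** [eval w delta] is the Magnus image of [w], where [(i, true)] stands for [1 + x_i] and
    [(i, false)] for its inverse; [reval] multiplies by the same factors on the right. *)
Definition eval w phi := foldr act phi w.
Definition reval w phi := foldl (fun phi l => ract l phi) phi w.

Lemma eval_cat w w' phi : eval (w ++ w') phi = eval w (eval w' phi).
Proof. exact: foldr_cat. Qed.

Lemma eval_ract w l phi : eval w (ract l phi) = ract l (eval w phi).
Proof. by elim: w => //= l' w ->; rewrite act_comm. Qed.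

Lemma eval_reval w w' phi : eval w (reval w' phi) = reval w' (eval w phi).
Proof. by elim: w' phi => //= l w' IH phi; rewrite IH eval_ract. Qed.

Lemma eval_delta w : eval w delta = reval w delta.
Proof.
elim: w => //= l w ->; rewrite -act_delta.
by rewrite -[act l (reval _ _)]/(eval [:: l] _) eval_reval.
Qed.

Lemma evalB w phi psi :
  eval w (fun m => phi m - psi m) = (fun m => eval w phi m - eval w psi m).
Proof. by elim: w => //= l w ->; rewrite actB. Qed.

Lemma revalB w phi psi :
  reval w (fun m => phi m - psi m) = (fun m => reval w phi m - reval w psi m).
Proof. by elim: w phi psi => //= l w IH phi psi; rewrite ractB IH. Qed.

Lemma eval_ge w : vge_stable (eval w).
Proof.
elim: w => [|l w IH] phi m //= /IH[pm <-].
exact: act_ge.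
Qed.

Lemma reval_ge w : vge_stable (reval w).
Proof.
elim: w => [|l w IH] phi m //= /(ract_ge l)[pm <-].
exact: IH.
Qed.

Definition winv w := rev (map flip w).

Lemma eval_winv w : cancel (eval w) (eval (winv w)).
Proof.
elim: w => // l w IH phi; rewrite /winv /= rev_cons -cats1 eval_cat /=.
by rewrite actK IH.
Qed.

Lemma winvK : involutive winv.
Proof. by move=> w; rewrite /winv map_rev revK mapK//; exact: flipK. Qed.

Lemma eval_winvV w : cancel (eval (winv w)) (eval w).
Proof. by move=> phi; rewrite -{1}[w]winvK eval_winv. Qed.

Definition reduced w := sorted (fun l l' => l' != flip l) w.

Lemma reduced_winv w : reduced w -> reduced (winv w).
Proof.
rewrite /reduced /winv rev_sorted sorted_map; apply: sub_sorted => l l'.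
by rewrite /= flipK eq_sym.
Qed.

(* Magnus: reading off the coefficient of a product of distinct consecutive
   variables, one for each syllable. *)
Lemma eval_syllable l w : reduced (l :: w) ->
  exists m, [/\ sorted [rel i j | i != j] (l.1 :: m),
    eval (l :: w) delta m != 0,
    exists2 e : nat, (0 < e)%N & eval (l :: w) delta (l.1 :: m) =
       (-1) ^+ (~~ l.2) * e%:R * eval (l :: w) delta m,
    forall m', sorted [rel i j | i != j] (l.1 :: m') -> (size m < size m')%N ->
       eval (l :: w) delta m' = 0 &
    forall m', sorted [rel i j | i != j] m' -> ((size m).+1 < size m')%N ->
       eval (l :: w) delta m' = 0].
Proof.
have actE i b phi m : sorted [rel i j | i != j] (i :: m) ->
    act (i, b) phi m = phi m.
  case: m => [|j m] /=; first by case: b; rewrite /act /= /actp ?addr0.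
  rewrite eq_sym => /andP[/negPf ji _].
  by case: b; rewrite /act /= /actp /= ji ?addr0 ?subr0.
(* On words without equal neighbours only one leading [x_i] can be split off, so the expansion of
   [(1 + x_i)^-1] contributes just [1 - x_i]. *)
have actE2 i b phi m : sorted [rel i j | i != j] (i :: m) ->
    act (i, b) phi (i :: m) = phi (i :: m) + (-1) ^+ (~~ b) * phi m.
  move=> im; case: b; rewrite /act /= /actp /= eqxx ?expr0 ?mul1r//.
  by rewrite expr1 mulN1r -[actn i phi m]/(act (i, false) phi m) actE.
elim: w l => [|l' w IH] [i b].
  move=> _; exists [::]; split=> //.
  - by rewrite /= actE.
  - by exists 1%N => //=; rewrite actE2// actE// /delta /= add0r !mulr1.
  - move=> [|j m] //= im _; rewrite actE//.
  move=> [|j m] //= jm sm; case: (eqVneq j i) => [jE|ji].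
    by rewrite -jE in jm *; rewrite actE2// /delta; case: m {jm} sm => //=; rewrite mulr0.
  by rewrite actE//= eq_sym ji.
move=> /= /andP[ll' lw]; have {IH}[m [im nm [e e0 em] v1 v2]] := IH _ lw.
set phi := eval (l' :: w) delta in nm em v1 v2 *.
have phiE : act l' (eval w delta) = phi by [].
(* Either the letter prolongs the first syllable, with the same sign since the word is reduced, and
   the exponent [e] grows by one; or it opens a new syllable and [m] receives the letter [l'.1]. *)
rewrite phiE; have [iE|il'] := eqVneq i l'.1.
  have bE : b = l'.2.
    move: ll'; rewrite iE; case: l' {lw im em v1 v2 phi nm phiE iE} => j c.
    by rewrite /flip /= xpair_eqE eqxx /=; case: b c => [] [].
  exists m; rewrite iE; split=> //.
  - by rewrite actE.
  - exists e.+1 => //; rewrite actE2// actE// em bE -mulrDl -natr1 mulrDr mulr1.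
    by [].
  - by move=> m' im' sm; rewrite actE// v1.
  move=> [|j m'] // jm' sm; case: (eqVneq j l'.1) => [jE|jl'].
    by rewrite jE in jm' *; rewrite actE2// v2// v1// mulr0 addr0.
  by rewrite actE ?v2//= eq_sym jl'.
have iim : sorted [rel i j | i != j] [:: i, l'.1 & m] by rewrite /= il'.
have nlm : phi (l'.1 :: m) != 0.
  by rewrite em !mulf_neq0 ?signr_eq0// pnatr_eq0 -lt0n.
exists (l'.1 :: m); split=> //.
- by rewrite actE.
- by exists 1%N => //; rewrite actE2// actE// v2//= add0r mulr1.
- move=> m' im' sm; rewrite actE// v2//.
  by move: im'; case: (m') => //= ? ? /andP[].
move=> [|j m'] // jm' sm; case: (eqVneq j i) => [jE|ji].
  rewrite jE in jm' *; rewrite actE2// v2//; last by apply: ltn_trans sm.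
  rewrite v2 ?mulr0 ?addr0//.
  by move: jm'; case: (m') => //= ? ? /andP[].
rewrite actE ?v2//; first by apply: ltn_trans sm.
by rewrite /= eq_sym ji.
Qed.

Lemma eval_reduced_neq1 w : reduced w -> eval w delta = delta -> w = [::].
Proof.
case: w => // l w rw E; have [m [_ nm [e e0 em] _ _]] := eval_syllable rw.
rewrite E in nm em; move/esym/eqP: em.
by rewrite !mulf_eq0 signr_eq0 (negPf nm) pnatr_eq0 orbF eqn0Ngt e0.
Qed.

(** Once common first letters are cancelled, two distinct nonempty words give a nonempty reduced
    word [winv w ++ w'] with trivial Magnus image. *)
Lemma eval_inj w w' : reduced w -> reduced w' ->
  eval w delta = eval w' delta -> w = w'.
Proof.
elim: w w' => [|l w IH] [|l' w'] rw rw' // E.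
- by rewrite (eval_reduced_neq1 rw' (esym E)).
- by rewrite (eval_reduced_neq1 rw E).
have [ll'|ll'] := eqVneq l l'.
  rewrite -ll' in E *; congr (_ :: _); apply: IH.
  - exact: path_sorted rw.
  - exact: path_sorted rw'.
  exact: (can_inj (actK l)) E.
suff /eval_reduced_neq1 : reduced (winv (l :: w) ++ l' :: w').
  rewrite eval_cat -E eval_winv => /(_ erefl).
  by move/(congr1 size)/eqP; rewrite size_cat /= addnS.
rewrite /winv /= rev_cons cat_rcons /reduced.
have /= := reduced_winv rw; rewrite /winv /= rev_cons => rr.
rewrite -cat_rcons.
case: (rcons _ _) (last_rcons l (rev (map flip w)) (flip l)) rr => //= x s lE rr.
by rewrite cat_path rr /= lE flipK eq_sym ll'.
Qed.

End FreeGroup.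

(** * Reduced words as an ordered group, and their Cayley tree *)

Section FreeOrderedGroup.

Variable d : nat.

Local Notation letter := ('I_d * bool)%type.
Local Notation series := (seq 'I_d -> int).

Definition rstep (l : letter) (w : seq letter) :=
  if w is l' :: w' then if l' == flip l then w' else l :: w else [:: l].

Lemma rstep_reduced l w : reduced w -> reduced (rstep l w).
Proof.
case: w => [|l' w] //= rw; case: ifPn => [_|ne]; first exact: path_sorted rw.
by rewrite /reduced /= ne.
Qed.

Lemma eval_rstep l w phi : eval (rstep l w) phi = act l (eval w phi).
Proof.
case: w => [|l' w] //=; case: ifPn => [/eqP ->|//].
by rewrite (actVK l).
Qed.

Definition wreduce w := foldr rstep [::] w.

Lemma wreduceP w : reduced (wreduce w).
Proof. by elim: w => //= l w IH; exact: rstep_reduced. Qed.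

Lemma eval_wreduce w phi : eval (wreduce w) phi = eval w phi.
Proof. by elim: w => //= l w IH; rewrite eval_rstep IH. Qed.

Definition fgroup := {w : seq letter | reduced w}.
Implicit Types a b c : fgroup.

Definition fgred w : fgroup := exist _ (wreduce w) (wreduceP w).
Definition fgmul a b := fgred (val a ++ val b).
Definition fgone : fgroup := fgred [::].
Definition fginv a := fgred (winv (val a)).
Definition fgval a : series := eval (val a) (@delta d).
(** The Magnus order: the first coefficient where the two images differ decides. *)
Definition fglt a b := `[< exists2 m, vge (fun m => fgval b m - fgval a m) m &
  0 < fgval b m - fgval a m >].

Lemma fgval_inj : injective fgval.
Proof. by move=> a b /eval_inj E; apply/val_inj/E; [exact: valP|exact: valP]. Qed.

Lemma fgvalM a b : fgval (fgmul a b) = eval (val a) (fgval b).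
Proof. by rewrite /fgval /= eval_wreduce eval_cat. Qed.

Lemma fg_wreduce a : wreduce (val a) = val a.
Proof.
apply: eval_inj; first exact: wreduceP.
  exact: valP.
by rewrite eval_wreduce.
Qed.

Lemma fgmulA : associative fgmul.
Proof.
by move=> a b c; apply: fgval_inj; rewrite !fgvalM /= eval_wreduce eval_cat.
Qed.

Lemma fgmul1g : left_id fgone fgmul.
Proof. by move=> a; apply: fgval_inj; rewrite fgvalM. Qed.

Lemma fgmulg1 : right_id fgone fgmul.
Proof. by move=> a; apply: fgval_inj; rewrite fgvalM. Qed.

Lemma fgmulVg : left_inverse fgone fginv fgmul.
Proof.
by move=> a; apply: fgval_inj; rewrite fgvalM /= eval_wreduce eval_winv.
Qed.

Lemma fgmulgV : right_inverse fgone fginv fgmul.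
Proof.
by move=> a; apply: fgval_inj; rewrite fgvalM /fgval /= eval_wreduce eval_winvV.
Qed.

Lemma fglt_irr : irreflexive fglt.
Proof. by move=> a; apply/asboolP => -[m _]; rewrite subrr ltxx. Qed.

Lemma fglt_trans : transitive fglt.
Proof.
move=> b a c /asboolP[m v1 p1] /asboolP[m' v2 p2]; apply/asboolP.
have E x : fgval c x - fgval a x = (fgval b x - fgval a x) + (fgval c x - fgval b x).
  by rewrite [RHS]addrC addrA subrK.
have [mm'|] := boolP (wlt m m').
  exists m; last by rewrite E (v2 _ mm') addr0.
  by move=> x xm; rewrite E v1// v2 ?addr0//; apply: wlt_trans mm'.
case: (eqVneq m m') => [E' _|mm' nm].
  by rewrite -E' in v2 p2; exists m; [move=> x xm; rewrite E v1// v2|rewrite E addr_gt0].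
have m'm : wlt m' m by case/orP: (wlt_total mm') => //; rewrite (negPf nm).
exists m'; last by rewrite E (v1 _ m'm) add0r.
by move=> x xm; rewrite E v2// v1 ?addr0//; apply: wlt_trans m'm.
Qed.

Lemma fglt_total a b : a != b -> fglt a b || fglt b a.
Proof.
move=> ab.
have [|m nm mmin] := @wlt_min d (fun m => fgval a m <> fgval b m).
  apply: contrapT => no; move/eqP: ab; apply; apply: fgval_inj.
  by apply/funext => m; apply: contrapT => nm; apply: no; exists m.
have eqm x : wlt x m -> fgval a x = fgval b x.
  by move=> /mmin; exact: contrapT.
case: (ltgtP (fgval a m) (fgval b m)) => // lt; apply/orP; [left|right];
  apply/asboolP; exists m; rewrite ?subr_gt0// => x xm;
  by rewrite eqm// subrr.
Qed.

Lemma fglt_stable (L : series -> series) a b a' b' :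
  vge_stable L -> (forall phi psi : series,
     L (fun m => phi m - psi m) = fun m => L phi m - L psi m) ->
  fgval a' = L (fgval a) -> fgval b' = L (fgval b) -> fglt a b -> fglt a' b'.
Proof.
move=> Lge LB aE bE /asboolP[m vm pm]; apply/asboolP; exists m.
  by have [+ _] := Lge _ _ vm; rewrite LB aE bE.
by have [_ E] := Lge _ _ vm; rewrite aE bE -[_ - _]/((fun m => _ m - _ m) m) -LB E.
Qed.

Lemma fglt_mul2l c a b : fglt (fgmul c a) (fgmul c b) = fglt a b.
Proof.
have H c' a' b' : fglt a' b' -> fglt (fgmul c' a') (fgmul c' b').
  apply: (@fglt_stable (eval (val c'))); rewrite ?fgvalM//.
    exact: eval_ge.
  exact: evalB.
apply/idP/idP; last exact: H.
by move/(H (fginv c)); rewrite !fgmulA fgmulVg !fgmul1g.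
Qed.

Lemma fglt_mul2r c a b : fglt (fgmul a c) (fgmul b c) = fglt a b.
Proof.
have E a' c' : fgval (fgmul a' c') = reval (val c') (fgval a').
  by rewrite fgvalM {2}/fgval -eval_reval -eval_delta.
have H c' a' b' : fglt a' b' -> fglt (fgmul a' c') (fgmul b' c').
  apply: (@fglt_stable (reval (val c'))); rewrite ?E//.
    exact: reval_ge.
  exact: revalB.
apply/idP/idP; last exact: H.
by move/(H (fginv c)); rewrite -!fgmulA fgmulgV !fgmulg1.
Qed.

Definition free_ogroup : ogroup := OGroup fgmulA fgmul1g fgmulg1 fgmulVg fgmulgV
  fglt_irr fglt_trans fglt_total fglt_mul2l fglt_mul2r.

Definition fggen (i : 'I_d) : fgroup := fgred [:: (i, true)].

Lemma fggen_mul i a : val (fgmul (fggen i) a) = rstep (i, true) (val a).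
Proof. by rewrite /= fg_wreduce. Qed.

(** The unit at [ord0] matches the constant coefficient of a pencil. *)
Definition fggen0 (k : 'I_d.+1) : fgroup :=
  if unlift ord0 k is Some i then fggen i else fgone.

(* In the Cayley tree, each [a] has [d] edges [a -- x_i * a] ; [fgparent a] is
   the index of the translate of [a] nearest to the root. *)
Definition fgparent a : 'I_d.+1 :=
  if val a is (i, false) :: _ then lift ord0 i else ord0.

(** Away from the parent index a translate reveals its origin: it is [(i, true)] put in front of
    [a], or it is [a] itself and [a] starts with some [(i, false)]. *)
Lemma fggen0_mulP (k : 'I_d.+1) a : k != fgparent a ->
  if unlift ord0 k is Some i then val (fgmul (fggen0 k) a) = (i, true) :: val a
  else fgmul (fggen0 k) a = a /\ exists i w, val a = (i, false) :: w.
Proof.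
rewrite /fggen0; case: unliftP => [i|] -> kp.
  rewrite fggen_mul; move: kp; rewrite /fgparent; case: (val a) => [|[j b] w] //=.
  rewrite /flip /= xpair_eqE; case: b; rewrite ?andbF//= andbT.
  by rewrite (inj_eq (@lift_inj _ _)) eq_sym; case: eqP.
split; first exact: fgmul1g.
by move: kp; rewrite /fgparent; case: (val a) => [|[i []] w] //= _; exists i, w.
Qed.

Lemma fgparent_mul a :
  fgmul (fggen0 (fgparent a)) a = a \/
  (size (val (fgmul (fggen0 (fgparent a)) a)) < size (val a))%N.
Proof.
rewrite /fgparent /fggen0; case E: (val a) => [|[i []] w].
- by left; rewrite unlift_none; exact: fgmul1g.
- by left; rewrite unlift_none; exact: fgmul1g.
by right; rewrite liftK fggen_mul E /= /flip /= eqxx.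
Qed.

Lemma fgparent_out a i : fgmul (fggen0 (fgparent a)) a = a ->
  forall w, val a <> (i, false) :: w.
Proof.
move=> + w E; rewrite /fgparent /fggen0 E liftK => /(congr1 val).
rewrite fggen_mul E /= /flip /= eqxx => /(congr1 size) /=.
by elim: (size w) => // n IH [].
Qed.

(* The edges from [A] together with the vertices of [A] that they miss and one
   more vertex are distinct: a forest with [d * r] edges has more than [d * r]
   vertices. *)
Lemma tree_count r (a : 'I_r -> fgroup) (j0 : 'I_r) : injective a ->
  (forall j, (size (val (a j0)) <= size (val (a j)))%N) ->
  forall (k k' : 'I_d.+1) (j j' : 'I_r),
    k != fgparent (a j) \/ j = j0 -> k' != fgparent (a j') \/ j' = j0 ->
    fgmul (fggen0 k) (a j) = fgmul (fggen0 k') (a j') -> k = k' /\ j = j'.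
Proof.
move=> inja jmin.
have main k k' j j' : k != fgparent (a j) -> k' != fgparent (a j') ->
    fgmul (fggen0 k) (a j) = fgmul (fggen0 k') (a j') -> k = k' /\ j = j'.
  move=> /fggen0_mulP + /fggen0_mulP.
  case: unliftP => [i|] ->; case: unliftP => [i'|] ->.
  - move=> E E' /(congr1 val); rewrite E E' => -[-> /val_inj/inja ->].
    by [].
  - move=> E [E' [i' [w E2]]] /(congr1 val).
    by rewrite E E' E2.
  - move=> [E' [i0 [w E2]]] E /(congr1 val).
    by rewrite E E' E2.
  by move=> [-> _] [-> _] /inja ->.
(* The minimal length of [a j0] separates its parent translate from every translate by a non-parent
   index. *)
have root k j : k != fgparent (a j) ->
    fgmul (fggen0 (fgparent (a j0))) (a j0) = fgmul (fggen0 k) (a j) -> False.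
  move=> /fggen0_mulP.
  have := fgparent_mul (a j0); set p := fgmul _ (a j0) => pE.
  case: unliftP => [i|] kE; first move=> qE; last move=> [qE [i [w aE]]].
    move=> /(congr1 val); rewrite qE => E.
    have : (size (val p) <= size (val (a j)))%N.
      by apply: leq_trans (jmin j); case: pE => [->|/ltnW].
    by rewrite E /= ltnn.
  rewrite qE => E; case: pE => [pE|].
    by apply: (fgparent_out pE (i := i) (w := w)); rewrite -aE -E pE.
  by rewrite E ltnNge jmin.
move=> k k' j j'.
case: (eqVneq k (fgparent (a j))) => [-> [//|->]|kp _];
case: (eqVneq k' (fgparent (a j'))) => [-> [//|->]|kp' _] //.
- by move=> /(root _ _ kp').
- by move=> /esym /(root _ _ kp).
exact: main.
Qed.

End FreeOrderedGroup.

(** * Singular pencils over the universal field of fractions *)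

Section GeneratedSkewField.

Variables (R : nzRingType) (D : unitRingType) (phi : {rmorphism R -> D}).

(** The skew subfield generated by the image of [phi]: universality concerns epic fields, and [D]
    may be larger. *)
Definition gen_pred : pred D := fun x => `[< forall S : D -> Prop,
  is_Rsubring phi S -> (forall x, S x -> x != 0 -> S x^-1) -> S x >].

Lemma gen_divring : divring_closed gen_pred.
Proof.
split=> [|x y /asboolP gx /asboolP gy|x y /asboolP gx /asboolP gy];
    apply/asboolP => S RS SV; have [Sphi SB SM] := RS.
- by rewrite -(rmorph1 phi).
- by apply: SB; [exact: gx|exact: gy].
apply: SM; first exact: gx.
have Sy : S y by exact: gy.
by case: (eqVneq y 0) Sy => [->|y0 /SV]; [rewrite invr0|exact].
Qed.

HB.instance Definition _ := GRing.isDivringClosed.Build D gen_pred gen_divring.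

Record gen_field := GenField { gf_val : D; gf_valP : gf_val \in gen_pred }.

HB.instance Definition _ := [isSub for gf_val].
HB.instance Definition _ := [Choice of gen_field by <:].
HB.instance Definition _ := [SubChoice_isSubUnitRing of gen_field by <:].

Lemma gen_phi r : phi r \in gen_pred.
Proof. by apply/asboolP => S [Sphi _ _] _. Qed.

Definition gen_inj r : gen_field := GenField (gen_phi r).

Lemma gen_inj_zmod : zmod_morphism gen_inj.
Proof. by move=> r s; apply: val_inj; rewrite raddfB; exact: rmorphB. Qed.

Lemma gen_inj_monoid : monoid_morphism gen_inj.
Proof.
split=> [|r s]; apply: val_inj; first exact: rmorph1.
by rewrite rmorphM; exact: rmorphM.
Qed.

HB.instance Definition _ := GRing.isZmodMorphism.Build R gen_field gen_inj
  gen_inj_zmod.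
HB.instance Definition _ := GRing.isMonoidMorphism.Build R gen_field gen_inj
  gen_inj_monoid.

Lemma gen_epic : is_skew_field D -> is_epic_field gen_inj.
Proof.
move=> D_skew.
have gf_skew : is_skew_field gen_field.
  move=> x x0; have ux : val x \is a GRing.unit.
    by apply: D_skew; apply: contraNneq x0 => x0; apply/eqP/val_inj; rewrite x0 raddf0.
  have vP : (val x)^-1 \in gen_pred by rewrite rpredV; exact: gf_valP.
  apply/unitrP; exists (GenField vP).
  by split; apply: val_inj; rewrite rmorphM rmorph1 /= (mulVr, divrr).
split=> // S [Sphi SB SM] SV x; have /asboolP := gf_valP x.
move=> /(_ (fun z => exists2 x : gen_field, val x = z & S x)) [||z /val_inj <- //].
  split=> [r|_ _ [a <- Sa] [b <- Sb]|_ _ [a <- Sa] [b <- Sb]].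
  - by exists (gen_inj r).
  - by exists (a - b); [rewrite raddfB|exact: SB].
  by exists (a * b); [rewrite rmorphM|exact: SM].
move=> _ [a <- Sa] a0; have a0' : a != 0 by apply: contraNneq a0 => ->; rewrite raddf0.
by exists a^-1; [rewrite rmorphV// gf_skew|exact: SV].
Qed.

End GeneratedSkewField.

(** * Leading terms of independent series *)

Section MalcevNeumannScalars.

Variables (K : fieldType) (G : ogroup).
Local Notation D := (mn K G).

Definition mnK (c : K) : D := mn_C gone c.

Lemma mnKM c (f : D) a : (mnK c * f) a = c * f a.
Proof. by rewrite mn_CMr ginv1 gmul1g. Qed.

Lemma mnKMM c (f g : D) a : (mnK c * f * g) a = c * (f * g) a.
Proof. by rewrite -mulrA mnKM. Qed.

Lemma mnK_zmod : zmod_morphism mnK.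
Proof.
move=> a b; apply: mnP => g; rewrite mnB !mn_CE.
by case: eqP; rewrite ?subrr.
Qed.

Lemma mnK_monoid : monoid_morphism mnK.
Proof.
split=> // a b; apply: mnP => g; rewrite mnKM !mn_CE.
by case: eqP; rewrite ?mulr0.
Qed.

HB.instance Definition _ := GRing.isZmodMorphism.Build K D mnK mnK_zmod.
HB.instance Definition _ := GRing.isMonoidMorphism.Build K D mnK mnK_monoid.

Lemma mnKC c (f : D) : mnK c * f = f * mnK c.
Proof.
by apply: mnP => g; rewrite mnKM mn_MCr ginv1 gmulg1 mulrC.
Qed.

Lemma mn_sumE I (r : seq I) (P : pred I) (f : I -> D) a :
  (\sum_(i <- r | P i) f i) a = \sum_(i <- r | P i) f i a.
Proof. by apply: (big_morph (fun f : D => f a)). Qed.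

Lemma glt_min n (a : 'I_n.+1 -> G) : exists j, forall i, ~~ glt (a i) (a j).
Proof.
elim: n a => [|n IH] a.
  by exists ord0 => i; rewrite (ord1 i) glt_irr.
have [j jmin] := IH (fun i => a (lift ord0 i)).
case: (boolP (glt (a ord0) (a (lift ord0 j)))) => lt.
  exists ord0 => i; case: (unliftP ord0 i) => [i'|] ->; last by rewrite glt_irr.
  by apply/negP => lt'; have := jmin i'; rewrite (glt_trans lt' lt).
exists (lift ord0 j) => i; case: (unliftP ord0 i) => [i'|] -> //.
Qed.

Local Notation km := (map_mx mnK).

Lemma kmME m n (P : 'M[K]_(m, n)) (e : 'cV[D]_n) i a :
  (km P *m e) i 0 a = \sum_j P i j * e j 0 a.
Proof.
by rewrite mxE mn_sumE; apply: eq_bigr => j _; rewrite mxE mnKM.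
Qed.

(** Gaussian elimination on leading terms. An entry with least exponent [g] goes first, and
    multiples of it clear the coefficient at [g] of the others. No later combination of these others
    recovers a term at [g], so the exponents found by induction differ from [g]. *)
Lemma distinct_leads r (e : 'cV[D]_r) : indep mnK e ->
  exists2 P : 'M[K]_r, P \in unitmx & exists a : 'I_r -> G,
    injective a /\ forall j, mn_lead ((km P *m e) j 0) (a j).
Proof.
elim: r e => [|r IH] e ie.
  by exists 1%:M; rewrite ?unitmx1//; exists (fun=> gone); split=> [[]|[]].
have e0 j : e j 0 != 0.
  apply/eqP => ej; have : delta_mx 0 j = 0 :> 'rV[K]_r.+1.
    apply: ie; rewrite map_delta_mx -rowE; apply/matrixP => i k.
    by rewrite mxE !ord1 ej mxE.
  by move/matrixP/(_ 0 j)/eqP; rewrite !mxE !eqxx oner_eq0.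
have [l hl] := choice (fun j => mn_lead_ex (e0 j)).
have [j0 jmin] := glt_min l.
pose P0 : 'M[K]_(1 + r) := tperm_mx j0 ord0.
have uP0 : P0 \in unitmx by exact: unitmx_perm.
pose e1 : 'cV[D]_(1 + r) := km P0 *m e.
have e1E k : e1 k 0 = e (tperm j0 ord0 k) 0.
  by rewrite /e1 map_tperm_mx -xrowE mxE.
pose x := e1 ord0 0; pose g := l j0.
have xl : mn_lead x g by rewrite /x e1E tpermR; exact: hl.
have [xg xge] := xl.
have e1ge k : mn_ge (e1 k 0) g.
  rewrite e1E; have [_ lk] := hl (tperm j0 ord0 k).
  exact: (mn_geW lk (jmin _)).
pose e2 := dsubmx e1.
have u1E : usubmx e1 = x%:M.
  rewrite [LHS]mx11_scalar mxE /x; congr (e1 _ _)%:M; exact: val_inj.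
pose c : 'cV[K]_r := \col_j (e2 j 0 g / x g).
pose P1 : 'M[K]_(1 + r) := block_mx 1%:M 0 (- c) 1%:M.
have uP1 : P1 \in unitmx by rewrite unitmxE det_lblock !det1 mulr1 unitr1.
pose e2' := e2 - km c *m x%:M.
have P1e1 : km P1 *m e1 = col_mx x%:M e2'.
  rewrite /P1 map_block_mx -[e1]vsubmxK mul_block_col u1E map_mx1 map_mx0.
  by rewrite mul1mx mul0mx addr0 map_mxN map_mx1 mul1mx mulNmx addrC.
have e2'E j a : e2' j 0 a = e2 j 0 a - c j 0 * x a.
  by rewrite !mxE big_ord1 !mxE eqxx mulr1n mnB mnKM.
have e2'ge j : mn_ge (e2' j 0) g.
  by move=> a ag; rewrite e2'E mxE e1ge// xge// mulr0 subrr.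
have e2'g j : e2' j 0 g = 0.
  by rewrite e2'E [c j 0]mxE divfK// subrr.
have ie1 : indep mnK (km P1 *m e1).
  apply: indep_mul; first by rewrite row_free_unit.
  by apply: indep_mul => //; rewrite row_free_unit.
have ie2' : indep mnK e2'.
  move=> b be; have : row_mx 0 b = 0 :> 'rV[K]_(1 + r).
    by apply: ie1; rewrite P1e1 map_row_mx mul_row_col map_mx0 mul0mx add0r.
  by rewrite -row_mx0 => /eq_row_mx[].
have [P2 uP2 [a2 [inja2 la2]]] := IH _ ie2'.
have a2g j : a2 j != g.
  apply/eqP => ag; have [+ _] := la2 j; rewrite ag kmME big1 ?eqxx// => k _.
  by rewrite e2'g mulr0.
pose P3 : 'M[K]_(1 + r) := block_mx 1%:M 0 0 P2.
have uP3 : P3 \in unitmx by rewrite unitmxE det_ublock det1 mul1r -unitmxE.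
exists (P3 *m P1 *m P0); first by rewrite !unitmx_mul uP0 uP1 uP3.
pose b (j : 'I_(1 + r)) := if fintype.split j is inr j' then a2 j' else g.
have bl (j : 'I_1) : b (lshift r j) = g by rewrite /b (unsplitK (inl j)).
have br (j : 'I_r) : b (rshift 1 j) = a2 j by rewrite /b (unsplitK (inr j)).
have injb : injective b.
  move=> i j; case: (split_ordP i) => i' ->; case: (split_ordP j) => j' ->;
    rewrite ?bl ?br.
  - by rewrite !ord1.
  - by move=> E; have := a2g j'; rewrite -E eqxx.
  - by move=> E; have := a2g i'; rewrite E eqxx.
  by move=> /inja2 ->.
have lb (j : 'I_(1 + r)) : mn_lead ((km (P3 *m P1 *m P0) *m e) j 0) (b j).
  rewrite !map_mxM -!mulmxA -/e1 P1e1 map_block_mx mul_block_col.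
  rewrite map_mx1 !map_mx0 mul1mx !mul0mx addr0 add0r.
  case: (split_ordP j) => j' ->; rewrite ?bl ?br.
    by rewrite col_mxEu ord1 mxE eqxx mulr1n.
  by rewrite col_mxEd.
by exists b.
Qed.

End MalcevNeumannScalars.

Section FreeGroupField.

Variables (K : fieldType) (d : nat).
Local Notation G := (free_ogroup d).
Local Notation D := (mn K G).
Local Notation km := (map_mx (@mnK K G)).

Definition mnX (k : 'I_d.+1) : D := mn_C (fggen0 k : G) 1.

Lemma mnX0 : mnX ord0 = 1.
Proof. by rewrite /mnX /fggen0 unlift_none. Qed.

Lemma mnX_lead k (f : D) a : mn_lead f a -> mn_lead (mnX k * f) (gmul (fggen0 k : G) a).
Proof.
have gX : mn_ge (mnX k) (fggen0 k : G).
  by move=> b; rewrite mn_CE; case: eqP => // ->; rewrite glt_irr.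
move=> [fa fge]; split; last exact: mn_mul_ge.
by rewrite mn_mul_lead// mn_CE eqxx mul1r.
Qed.

(** After [distinct_leads], let a combination [c] of the relations have zero coefficient at the
    parent index of [a j] for every [j] other than [j0]. By [tree_count] its remaining products have
    distinct leading terms, so the least of them cannot cancel and [c = 0]. Hence [n] is at most the
    number of these conditions, one less than the number of entries. *)
Lemma key_free r (e : 'cV[D]_r) n (B : pencil K d n r) :
  indep (@mnK K G) e -> (0 < r)%N -> pindep B -> ev (@mnK K G) mnX B *m e = 0 ->
  (n < r)%N.
Proof.
case: r => [//|r] in e B * => ie _ iB Be; rewrite ltnS.
have [P uP [a [inja la]]] := distinct_leads ie.
pose e' := km P *m e; pose B' k := B k *m invmx P.
have B'e : ev (@mnK K G) mnX B' *m e' = 0.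
  rewrite (evMr (@mnKC K G)) /e' mulmxA -[_ *m km P]mulmxA -map_mxM mulVmx//.
  by rewrite map_mx1 mulmx1.
have iB' : pindep B'.
  move=> c cB; apply: iB => k; have := cB k; rewrite /B' mulmxA.
  by move/(congr1 (mulmx^~ P)); rewrite mulmxKV// mul0mx.
have [j0 jmin] : exists j0, forall j, (size (val (a j0)) <= size (val (a j)))%N.
  have [j0 _ jm] := @arg_minnP _ (ord0 : 'I_r.+1) xpredT (fun j => size (val (a j))) isT.
  by exists j0 => j; apply: jm.
pose Z : 'M[K]_(n, r) := \matrix_(i, j)
  B' (fgparent (a (lift j0 j))) i (lift j0 j).
suff : row_free Z by move/eqP <-; exact: rank_leq_col.
apply: inj_row_free => c cZ; apply: iB'.
pose v (p : 'I_d.+1 * 'I_r.+1) := (c *m B' p.1) 0 p.2.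
suff v0 p : v p = 0.
  by move=> k; apply/matrixP => i j; rewrite [i]ord1 [RHS]mxE; exact: (v0 (k, j)).
have vP q : v q != 0 -> q.1 != fgparent (a q.2) \/ q.2 = j0.
  move=> vq; case: (eqVneq q.2 j0) => [|qj]; first by right.
  left; apply: contraNneq vq => qp; apply/eqP.
  have [j qE] : exists j, q.2 = lift j0 j.
    by case: (unliftP j0 q.2) qj => [j ->|->]; [exists j|rewrite eqxx].
  have := congr1 (fun M : 'rV_r => M 0 j) cZ; rewrite !mxE => E.
  rewrite -[RHS]E /v mxE; apply: eq_bigr => i _.
  by rewrite [Z _ _]mxE -qE -qp.
pose w q : G := gmul (fggen0 q.1 : G) (a q.2).
have winj q q' : v q != 0 -> v q' != 0 -> w q = w q' -> q = q'.
  move=> /vP vq /vP vq' E.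
  have [E1 E2] := tree_count inja jmin vq vq' E.
  by case: q q' {vq vq' E} E1 E2 => [? ?] [? ?] /= -> ->.
apply/eqP; apply: contraT => vp.
(* Among the products with nonzero coefficient, [p0] has the least leading exponent, and it alone
   contributes at [w p0]. *)
have [p0 vp0 p0min] : exists2 p0, v p0 != 0 & forall q, v q != 0 -> ~~ glt (w q) (w p0).
  pose s := [seq q <- enum {: 'I_d.+1 * 'I_r.+1} | v q != 0].
  have ps : p \in s by rewrite mem_filter vp mem_enum.
  have [m sm] : exists m, size s = m.+1 by case: (s) ps => // x s' _; exists (size s').
  have [j jm] := glt_min (fun j : 'I_m.+1 => w (nth p s j)).
  have jl (i : 'I_m.+1) : nth p s i \in s by rewrite mem_nth// sm.
  exists (nth p s j); first by have := jl j; rewrite mem_filter => /andP[].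
  move=> q vq; have qs : q \in s by rewrite mem_filter vq mem_enum.
  have ql : (index q s < m.+1)%N by rewrite -sm index_mem.
  by have := jm (Ordinal ql); rewrite /= nth_index.
have : (km c *m (ev (@mnK K G) mnX B' *m e')) 0 0 (w p0) = 0.
  by rewrite B'e mulmx0 mxE.
have -> : (km c *m (ev (@mnK K G) mnX B' *m e')) 0 0 (w p0) =
    \sum_q v q * (mnX q.1 * e' q.2 0) (w p0).
  rewrite mulmxA -evMl mxE mn_sumE.
  under eq_bigr do rewrite mxE mulr_suml mn_sumE.
  by rewrite exchange_big pair_big; apply: eq_bigr => q _; exact: mnKMM.
rewrite (bigD1 p0)// big1 ?addr0 => [E|q /andP[_ qp0]]; last first.
  case: (eqVneq (v q) 0) => [->|vq]; first by rewrite mul0r.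
  have [_ ge] := mnX_lead q.1 (la q.2).
  suff -> : (mnX q.1 * e' q.2 0) (w p0) = 0 by rewrite mulr0.
  apply: ge; have [E|//] := glt_ge (p0min _ vq).
  by case/eqP: qp0; apply: winj.
have [n0 _] := mnX_lead p0.1 (la p0.2).
have {}E : v p0 * (mnX p0.1 * e' p0.2 0) (w p0) = 0.
  by rewrite -[LHS]addr0; exact: E.
by move/eqP: E; rewrite mulf_eq0 (negPf vp0) (negPf n0).
Qed.

(** With [w = C e] and [e] independent, the pencil [A C] kills [e] and so has row rank below [m].
    Its row relations, more than [n - m] of them, face the [m] columns of [C] in a zero block. *)
Lemma singular_hollow n (A : pencil K d n n) (w : 'cV[D]_n) :
  w != 0 -> ev (@mnK K G) mnX A *m w = 0 -> hollow A.
Proof.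
move=> w0 Aw; have [m [C [C' [e [ie wE CC]]]]] := indep_basis (@mnK K G) w.
have m0 : (0 < m)%N.
  case: m => // in C C' e ie wE CC *; case/eqP: w0.
  by rewrite wE [e]flatmx0 mulmx0.
have [P fP iP] := pindep_base (fun k => A k *m C).
set X := \mxrow_k (A k *m C) in P fP iP.
have rX : (\rank X < m)%N.
  apply: (key_free ie m0 iP).
  by rewrite evMl (evMr (@mnKC K G)) -!mulmxA -wE Aw mulmx0.
have XP : row_base (kermx X) *m X = 0.
  by apply/sub_kermxP; rewrite eq_row_base.
exists (\rank (kermx X)), m, (row_base (kermx X)), C; split.
- exact: row_base_free.
- by rewrite /row_free mxrank_tr; apply/row_fullP; exists C'.
- by rewrite mxrank_ker; have := rank_leq_row X; lia.
move=> k; rewrite -mulmxA.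
exact: (proj1 (flat_eq0 (fun k => A k *m C) _) XP k).
Qed.

End FreeGroupField.

(** Universality gives a specialization to the skew subfield of [D] generated by [R], and
    elimination over its domain lifts invertibility to [U]. *)
Lemma universal_invertible (R : nzRingType) (U D : unitRingType)
    (iota : {rmorphism R -> U}) (phi : {rmorphism R -> D}) n (M : 'M[R]_n) :
  is_universal_field_of_fractions iota -> is_skew_field D ->
  (forall w : 'cV[D]_n, map_mx phi M *m w = 0 -> w = 0) ->
  invertible_mx (map_mx iota M).
Proof.
move=> [[U_skew _] _ univ] D_skew inj.
have [S [h [[Siota SB SM] hiota hB hM SV]]] := univ _ _ (gen_epic phi D_skew).
have [gf_skew _] := gen_epic phi D_skew.
apply: (@local_elimination U _ S h gf_skew) => //.
- by rewrite -(rmorph1 iota).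
- by rewrite -(rmorph1 iota) hiota rmorph1.
- by move=> i j; rewrite mxE.
move=> w hw; apply/matrixP => i j.
have : map_mx (val : gen_field phi -> D) w = 0.
  apply: inj; have -> :
      map_mx phi M = map_mx (val : gen_field phi -> D) (map_mx h (map_mx iota M)).
    by apply/matrixP => k l; rewrite !mxE hiota.
  by rewrite -map_mxM hw map_mx0.
move/matrixP/(_ i j); rewrite !mxE => E; apply: val_inj; rewrite E.
by rewrite raddf0.
Qed.

(** * Evaluation of the free algebra, and hollow pencils over the free field *)

Section FreeAlgebra.

Variables (K : fieldType) (d : nat).
Local Notation D := (mn K (free_ogroup d)).
Local Notation KX := {freealg K, d}.

Definition word_eval (w : {fmonom 'I_d}) : D :=
  \prod_(i <- (w : seq 'I_d)) mnX K (lift ord0 i).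

Lemma word_eval_mmorphism : mmorphism word_eval.
Proof.
split=> [w w'|]; last by rewrite /word_eval fm1 big_nil.
by rewrite /word_eval fmM big_cat.
Qed.

HB.instance Definition _ := monalg.isMultiplicative.Build _ _ word_eval
  word_eval_mmorphism.

Definition free_eval : KX -> D := mmap (@mnK K (free_ogroup d)) word_eval.

Lemma free_eval_zmod : zmod_morphism free_eval.
Proof. exact: mmap_is_additive. Qed.

Lemma free_eval_monoid : monoid_morphism free_eval.
Proof.
have [M1 M2] : multiplicative free_eval.
  by apply: commr_mmap_is_multiplicative => g m m'; exact: mnKC.
by split.
Qed.

HB.instance Definition _ := GRing.isZmodMorphism.Build KX D free_eval
  free_eval_zmod.
HB.instance Definition _ := GRing.isMonoidMorphism.Build KX D free_eval
  free_eval_monoid.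

Lemma free_evalZ a (p : KX) : free_eval (a *: p) = mnK _ a * free_eval p.
Proof. exact: mmapZ. Qed.

Lemma free_eval_var i : free_eval (var K i) = mnX K (lift ord0 i).
Proof. rewrite [LHS]mmapU /word_eval fmU big_seq1; exact: mul1r. Qed.

Definition var0 (k : 'I_d.+1) : KX := if unlift ord0 k is Some i then var K i else 1.

Lemma free_eval_var0 k : free_eval (var0 k) = mnX K k.
Proof.
rewrite /var0; case: unliftP => [i|] ->; first exact: free_eval_var.
by rewrite rmorph1 mnX0.
Qed.

Definition pencil_mx n m (A : pencil K d n m) : 'M[KX]_(n, m) :=
  \matrix_(i, j) \sum_k A k i j *: var0 k.

Variables (F : unitAlgType K) (iota : {lrmorphism KX -> F}).

Definition gen (k : 'I_d.+1) : F := iota (var0 k).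

Lemma map_pencil_mx n m (A : pencil K d n m) :
  map_mx iota (pencil_mx A) = ev (in_alg F) gen A.
Proof.
apply/matrixP => i j; rewrite !mxE linear_sum; apply: eq_bigr => k _.
by rewrite linearZ /= mulr_algl.
Qed.

Lemma universal_hollow : is_universal_field_of_fractions iota ->
  forall n (A : pencil K d n n), ~ invertible_mx (ev (in_alg F) gen A) ->
  hollow A.
Proof.
move=> univ n A nA.
have [w w0 Aw] : exists2 w : 'cV[D]_n, w != 0 & map_mx free_eval (pencil_mx A) *m w = 0.
  apply: contrapT => no; apply: nA; rewrite -map_pencil_mx.
  apply: (universal_invertible (phi := free_eval) univ (@mn_skew _ _)) => w Aw.
  by apply/eqP; apply: contraT => w0; case: no; exists w.
apply: (singular_hollow w0); rewrite -[RHS]Aw; congr (_ *m _).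
apply/matrixP => i j; rewrite !mxE rmorph_sum; apply: eq_bigr => k _.
by apply/esym; rewrite -[mnX K k]free_eval_var0; exact: free_evalZ.
Qed.

Lemma gen0 : gen ord0 = 1.
Proof. by rewrite /gen /var0 unlift_none rmorph1. Qed.

End FreeAlgebra.

(** * Linear systems over the free algebra *)

Section LinearMatrices.

Variables (K : fieldType) (d : nat).
Local Notation KX := {freealg K, d}.
Local Notation pencil := (pencil K d).

Lemma eq_pencil_mx m n (A B : pencil m n) :
  (forall k, A k = B k) -> pencil_mx A = pencil_mx B.
Proof.
by move=> /funext ->.
Qed.

Lemma cst_pencil_mx m n (M : 'M[K]_(m, n)) : cst d M = pencil_mx (pconst M).
Proof.
apply/matrixP => i j; rewrite !mxE (bigD1 ord0)//= /pconst eqxx.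
rewrite /var0 unlift_none big1 ?addr0// => k /negPf ->.
by rewrite mxE scale0r.
Qed.

Lemma pencil_mx0 m n : pencil_mx (fun=> 0 : 'M[K]_(m, n)) = 0 :> 'M[KX]_(m, n).
Proof.
by apply/matrixP => i j; rewrite !mxE big1// => k _; rewrite ?mxE scale0r.
Qed.

Lemma cst_mul_pencil m n p (P : 'M[K]_(m, n)) (A : pencil n p) :
  cst d P *m pencil_mx A = pencil_mx (fun k => P *m A k).
Proof.
apply/matrixP => i j; rewrite !mxE.
under eq_bigr do rewrite !mxE mulr_sumr.
rewrite exchange_big; apply: eq_bigr => k _ /=.
rewrite mxE scaler_suml; apply: eq_bigr => l _.
by rewrite mulr_algl scalerA.
Qed.

Lemma freealg_mulC (p : KX) a : p * a%:A = a *: p.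
Proof.
rewrite -[a%:A]mul_malgC mulr1 malgM_def malgZ_def fgmulgU.
by apply: eq_bigr => k _; rewrite mulm1 mulrC.
Qed.

Lemma pencil_mul_cst m n p (A : pencil m n) (Q : 'M[K]_(n, p)) :
  pencil_mx A *m cst d Q = pencil_mx (fun k => A k *m Q).
Proof.
apply/matrixP => i j; rewrite !mxE.
under eq_bigr do rewrite !mxE mulr_suml.
rewrite exchange_big; apply: eq_bigr => k _ /=.
rewrite mxE scaler_suml; apply: eq_bigr => l _.
by rewrite freealg_mulC scalerA mulrC.
Qed.

Lemma pencil_mx_block m n p r (A : pencil m n) (B : pencil m p) (C : pencil r n)
    (D : pencil r p) :
  pencil_mx (fun k => block_mx (A k) (B k) (C k) (D k)) =
  block_mx (pencil_mx A) (pencil_mx B) (pencil_mx C) (pencil_mx D).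
Proof.
apply/matrixP => i j; rewrite mxE; case: (split_ordP i) => i' ->;
  case: (split_ordP j) => j' ->;
  by rewrite (block_mxEul, block_mxEur, block_mxEdl, block_mxEdr) mxE;
     apply: eq_bigr => k _;
     rewrite (block_mxEul, block_mxEur, block_mxEdl, block_mxEdr).
Qed.

Lemma is_linear_pencil_mx n (M : 'M[KX]_n) :
  is_linear_mx M <-> exists A : pencil n n, M = pencil_mx A.
Proof.
have E (A : pencil n n) : pencil_mx A = cst d (A ord0) +
    \sum_(l < d) map_mx (fun c => c *: var K l) (A (lift ord0 l)).
  apply/matrixP => i j; rewrite !mxE big_ord_recl summxE /var0 unlift_none.
  congr (_ + _); apply: eq_bigr => l _; by rewrite liftK mxE.
split=> [[A0 [Al ->]]|[A ->]].
  exists (fun k => if unlift ord0 k is Some l then Al l else A0).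
  rewrite E unlift_none; congr (_ + _); apply: eq_bigr => l _.
  by rewrite liftK.
by exists (A ord0), (fun l => A (lift ord0 l)).
Qed.

Variables (F : unitAlgType K) (iota : {lrmorphism KX -> F}).
Local Notation y := (gen iota).
Local Notation kap := (in_alg F).
Local Notation km := (map_mx (in_alg F)).
Local Notation isrep := (isrep (in_alg F) y).

Lemma in_algC a (x : F) : kap a * x = x * kap a.
Proof. by rewrite mulr_algl mulr_algr. Qed.

Lemma isrepI n u (A : pencil n n) v s f :
  invertible_mx (ev kap y A) -> ev kap y A *m s = km v -> km u *m s = f%:M ->
  exists t, isrep u A v s t f.
Proof.
move=> iA; have [Ai [_ AiA]] := iA; move=> As us; exists (km u *m Ai).
by split=> //; rewrite -mulmxA AiA mulmx1.
Qed.

Lemma linrep_isrep S f : is_linrep iota S f ->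
  exists (A : pencil (sdim S) (sdim S)) s t,
    mat S = pencil_mx A /\ isrep (lhs S) A (rhs S) s t f.
Proof.
move=> [/is_linear_pencil_mx[A AE] [Ai [AAi AiA] fE]].
rewrite AE map_pencil_mx in AAi AiA.
exists A, (Ai *m km (rhs S)).
have [|||t rep] := @isrepI (sdim S) (lhs S) A (rhs S) (Ai *m km (rhs S)) f.
- by exists Ai.
- by rewrite mulmxA AAi mul1mx.
- by rewrite fE /over_F mulmxA -mx11_scalar.
by exists t.
Qed.

Lemma isrep_linrep n u (A : pencil n n) v s t f : isrep u A v s t f ->
  is_linrep iota (LinSys u (pencil_mx A) v) f.
Proof.
move=> [[Ai [AAi AiA]] As tA us]; split; first by apply/is_linear_pencil_mx; exists A.
exists Ai; first by split; rewrite /= map_pencil_mx.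
rewrite /= /over_F -mulmxA -As [Ai *m _]mulmxA AiA mul1mx us mxE.
by rewrite eqxx mulr1n.
Qed.

Lemma in_L_sysE S (A : pencil (sdim S) (sdim S)) s t f x : mat S = pencil_mx A ->
  isrep (lhs S) A (rhs S) s t f ->
  in_L_sys iota S x <-> exists c : 'rV_(sdim S), km c *m s = x%:M.
Proof.
move=> AE [[Ai [AAi AiA]] As tA us].
have sE Ai' : inverse_mat iota Ai' -> Ai' *m over_F F (rhs S) = s.
  move=> [_ AiA']; rewrite /over_F -As mulmxA -(map_pencil_mx iota A) -AE.
  by rewrite AiA' mul1mx.
have cE (c : 'rV[K]_(sdim S)) : (km c *m s) 0 0 = \sum_i c 0 i *: s i 0.
  by rewrite mxE; apply: eq_bigr => i _; rewrite mxE /= mulr_algl.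
split=> [[Ai' [k [/sE sE' xE]]]|[c cs]].
  exists (\row_i k i); rewrite [LHS]mx11_scalar cE xE sE'; congr _%:M.
  by apply: eq_bigr => i _; rewrite mxE.
exists Ai, (c 0); have inv : inverse_mat iota Ai.
  by split; rewrite AE map_pencil_mx.
split=> //; rewrite (sE _ inv) -cE cs mxE eqxx mulr1n.
by [].
Qed.

Lemma in_R_sysE S (A : pencil (sdim S) (sdim S)) s t f x : mat S = pencil_mx A ->
  isrep (lhs S) A (rhs S) s t f ->
  in_R_sys iota S x <-> exists c : 'cV_(sdim S), t *m km c = x%:M.
Proof.
move=> AE [[Ai [AAi AiA]] As tA us].
have tE Ai' : inverse_mat iota Ai' -> over_F F (lhs S) *m Ai' = t.
  move=> [AAi' _]; rewrite /over_F -tA -mulmxA -(map_pencil_mx iota A) -AE.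
  by rewrite AAi' mulmx1.
have cE (c : 'cV[K]_(sdim S)) : (t *m km c) 0 0 = \sum_i c i 0 *: t 0 i.
  by rewrite mxE; apply: eq_bigr => i _; rewrite mxE /= mulr_algr.
split=> [[Ai' [k [/tE tE' xE]]]|[c ct]].
  exists (\col_i k i); rewrite [LHS]mx11_scalar cE xE tE'; congr _%:M.
  by apply: eq_bigr => i _; rewrite mxE.
exists Ai, (c^~ 0); have inv : inverse_mat iota Ai.
  by split; rewrite AE map_pencil_mx.
split=> //; rewrite (tE _ inv) -cE ct mxE eqxx mulr1n.
by [].
Qed.

Hypothesis univ : is_universal_field_of_fractions iota.

Let F_skew : is_skew_field F := let: And3 (conj h _) _ _ := univ in h.
Let y0 : y ord0 = 1 := gen0 iota.
Let hollowP := universal_hollow univ.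

(** A dependency in either family would let the reduction lemmas produce a smaller system. *)
Lemma minimal_indep S (A : pencil (sdim S) (sdim S)) s t f :
  is_minimal iota S f -> isrep (lhs S) A (rhs S) s t f ->
  indep kap s /\ indepr kap t.
Proof.
move=> [_ Smin] rep; split.
  have [m [C [C' [e [ie sE CC]]]]] := indep_basis kap s.
  have [E [A2 [v2 [rep2 _]]]] := isrep_reduce F_skew in_algC hollowP rep sE CC ie.
  have /= le := Smin _ (isrep_linrep rep2).
  rewrite sE; apply: indep_mul ie.
  have rC : \rank C = m by apply/eqP/row_fullP; exists C'.
  by rewrite /row_free rC eqn_leq -{1}rC rank_leq_row le.
have [m [C [C' [e [ie tE CC]]]]] := indepr_basis kap t.
have [E [A2 [u2 [rep2 _]]]] := isrep_reducer F_skew in_algC hollowP rep tE CC ie.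
have /= le := Smin _ (isrep_linrep rep2).
have rC : \rank C = m by apply/eqP/row_freeP; exists C'.
have fC : row_free C^T.
  by rewrite /row_free mxrank_tr rC eqn_leq -{1}rC rank_leq_col le.
move=> c; rewrite tE -mulmxA -map_mxM => /ie Cc.
apply: trmx_inj; rewrite trmx0; apply: (row_free_inj fC).
by rewrite mul0mx -trmx_mul Cc trmx0.
Qed.

(** Reduction gives the competitor an independent left family without increasing its dimension, and
    by [left_span_sub] the span of this family contains that of [s]. *)
Lemma indep_minimal n u (A : pencil n n) v s t f n' u' (A' : pencil n' n') v' s' t' :
  isrep u A v s t f -> indep kap s -> indepr kap t -> isrep u' A' v' s' t' f ->
  (n <= n')%N.
Proof.
move=> rep is_ it rep'.
have [m [C [C' [e [ie sE CC]]]]] := indep_basis kap s'.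
have [E [A2 [v2 [rep2 _]]]] := isrep_reduce F_skew in_algC hollowP rep' sE CC ie.
have [X sX] := left_span_sub F_skew in_algC hollowP rep rep2 is_ it ie.
have fX : row_free X by apply: (indep_row_free (kap := kap) (e := e)); rewrite -sX.
have rC : \rank C = m by apply/eqP/row_fullP; exists C'.
have := rank_leq_col X; have := rank_leq_row C; rewrite rC (eqP fX).
by move=> mn' /leq_trans; apply.
Qed.

Lemma in_LE S (A : pencil (sdim S) (sdim S)) s t f x : is_minimal iota S f ->
  mat S = pencil_mx A -> isrep (lhs S) A (rhs S) s t f ->
  in_L iota f x <-> exists c : 'rV_(sdim S), km c *m s = x%:M.
Proof.
move=> Smin AE rep; split=> [[S' S'min xS']|cs]; last first.
  by exists S => //; apply/(in_L_sysE _ AE rep).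
have [is_ it] := minimal_indep Smin rep.
have [A' [s' [t' [AE' rep']]]] := linrep_isrep S'min.1.
have [is' it'] := minimal_indep S'min rep'.
have [c cs'] := (in_L_sysE _ AE' rep').1 xS'.
have [X s'E] := left_span_sub F_skew in_algC hollowP rep' rep is' it' is_.
by exists (c *m X); rewrite map_mxM -mulmxA -s'E.
Qed.

Lemma in_RE S (A : pencil (sdim S) (sdim S)) s t f x : is_minimal iota S f ->
  mat S = pencil_mx A -> isrep (lhs S) A (rhs S) s t f ->
  in_R iota f x <-> exists c : 'cV_(sdim S), t *m km c = x%:M.
Proof.
move=> Smin AE rep; split=> [[S' S'min xS']|cs]; last first.
  by exists S => //; apply/(in_R_sysE _ AE rep).
have [is_ it] := minimal_indep Smin rep.
have [A' [s' [t' [AE' rep']]]] := linrep_isrep S'min.1.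
have [is' it'] := minimal_indep S'min rep'.
have [c ct'] := (in_R_sysE _ AE' rep').1 xS'.
have [X t'E] := right_span_sub F_skew in_algC hollowP rep' rep is' it' it.
by exists (X *m c); rewrite map_mxM mulmxA -t'E.
Qed.

End LinearMatrices.

(** * Normal forms and minimality of the constructed systems *)

Section Completion.

Variable K : fieldType.

Lemma row_base_dim m n (A : 'M[K]_(m, n)) r : \rank A = r ->
  exists N : 'M[K]_(r, n), row_free N /\ (N :=: A)%MS.
Proof.
by move=> <-; exists (row_base A); split; [exact: row_base_free|exact: eq_row_base].
Qed.

Lemma complete_rows m (r1 r2 : 'rV[K]_(1 + m + 1)) : row_free (col_mx r1 r2) ->
  exists N : 'M[K]_(m, 1 + m + 1), col_mx (col_mx r1 N) r2 \in unitmx.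
Proof.
move=> fW; set W := col_mx r1 r2 in fW.
have rW : \rank (W^C)%MS = m by rewrite mxrank_compl (eqP fW); lia.
have [N [_ NW]] := row_base_dim rW; exists N.
rewrite -row_full_unit -sub1mx; set X := col_mx _ _.
have rX1 : (col_mx r1 N <= X)%MS by have := addsmxSl (col_mx r1 N) r2; rewrite addsmxE.
have rX2 : (r2 <= X)%MS by have := addsmxSr (col_mx r1 N) r2; rewrite addsmxE.
have r1X : (r1 <= X)%MS.
  by apply: submx_trans rX1; have := addsmxSl r1 N; rewrite addsmxE.
have NX : (N <= X)%MS.
  by apply: submx_trans rX1; have := addsmxSr r1 N; rewrite addsmxE.
have := addsmx_compl_full W; rewrite -sub1mx => /submx_trans; apply.
by rewrite addsmx_sub -NW NX andbT col_mx_sub r1X.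
Qed.

(** Provides a change of rows [P] with prescribed last row [b] for which [P v] is the last unit
    vector. *)
Lemma complete_last n (v : 'cV[K]_(n + 1)) (b : 'rV[K]_(n + 1)) :
  b *m v = 1%:M ->
  exists N : 'M[K]_(n, n + 1), N *m v = 0 /\ col_mx N b \in unitmx.
Proof.
move=> bv; have v0 : v != 0.
  by apply: contra_eq_neq bv => ->; rewrite mulmx0 eq_sym matrix_nonzero1.
have rv : \rank v = 1%N by rewrite -mxrank_tr rank_rV -(inj_eq trmx_inj) trmxK trmx0 v0.
have rk : \rank (kermx v) = n by rewrite mxrank_ker rv addn1 subn1.
have [N [fN NE]] := row_base_dim rk; exists N.
have Nv : N *m v = 0 by apply/sub_kermxP; rewrite NE.
split=> //; rewrite -row_free_unit; apply: inj_row_free => c.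
rewrite -[c]hsubmxK mul_row_col => cN.
have c2 : rsubmx c = 0.
  have := congr1 (mulmx^~ v) cN; rewrite mulmxDl -!mulmxA Nv bv mulmx0 add0r.
  by rewrite mulmx1 mul0mx.
suff -> : lsubmx c = 0 by rewrite c2 row_mx0.
apply: (row_free_inj fN); rewrite mul0mx -[RHS]cN c2 mul0mx addr0.
by [].
Qed.

Lemma e_first_row n : e_first K (1 + n) = row_mx 1%:M 0.
Proof.
apply/matrixP => i j; rewrite mxE; case: (split_ordP j) => k ->.
  by rewrite row_mxEl mxE !ord1.
by rewrite row_mxEr mxE.
Qed.

Lemma e_first_row2 m n : e_first K (1 + m + n) = row_mx (row_mx 1%:M 0) 0.
Proof.
rewrite -e_first_row; apply/matrixP => i j; rewrite mxE.
case: (split_ordP j) => k ->; rewrite ?row_mxEl ?row_mxEr mxE//.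
Qed.

Lemma e_first_catr m n : (0 < m)%N -> e_first K (m + n) = row_mx (e_first K m) 0.
Proof.
move=> m0; apply/matrixP => i j; rewrite mxE.
case: (split_ordP j) => k ->; rewrite ?row_mxEl ?row_mxEr mxE//=.
by rewrite addn_eq0 eqn0Ngt m0.
Qed.

Lemma e_last_col n : e_last K (n + 1) = col_mx 0 1%:M.
Proof.
apply/matrixP => i j; rewrite mxE; case: (split_ordP i) => k ->.
  by rewrite col_mxEu mxE /= addn1 eqSS ltn_eqF.
by rewrite col_mxEd mxE !ord1 /= addn0 addn1 eqxx.
Qed.

Lemma e_first_rowE n (M : 'M[K]_(n, n)) (i : 'I_n) :
  i = 0%N :> nat -> row i M = e_first K n *m M.
Proof.
move=> i0; rewrite rowE; congr (_ *m _); apply/matrixP => k j.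
rewrite !mxE !ord1 eqxx /=.
by have -> : (j == i) = (j == 0%N :> nat) by rewrite -i0.
Qed.

End Completion.

Section Constructions.

Variables (K : fieldType) (d : nat).
Local Notation KX := {freealg K, d}.
Local Notation pencil := (pencil K d).
Variables (F : unitAlgType K) (iota : {lrmorphism KX -> F}).
Local Notation y := (gen iota).
Local Notation kap := (in_alg F).
Local Notation km := (map_mx (in_alg F)).
Local Notation isrep := (isrep (in_alg F) y).

Lemma adm_linrep S S' f : is_linrep iota S f -> adm_transf S S' ->
  is_linrep iota S' f /\ sdim S' = sdim S.
Proof.
move=> /linrep_isrep[A [s [t [AE rep]]]] [P [Q [uP uQ _ ->]]]; split=> //.
rewrite /transform AE cst_mul_pencil pencil_mul_cst.
have [iA As tA us] := rep.
have kQ : km Q *m km (invmx Q) = 1%:M by rewrite -map_mxM mulmxV// map_mx1.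
have [|||t' rep'] := @isrepI _ _ _ iota (sdim S) (lhs S *m Q) (fun k => P *m A k *m Q)
  (P *m rhs S) (km (invmx Q) *m s) f; last exact: isrep_linrep rep'.
- rewrite (evMr (@in_algC _ _)) evMl; apply: invertible_mxM; last exact: km_unit.
  by apply: invertible_mxM => //; exact: km_unit.
- rewrite (evMr (@in_algC _ _)) evMl mulmxA -[_ *m km Q *m _]mulmxA kQ mulmx1.
  by rewrite -mulmxA As map_mxM.
by rewrite map_mxM mulmxA -[_ *m km Q *m _]mulmxA kQ mulmx1.
Qed.

Lemma ulsub_pencil_mx m n p q (A : pencil (m + n) (p + q)) :
  ulsubmx (pencil_mx A) = pencil_mx (fun k => ulsubmx (A k)).
Proof. by apply/matrixP => i j; rewrite !mxE; apply: eq_bigr => k _; rewrite !mxE. Qed.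

Lemma ursub_pencil_mx m n p q (A : pencil (m + n) (p + q)) :
  ursubmx (pencil_mx A) = pencil_mx (fun k => ursubmx (A k)).
Proof. by apply/matrixP => i j; rewrite !mxE; apply: eq_bigr => k _; rewrite !mxE. Qed.

Lemma drsub_pencil_mx m n p q (A : pencil (m + n) (p + q)) :
  drsubmx (pencil_mx A) = pencil_mx (fun k => drsubmx (A k)).
Proof. by apply/matrixP => i j; rewrite !mxE; apply: eq_bigr => k _; rewrite !mxE. Qed.

Lemma scale_pencil_mx m n (A : pencil m n) a :
  a%:A *: pencil_mx A = pencil_mx (fun k => a *: A k).
Proof.
apply/matrixP => i j; rewrite 3!mxE mulr_algl scaler_sumr.
by apply: eq_bigr => k _; rewrite mxE scalerA.
Qed.

Lemma invertible_ublock_l n1 n2 (X : 'M[F]_n1) (Y : 'M_(n1, n2)) :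
  invertible_mx (block_mx X Y 0 1%:M) -> invertible_mx X.
Proof.
move=> [N [MN NM]]; have iU := invertible_upper Y.
have E : block_mx X Y 0 1%:M = block_mx 1%:M Y 0 1%:M *m block_mx X 0 0 1%:M.
  by rewrite mulmx_block !mulmx1 !mul1mx !mulmx0 !mul0mx !addr0 !add0r.
have [V [UV VU]] := iU.
pose D := N *m block_mx 1%:M Y 0 1%:M.
have DM : D *m block_mx X 0 0 1%:M = 1%:M by rewrite -mulmxA -E.
have MD : block_mx X 0 0 1%:M *m D = 1%:M.
  rewrite -[block_mx X 0 0 1%:M]mul1mx -VU -[V *m _ *m _]mulmxA -E /D.
  by rewrite -mulmxA [_ *m (N *m _)]mulmxA MN mul1mx VU.
exists (ulsubmx D); split.
  move: MD; rewrite -[D]submxK mulmx_block scalar_mx_block => /eq_block_mx[+ _ _ _].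
  by rewrite mul0mx addr0 !block_mxKul.
move: DM; rewrite -[D]submxK mulmx_block scalar_mx_block => /eq_block_mx[+ _ _ _].
by rewrite mulmx0 addr0 block_mxKul.
Qed.

Lemma invertible_ublock_r n1 n2 (X : 'M[F]_n2) (Y : 'M_(n1, n2)) :
  invertible_mx (block_mx 1%:M Y 0 X) -> invertible_mx X.
Proof.
move=> [N [MN NM]].
have E : block_mx 1%:M Y 0 X = block_mx 1%:M 0 0 X *m block_mx 1%:M Y 0 1%:M.
  by rewrite mulmx_block !mulmx1 !mul1mx !mulmx0 !mul0mx !addr0 !add0r.
have [V [UV VU]] := invertible_upper Y.
pose D := block_mx 1%:M Y 0 1%:M *m N.
have MD : block_mx 1%:M 0 0 X *m D = 1%:M by rewrite mulmxA -E.
have DM : D *m block_mx 1%:M 0 0 X = 1%:M.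
  rewrite -[block_mx 1%:M 0 0 X]mulmx1 -UV [block_mx _ 0 0 _ *m (_ *m _)]mulmxA -E /D.
  by rewrite -mulmxA [N *m _]mulmxA NM mul1mx UV.
exists (drsubmx D); split.
  move: MD; rewrite -[D]submxK mulmx_block scalar_mx_block => /eq_block_mx[_ _ _].
  by rewrite mul0mx add0r !block_mxKdr.
move: DM; rewrite -[D]submxK mulmx_block scalar_mx_block => /eq_block_mx[_ _ _].
by rewrite mulmx0 add0r !block_mxKdr.
Qed.

(** The last row of the system of [f] only says that the last unknown is [lf]. Multiplied on the
    right by [g], this unknown becomes [lf g = lf u_g s_g], so the rows of the system of [g] can
    replace that row. *)
Lemma mul_1star_linrep m a b' b a' B b'' lf Sg f g :
  is_linrep iota (@form_f1 K d m a b' b a' B b'' lf) f -> is_linrep iota Sg g ->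
  is_linrep iota (mul_1star a b' b a' B b'' lf Sg) (f * g).
Proof.
move=> /linrep_isrep[/= A [s [t [AE [iA As _ us]]]]].
move=> /linrep_isrep[Ag [sg [tg [AgE [iAg Asg _ usg]]]]].
pose X k : 'M[K]_(1 + m) := ulsubmx (A k).
pose Y k : 'M[K]_(1 + m, 1) := ursubmx (A k).
have XE : block_mx a b' a' B = pencil_mx X by rewrite -ulsub_pencil_mx -AE block_mxKul.
have YE : col_mx b b'' = pencil_mx Y by rewrite -ursub_pencil_mx -AE block_mxKur.
have evA : ev kap y A = block_mx (ev kap y X) (ev kap y Y) 0 1%:M.
  by rewrite -!map_pencil_mx -AE XE YE map_block_mx map_mx0 map_mx1.
have iX : invertible_mx (ev kap y X) by rewrite evA in iA; exact: invertible_ublock_l iA.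
pose s1 := usubmx s; pose s2 := dsubmx s.
have [Xs s2E] : ev kap y X *m s1 + ev kap y Y *m s2 = 0 /\ s2 = km lf%:M.
  apply: eq_col_mx; rewrite -{2}[s2]mul1mx -[X in col_mx _ X]add0r -{1}(mul0mx _ s1).
  by rewrite -mul_block_col -evA vsubmxK As map_col_mx map_mx0.
pose Z k : 'M[K]_(1 + m + sdim Sg) := block_mx (X k) (lf *: Y k *m lhs Sg) 0 (Ag k).
have -> : mul_1star a b' b a' B b'' lf Sg = LinSys (row_mx (row_mx 1%:M 0) 0)
    (pencil_mx Z) (col_mx 0 (rhs Sg)).
  rewrite /mul_1star /Z pencil_mx_block pencil_mx0 -XE -AgE; congr (LinSys _ _ _).
  by rewrite -mul_col_mx -scale_col_mx YE scale_pencil_mx pencil_mul_cst.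
have evZ : ev kap y Z = block_mx (ev kap y X) (kap lf *: ev kap y Y *m km (lhs Sg))
    0 (ev kap y Ag).
  rewrite /Z ev_block_mx ev0 (evMr (@in_algC _ _)); congr (block_mx _ (_ *m _) _ _).
  apply/matrixP => i j; rewrite !mxE mulr_sumr; apply: eq_bigr => k _.
  by rewrite !mxE rmorphM mulrA.
have [|||t' rep'] := @isrepI _ _ _ iota _ (row_mx (row_mx 1%:M 0) 0) Z
  (col_mx 0 (rhs Sg)) (col_mx (s1 *m g%:M) sg) (f * g); last exact: isrep_linrep rep'.
- by rewrite evZ; exact: invertible_ublock.
- rewrite evZ mul_block_col mul0mx add0r Asg map_col_mx map_mx0; congr col_mx.
  rewrite -[_ *m _ *m sg]mulmxA usg mulmxA -mulmxDl.
  have -> : kap lf *: ev kap y Y = ev kap y Y *m s2.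
    rewrite s2E km_scalar; apply/matrixP => i j; rewrite [RHS]mxE big_ord1.
    by rewrite !ord1 [LHS]mxE [_%:M _ _]mxE eqxx mulr1n in_algC.
  by rewrite Xs mul0mx.
rewrite map_row_mx map_mx0 mul_row_col mul0mx addr0 mulmxA scalar_mxM.
congr (_ *m _); rewrite -us -[in RHS](vsubmxK s) [in RHS]map_row_mx map_mx0.
by rewrite mul_row_col mul0mx addr0.
Qed.

(** The first unknown of the system of [g] is [g] itself, and its first row reads [g = - Y s2].
    Substituted in [A_f (s_f g) = v_f g], this eliminates that unknown and that row. *)
Lemma mul_star1_linrep m b' b B b'' c' c lg n (Af : 'M[KX]_n) lf f g : (0 < n)%N ->
  is_linrep iota (@form_1g K d m b' b B b'' c' c lg) g ->
  is_linrep iota (als1 Af lf) f ->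
  is_linrep iota (mul_star1 b' b B b'' c' c lg Af lf) (f * g).
Proof.
move=> n0 /linrep_isrep[/= A [s [t [AE [iA As _ us]]]]].
move=> /linrep_isrep[/= Pf [sf [tf [AfE [iAf Asf _ usf]]]]].
pose X k : 'M[K]_(m + 1) := drsubmx (A k).
pose Y k : 'M[K]_(1, m + 1) := ursubmx (A k).
have XE : block_mx B b'' c' c = pencil_mx X by rewrite -drsub_pencil_mx -AE block_mxKdr.
have YE : row_mx b' b = pencil_mx Y by rewrite -ursub_pencil_mx -AE block_mxKur.
have evA : ev kap y A = block_mx 1%:M (ev kap y Y) 0 (ev kap y X).
  by rewrite -!map_pencil_mx -AE XE YE map_block_mx map_mx0 map_mx1.
have iX : invertible_mx (ev kap y X) by rewrite evA in iA; exact: invertible_ublock_r iA.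
pose s1 := usubmx s; pose s2 := dsubmx s.
have s1E : s1 = g%:M.
  rewrite -us -[s]vsubmxK map_row_mx map_mx0 map_mx1 mul_row_col mul0mx addr0.
  by rewrite mul1mx.
have [Ys Xs] : s1 + ev kap y Y *m s2 = 0 /\
    ev kap y X *m s2 = km (col_mx 0 lg%:M).
  have := As; rewrite evA -[X in _ *m X = _](vsubmxK s) mul_block_col mul1mx mul0mx.
  by rewrite add0r map_col_mx map_mx0 => /eq_col_mx.
pose vf := lf *: e_last K n.
pose Z k : 'M[K]_(n + (m + 1)) := block_mx (Pf k) (vf *m Y k) 0 (X k).
have -> : mul_star1 b' b B b'' c' c lg Af lf = LinSys (row_mx (e_first K n) 0)
    (pencil_mx Z) (col_mx 0 (col_mx 0 lg%:M)).
  rewrite /mul_star1 /Z pencil_mx_block pencil_mx0 -XE -AfE; congr (LinSys _ _ _).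
  by rewrite -mul_mx_row YE cst_mul_pencil.
have evZ : ev kap y Z = block_mx (ev kap y Pf) (km vf *m ev kap y Y) 0 (ev kap y X).
  by rewrite /Z ev_block_mx ev0 evMl.
have [|||t' rep'] := @isrepI _ _ _ iota _ (row_mx (e_first K n) 0) Z
  (col_mx 0 (col_mx 0 lg%:M)) (col_mx (sf *m g%:M) s2) (f * g); last exact: isrep_linrep rep'.
- by rewrite evZ; exact: invertible_ublock.
- rewrite evZ mul_block_col mul0mx add0r Xs [RHS]map_col_mx map_mx0; congr col_mx.
  by rewrite mulmxA Asf -mulmxA -mulmxDr -s1E Ys mulmx0.
rewrite map_row_mx map_mx0 mul_row_col mul0mx addr0 mulmxA scalar_mxM.
by rewrite usf.
Qed.

End Constructions.

Lemma e_last_catl (K : fieldType) m n : (0 < n)%N ->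
  e_last K (m + n) = col_mx 0 (e_last K n).
Proof.
move=> n0; apply/matrixP => i j; rewrite mxE.
case: (split_ordP i) => k ->; rewrite ?col_mxEu ?col_mxEd mxE /=.
  by rewrite ltn_eqF//; have := ltn_ord k; lia.
by rewrite -addnS eqn_add2l.
Qed.

Lemma row_free_leq (K : fieldType) m n (A : 'M[K]_(m, n)) : row_free A -> (m <= n)%N.
Proof. by move=> /eqP <-; exact: rank_leq_col. Qed.

Lemma unit_first_last (K : fieldType) n (r1 r2 : 'rV[K]_n) :
  row_free (col_mx r1 r2) -> exists2 Q : 'M[K]_n, Q \in unitmx &
    r1 *m Q = e_first K n /\ r2 *m Q = (e_last K n)^T.
Proof.
move=> fr; have n2 : (2 <= n)%N := row_free_leq fr.
have [m nE] : exists m, n = (1 + m + 1)%N by exists (n - 2)%N; lia.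
subst n; have [N uX] := complete_rows fr.
set X := col_mx _ _ in uX; exists (invmx X); first by rewrite unitmx_inv.
have E1 : e_first K (1 + m + 1) *m X = r1.
  by rewrite e_first_row2 /X !mul_row_col mul1mx !mul0mx !addr0.
have E2 : (e_last K (1 + m + 1))^T *m X = r2.
  by rewrite e_last_col tr_col_mx trmx0 trmx1 /X mul_row_col mul0mx add0r mul1mx.
by rewrite -{1}E1 -{1}E2 !mulmxK.
Qed.

Section Forms.

Variables (K : fieldType) (d : nat).
Local Notation KX := {freealg K, d}.
Local Notation pencil := (pencil K d).
Variables (F : unitAlgType K) (iota : {lrmorphism KX -> F}).
Hypothesis univ : is_universal_field_of_fractions iota.
Local Notation y := (gen iota).
Local Notation kap := (in_alg F).
Local Notation km := (map_mx (in_alg F)).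
Local Notation isrep := (isrep (in_alg F) y).

Let F_skew : is_skew_field F := let: And3 (conj h _) _ _ := univ in h.
Let y0 : y ord0 = 1 := gen0 iota.
Let hollowP := universal_hollow univ.

Lemma pencil_mx_col m n p (A : pencil m n) (B : pencil p n) :
  pencil_mx (fun k => col_mx (A k) (B k)) = col_mx (pencil_mx A) (pencil_mx B).
Proof.
apply/matrixP => i j; rewrite mxE; case: (split_ordP i) => l ->;
  rewrite (col_mxEu, col_mxEd) mxE; apply: eq_bigr => k _;
  by rewrite (col_mxEu, col_mxEd).
Qed.

Lemma pencil_mx_row m n p (A : pencil m n) (B : pencil m p) :
  pencil_mx (fun k => row_mx (A k) (B k)) = row_mx (pencil_mx A) (pencil_mx B).
Proof.
apply/matrixP => i j; rewrite mxE; case: (split_ordP j) => l ->;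
  rewrite (row_mxEl, row_mxEr) mxE; apply: eq_bigr => k _;
  by rewrite (row_mxEl, row_mxEr).
Qed.

Lemma mul_pconst m n p (M : 'M[K]_(m, n)) (N : 'M_(n, p)) k :
  (pconst M : pencil m n) k *m N = (pconst (M *m N) : pencil m p) k.
Proof. by rewrite /pconst; case: eqP => _; rewrite ?mul0mx. Qed.

Lemma mul_pconstr m n p (M : 'M[K]_(m, n)) (N : 'M_(n, p)) k :
  M *m (pconst N : pencil n p) k = (pconst (M *m N) : pencil m p) k.
Proof. by rewrite /pconst; case: eqP => _; rewrite ?mulmx0. Qed.

Lemma km_scalarE a : km a%:M = (kap a)%:M :> 'M_1.
Proof. exact: km_scalar. Qed.

Lemma one_elt_indep (f : F) (w0 w1 : 'M[K]_1) : (forall c : K, f <> c%:A) ->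
  km w0 *m f%:M + km w1 = 0 -> w0 = 0 /\ w1 = 0.
Proof.
move=> fK E; suff w00 : w0 = 0.
  by move: E; rewrite w00 map_mx0 mul0mx add0r => /(km_eq0 (kap := kap)).
apply/eqP; apply: contraT => w0n.
have a0 : w0 0 0 != 0.
  by apply: contraNneq w0n => w00; rewrite [w0]mx11_scalar w00 raddf0.
case: (fK (- (w0 0 0)^-1 * w1 0 0)); rewrite -[_%:A]/(kap _) rmorphM rmorphN.
have -> : f = kap (w0 0 0)^-1 * (kap (w0 0 0) * f).
  by rewrite mulrA -rmorphM mulVf// rmorph1 mul1r.
have : kap (w0 0 0) * f + kap (w1 0 0) = 0.
  have := congr1 (fun M : 'M_1 => M 0 0) E.
  by rewrite !mxE big_ord1 !mxE eqxx mulr1n.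
by move/eqP; rewrite addr_eq0 => /eqP ->; rewrite mulrN mulNr.
Qed.

Lemma als1_ex S f : is_linrep iota S f -> f != 0 -> lhs S = e_first K (sdim S) ->
  exists (A : 'M_(sdim S)) l, adm_transf S (als1 A l).
Proof.
move=> /linrep_isrep[A [s [t [AE [iA As tA us]]]]] f0.
case: S => n u M v /= in A s t AE iA As tA us * => uE.
have v0 : v != 0.
  apply: contraNneq f0 => v0; move: As; rewrite v0 map_mx0 => As0.
  have [Ai [_ AiA]] := iA.
  have s0 : s = 0 by rewrite -[s]mul1mx -AiA -mulmxA As0 mulmx0.
  by have := congr1 (fun M : 'M_1 => M 0 0) us; rewrite s0 mulmx0 !mxE eqxx mulr1n => <-.
have [b bv] : exists b : 'rV_n, b *m v = 1%:M.
  have [i vi] : exists i, v i 0 != 0.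
    apply: contrapT => no; case/eqP: v0; apply/matrixP => i j.
    rewrite ord1 [RHS]mxE; apply/eqP; apply: contraT => vi; case: no; by exists i.
  exists ((v i 0)^-1 *: delta_mx 0 i); rewrite -scalemxAl -rowE.
  by rewrite [row i v]mx11_scalar mxE scale_scalar_mx mulVf.
have n0 : (0 < n)%N.
  rewrite lt0n; apply: contraNneq v0 => n0; apply/eqP/matrixP => i.
  by have := ltn_ord i; rewrite [X in (_ < X)%N]n0.
have [n' nE] : exists n', n = (n' + 1)%N by exists (n - 1)%N; lia.
subst n; have [N [Nv uP]] := complete_last bv.
exists (cst d (col_mx N b) *m M *m cst d 1%:M), 1, (col_mx N b), 1%:M; split=> //.
- exact: unitmx1.
- by move=> i i0; rewrite e_first_rowE// mulmx1.
rewrite /transform /als1 /= uE mulmx1; congr LinSys.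
by rewrite scale1r mul_col_mx Nv bv e_last_col.
Qed.

(** Write [1 = c s]. As [f] is not a scalar, [c] is independent of [e_1], so a column change turns
    it into the last coordinate. By [relation_row] the equation [c s = 1] is a combination [b] of
    the rows, and [b] is taken as last row of [P]. *)
Lemma form_f1_ex S f : is_minimal iota S f -> lhs S = e_first K (sdim S) ->
  (forall c : K, f <> c%:A) -> in_L iota f 1 ->
  exists (m : nat) a b' b a' B b'' lf,
    adm_transf S (@form_f1 K d m a b' b a' B b'' lf).
Proof.
move=> Smin uE fK f1; have [A [s [t [AE rep]]]] := linrep_isrep Smin.1.
have [is_ it] := minimal_indep univ Smin rep.
have [c cs] := (in_LE univ 1 Smin AE rep).1 f1.
case: S => n u M v /= in uE A s t AE rep is_ it c cs {Smin} *.
have [_ _ _ us] := rep.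
have fr : row_free (col_mx (e_first K n) c).
  apply: inj_row_free => w; rewrite -[w](hsubmxK (n1 := 1)) mul_row_col => wE.
  have := congr1 (fun M => km M *m s) wE.
  rewrite map_mxD !map_mxM mulmxDl -!mulmxA cs -uE us map_mx0 mul0mx mulmx1.
  by move=> /(one_elt_indep fK)[-> ->]; rewrite row_mx0.
have n2 : (2 <= n)%N := row_free_leq fr.
have [m nE] : exists m, n = (1 + m + 1)%N by exists (n - 2)%N; lia.
subst n; have [Q uQ [eQ cQ]] := unit_first_last fr.
have [|b [bA bv]] := @relation_row _ _ _ _ _ (@in_algC _ _) hollowP _ _ _ _ _ _ _
  (pconst c) 1%:M rep is_.
  by rewrite ev_const// cs map_mx1.
have [N [Nv uP]] := complete_last (esym bv).
pose T := pencil_mx (fun k => N *m A k *m Q).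
exists m, (ulsubmx (lsubmx T)), (ursubmx (lsubmx T)), (usubmx (rsubmx T)),
  (dlsubmx (lsubmx T)), (drsubmx (lsubmx T)), (dsubmx (rsubmx T)), 1.
exists (col_mx N b), Q; split=> //.
  by move=> i i0; rewrite e_first_rowE.
rewrite /transform /form_f1 /= uE eQ e_first_row2 AE cst_mul_pencil pencil_mul_cst.
rewrite mul_col_mx Nv -bv; congr LinSys.
have -> : pencil_mx (fun k => col_mx N b *m A k *m Q) = col_mx T (cst d (row_mx 0 1%:M)).
  rewrite /T cst_pencil_mx -pencil_mx_col; apply: eq_pencil_mx => k.
  by rewrite !mul_col_mx -bA mul_pconst cQ e_last_col tr_col_mx trmx0 trmx1.
by rewrite /cst map_row_mx map_mx0 map_mx1 submxK vsubmxK block_mxEv hsubmxK.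
Qed.

(** Dually, write [1 = t mu]. The columns [mu] and [v] are independent because [t v = g] is not a
    scalar, so a row change makes them the first and last unit columns. By [relation_col], [mu] is a
    combination [b] of the columns of the pencil, and [b] is taken as first column of [Q]. *)
Lemma form_1g_ex S g : is_minimal iota S g -> lhs S = e_first K (sdim S) ->
  (forall c : K, g <> c%:A) -> in_R iota g 1 ->
  exists (m : nat) b' b B b'' c' c lg,
    adm_transf S (@form_1g K d m b' b B b'' c' c lg).
Proof.
move=> Smin uE gK g1; have [A [s [t [AE rep]]]] := linrep_isrep Smin.1.
have [is_ it] := minimal_indep univ Smin rep.
have [mu tmu] := (in_RE univ 1 Smin AE rep).1 g1.
case: S => n u M v /= in uE A s t AE rep is_ it mu tmu {Smin} *.
have tv := isrep_tv rep.
have fr : row_free (col_mx mu^T v^T).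
  apply: inj_row_free => w; rewrite -[w](hsubmxK (n1 := 1)) mul_row_col => wE.
  have E : mu *m (lsubmx w)^T + v *m (rsubmx w)^T = 0.
    by apply: trmx_inj; rewrite raddfD /= !trmx_mul !trmxK wE trmx0.
  have := congr1 (fun M => t *m km M) E.
  rewrite map_mxD !map_mxM mulmxDr !mulmxA tmu tv map_mx0 mulmx0 mul1mx.
  have -> : g%:M *m km (rsubmx w)^T = km (rsubmx w)^T *m g%:M.
    rewrite [(rsubmx w)^T]mx11_scalar km_scalarE -!scalar_mxM.
    by rewrite in_algC.
  rewrite addrC => /(one_elt_indep gK)[/(congr1 trmx) + /(congr1 trmx)].
  by rewrite !trmxK !trmx0 => -> ->; rewrite row_mx0.
have n2 : (2 <= n)%N := row_free_leq fr.
have [m nE] : exists m, n = (1 + (m + 1))%N by exists (n - 2)%N; lia.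
subst n; have [P uP [muP vP]] := unit_first_last fr.
have [|b [bA bu]] := @relation_col _ _ _ _ _ (@in_algC _ _) hollowP _ _ _ _ _ _ _
  (pconst mu) 1%:M rep it.
  by rewrite ev_const// tmu map_mx1.
(* From [u b = 1] with [u = e_1]: the first entry of [b] is [1], which makes [Q] invertible with
   first row [e_1], as admissibility requires. *)
have ub : usubmx b = 1%:M.
  by rewrite bu uE e_first_row -[in RHS](vsubmxK b) mul_row_col mul1mx mul0mx addr0.
pose R : 'M[K]_(1 + (m + 1), m + 1) := col_mx 0 1%:M.
pose Q := row_mx b R.
have QE : Q = block_mx 1%:M 0 (dsubmx b) 1%:M.
  by rewrite block_mxEh -ub vsubmxK.
have uQ : Q \in unitmx by rewrite QE unitmxE det_lblock !det1 mulr1 unitr1.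
have eQ : e_first K (1 + (m + 1)) *m Q = e_first K (1 + (m + 1)).
  by rewrite e_first_row QE mul_row_block !mul1mx !mul0mx !addr0.
pose T := pencil_mx (fun k => P^T *m A k *m R).
exists m, (lsubmx (usubmx T)), (rsubmx (usubmx T)), (ulsubmx (dsubmx T)),
  (ursubmx (dsubmx T)), (dlsubmx (dsubmx T)), (drsubmx (dsubmx T)), 1.
exists P^T, Q; split=> //.
- by rewrite unitmx_tr.
- by move=> i i0; rewrite e_first_rowE.
rewrite /transform /form_1g /= uE eQ e_first_row AE cst_mul_pencil pencil_mul_cst.
have -> : P^T *m v = col_mx 0 (col_mx 0 1%:M).
  rewrite -e_last_col -e_last_catl ?addn1//; apply: trmx_inj.
  by rewrite trmx_mul trmxK vP.
congr LinSys.
have -> : pencil_mx (fun k => P^T *m A k *m Q) = row_mx (cst d (col_mx 1%:M 0)) T.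
  rewrite /T cst_pencil_mx -pencil_mx_row; apply: eq_pencil_mx => k.
  rewrite mul_mx_row -mulmxA -bA mul_pconstr; congr (row_mx (pconst _ k) _).
  apply: trmx_inj; rewrite trmx_mul trmxK muP tr_col_mx trmx1 trmx0.
  exact: e_first_row.
by rewrite /cst map_col_mx map_mx0 map_mx1 submxK hsubmxK block_mxEh vsubmxK.
Qed.

End Forms.

Section Products.

Variables (K : fieldType) (d : nat).
Local Notation KX := {freealg K, d}.
Local Notation pencil := (pencil K d).
Variables (F : unitAlgType K) (iota : {lrmorphism KX -> F}).
Local Notation y := (gen iota).
Local Notation kap := (in_alg F).
Local Notation km := (map_mx (in_alg F)).
Local Notation isrep := (isrep (in_alg F) y).

Lemma minimal_dim S S' f :
  is_minimal iota S f -> is_minimal iota S' f -> sdim S = sdim S'.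
Proof.
move=> [rep min] [rep' min']; apply/eqP.
by rewrite eqn_leq min//= min'.
Qed.

Lemma rank_le_dim f g h S S' T : is_minimal iota S f -> is_minimal iota S' g ->
  is_linrep iota T h -> rank_le iota f g h -> (sdim S + sdim S' <= sdim T + 1)%N.
Proof.
move=> Sf Sg Th [_ [_ [_ [[S1 S1f <-] [S2 S2g <-] [S3 [_ S3h] <-] le]]]].
rewrite (minimal_dim Sf S1f) (minimal_dim Sg S2g).
by apply: (leq_trans le); rewrite leq_add2r S3h.
Qed.

Lemma mul_star_starE Sf Sg (Af : pencil _ _) (Ag : pencil _ _) :
  mat Sf = pencil_mx Af -> mat Sg = pencil_mx Ag ->
  mul_star_star Sf Sg = LinSys (row_mx (lhs Sf) 0)
    (pencil_mx (mul_pencil Af (rhs Sf) (lhs Sg) Ag)) (col_mx 0 (rhs Sg)).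
Proof.
move=> AfE AgE; rewrite /mul_star_star /mul_pencil pencil_mx_block pencil_mx0.
by rewrite -AfE -AgE -cst_pencil_mx /cst map_mxN map_mxM.
Qed.

Hypothesis univ : is_universal_field_of_fractions iota.

Let F_skew : is_skew_field F := let: And3 (conj h _) _ _ := univ in h.
Let y0 : y ord0 = 1 := gen0 iota.
Let hollowP := universal_hollow univ.

Lemma mul_star_star_minimal f g Sf Sg : g != 0 ->
  is_minimal iota Sf f -> is_minimal iota Sg g -> left_factor iota f (f * g) ->
  ~ in_R iota g 1 -> ~ in_L iota f 1 ->
  is_minimal iota (mul_star_star Sf Sg) (f * g).
Proof.
move=> g0 Sfmin Sgmin [f0 fg0 rank1 rank2] R1 L1.
have uf := F_skew f0; have ug := F_skew g0.
(* The inequalities now compare [f], [g] with [f g] and [g^-1], [f^-1] with [g^-1 f^-1]. *)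
rewrite mulKr// in rank1; rewrite invrM// mulrVK// in rank2.
have [Af [sf [tf [AfE repf]]]] := linrep_isrep Sfmin.1.
have [Ag [sg [tg [AgE repg]]]] := linrep_isrep Sgmin.1.
have [isf itf] := minimal_indep univ Sfmin repf.
have [isg itg] := minimal_indep univ Sgmin repg.
(* The rank inequality itself carries minimal systems of [g^-1] and [f^-1]. *)
have [_ [_ [_ [[Sj Sjmin _] [Si Simin _] _ _]]]] := rank2.
have [Ai [si [ti [AiE repi]]]] := linrep_isrep Simin.1.
have [Aj [sj [tj [AjE repj]]]] := linrep_isrep Sjmin.1.
have [isi iti] := minimal_indep univ Simin repi.
have [isj itj] := minimal_indep univ Sjmin repj.
have min1 n u (A : pencil n n) v s t : isrep u A v s t (f * g) ->
    (sdim Sf + sdim Sg <= n + 1)%N.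
  by move=> /isrep_linrep rep; exact: (rank_le_dim Sfmin Sgmin rep rank1).
have min2 n u (A : pencil n n) v s t : isrep u A v s t (g^-1 * f^-1) ->
    (sdim Sj + sdim Si <= n + 1)%N.
  by move=> /isrep_linrep rep; exact: (rank_le_dim Sjmin Simin rep rank2).
have f1 (c : 'rV_(sdim Sf)) : km c *m sf <> 1%:M.
  by move=> cs; apply: L1; apply/(in_LE univ 1 Sfmin AfE repf); exists c.
have g1 (c : 'cV_(sdim Sg)) : tg *m km c <> 1%:M.
  by move=> ct; apply: R1; apply/(in_RE univ 1 Sgmin AgE repg); exists c.
have il := product_left_indep F_skew (@in_algC _ _) y0 hollowP f0 g0 repf isf itf
  repg isg itg repi isi repj isj itj min1 min2 f1 g1.
have ir := product_right_indep F_skew (@in_algC _ _) y0 hollowP f0 g0 repf isf itf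
  repg isg itg repi isi iti repj itj min1 min2 f1 g1.
have rep := isrep_mul y0 repf repg.
rewrite (mul_star_starE AfE AgE); split; first exact: isrep_linrep rep.
move=> S' /linrep_isrep[A' [s' [t' [_ rep']]]].
exact: (indep_minimal univ rep il ir rep').
Qed.

End Products.

Theorem theorem4p2 (K : fieldType) (d : nat) (hd : (0 < d)%N)
  (F : unitAlgType K) (iota : {lrmorphism {freealg K, d} -> F})
  (hF : is_universal_field_of_fractions iota)
  (f g : F) (hf : forall c : K, f <> c%:A) (hg : forall c : K, g <> c%:A)
  (Sf Sg : linsys K d)
  (hSf : is_minimal_als iota Sf f) (hSg : is_minimal_als iota Sg g)
  (hfact : left_factor iota f (f * g)) :
  let n := (sdim Sf + sdim Sg)%N in
  [/\ (* (a) *)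
      in_L iota f 1 ->
      [/\ exists (m : nat) a b' b a' B b'' lf,
            adm_transf Sf (@form_f1 K d m a b' b a' B b'' lf),
          exists (Ag : 'M_(sdim Sg)) lg, adm_transf Sg (als1 Ag lg)
        & forall (m : nat) a b' b a' B b'' lf (Ag : 'M_(sdim Sg)) lg,
            adm_transf Sf (@form_f1 K d m a b' b a' B b'' lf) ->
            adm_transf Sg (als1 Ag lg) ->
            let S := mul_1star a b' b a' B b'' lf (als1 Ag lg) in
            is_minimal_als iota S (f * g) /\ sdim S = (n - 1)%N],
      (* (b) *)
      in_R iota g 1 ->
      [/\ exists (m : nat) b' b B b'' c' c lg,
            adm_transf Sg (@form_1g K d m b' b B b'' c' c lg),
          exists (Af : 'M_(sdim Sf)) lf, adm_transf Sf (als1 Af lf)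
        & forall (m : nat) b' b B b'' c' c lg (Af : 'M_(sdim Sf)) lf,
            adm_transf Sg (@form_1g K d m b' b B b'' c' c lg) ->
            adm_transf Sf (als1 Af lf) ->
            let S := mul_star1 b' b B b'' c' c lg Af lf in
            is_minimal_als iota S (f * g) /\ sdim S = (n - 1)%N]
    & (* (c) *)
      ~ in_R iota g 1 -> ~ in_L iota f 1 ->
      let S := mul_star_star Sf Sg in
      is_minimal_als iota S (f * g) /\ sdim S = n].
Proof.
have F_skew : is_skew_field F by case: hF => -[].
have [Sfmin uf] := hSf; have [Sgmin ug] := hSg.
have [f0 _ rank1 _] := hfact.
have g0 : g != 0 by apply/eqP; have := hg 0; rewrite scale0r.
have nf0 : (0 < sdim Sf)%N.
  case: Sfmin => -[_ [Ai _ fE]] _; rewrite lt0n; apply: contraNneq f0 => nf0.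
  rewrite fE mxE big1// => i _; have := ltn_ord i.
  by rewrite [X in (_ < X)%N]nf0.
rewrite mulKr ?F_skew// in rank1.
have min1 S' : is_linrep iota S' (f * g) -> (sdim Sf + sdim Sg - 1 <= sdim S')%N.
  by move=> rep; have := rank_le_dim Sfmin Sgmin rep rank1; lia.
split.
- move=> L1; split; first exact: (form_f1_ex hF Sfmin uf hf L1).
    exact: (als1_ex Sgmin.1 g0 ug).
  move=> m a b' b a' B b'' lf Ag lg /(adm_linrep Sfmin.1)[repf /= nf].
  move=> /(adm_linrep Sgmin.1)[repg _].
  have nE : (1 + m + sdim Sg)%N = (sdim Sf + sdim Sg - 1)%N by lia.
  split=> //; split; last by rewrite /= e_first_row2.
  split; first exact: mul_1star_linrep repf repg.
  by move=> S' /min1; rewrite -nE.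
- move=> R1; split; first exact: (form_1g_ex hF Sgmin ug hg R1).
    exact: (als1_ex Sfmin.1 f0 uf).
  move=> m b' b B b'' c' c lg Af lf /(adm_linrep Sgmin.1)[repg /= ng].
  move=> /(adm_linrep Sfmin.1)[repf _].
  have nE : (sdim Sf + (m + 1))%N = (sdim Sf + sdim Sg - 1)%N by lia.
  split=> //; split; last by rewrite /= e_first_catr.
  split; first exact: (mul_star1_linrep nf0 repg repf).
  by move=> S' /min1; rewrite -nE.
move=> R1 L1; split=> //; split; last by rewrite /= e_first_catr// uf.
exact: mul_star_star_minimal.
Qed.
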